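(* Let $\kappa\ge 0$, $n\ge 2$, let $\Omega\subset M^n_\kappa$ be open, let $x_0\in\Omega$, let $\rho$ denote the Riemannian distance from $x_0$, and put $\sup\rho=\sup_{x\in\Omega}\rho(x)$. Let $v,V\colon(0,\sup\rho)\to[0,\infty)$ be smooth functions with $v$ nowhere zero, and let $H\colon(0,\sup\rho)\to\mathbb{R}$ be $(\rho,v)$-admissible for the dual Riccati pair $(L_\kappa,V)$ on $\Omega$; that is, $H$ is smooth and $$-H'(t)+\left(L_\kappa(t)-\frac{v'(t)}{v(t)}\right)H(t)-H(t)^2\ge V(t),\qquad\forall t\in(0,\sup\rho).$$ Then the following statements hold. (i) If $E_1(t)=(v(t)H(t))'+v(t)H(t)\left(L_\kappa(t)-2\,\mathbf{ct}_\kappa(t)\right)\ge 0$ for all $t\in(0,\sup\rho)$, then for every $u\in C_0^\infty(\Omega)$ one has $$\int_\Omega v(\rho)\,|\Delta_\kappa u|^2\,\mathrm{d}x_\kappa\ge\int_\Omega v(\rho)V(\rho)\,|\nabla^{\mathrm{rad}}_\kappa u|^2\,\mathrm{d}x_\kappa.$$ (ii) If $E_2(t)=2(v(t)H(t))'+v(t)H(t)\left(H(t)-2\,\mathbf{ct}_\kappa(t)\right)\ge 0$ for all $t\in(0,\sup\rho)$, then for every $u\in C_0^\infty(\Omega)$ one has $$\int_\Omega v(\rho)\,|\Delta_\kappa u|^2\,\mathrm{d}x_\kappa\ge\int_\Omega v(\rho)V(\rho)\,|\nabla_\kappa u|^2\,\mathrm{d}x_\kappa.$$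
   Context: For $\kappa\ge 0$, $(M^n_\kappa,g_\kappa)$ is the $n$-dimensional model space form of constant sectional curvature $-\kappa^2$: for $\kappa=0$ it is the Euclidean space $\mathbb{R}^n$; for $\kappa>0$ it is the hyperbolic space $\mathbb{H}^n_\kappa=\{x\in\mathbb{R}^n:|x|<1\}$. The metric is $(g_\kappa)_{ij}(x)=p_\kappa^2(x)\delta_{ij}$ with $p_0\equiv 1$ and $p_\kappa(x)=\frac{2}{\kappa(1-|x|^2)}$ for $\kappa>0$. Its volume form, gradient and Laplace–Beltrami operator are $\mathrm{d}x_\kappa=p_\kappa^n(x)\,\mathrm{d}x$, $\nabla_\kappa u=p_\kappa^{-2}\nabla u$ and $\Delta_\kappa u=p_\kappa^{-n}\operatorname{div}(p_\kappa^{n-2}\nabla u)$; $\langle\cdot,\cdot\rangle$ and $|\cdot|$ applied to vector fields are taken with respect to $g_\kappa$. The radial derivative is $\nabla^{\mathrm{rad}}_\kappa u=\langle\nabla_\kappa u,\nabla_\kappa\rho\rangle$. Define $\mathbf{ct}_\kappa\colon(0,\infty)\to(0,\infty)$ by $\mathbf{ct}_0(t)=\frac1t$ and $\mathbf{ct}_\kappa(t)=\kappa\coth(\kappa t)$ for $\kappa>0$, and $L_\kappa(t)=(n-1)\,\mathbf{ct}_\kappa(t)$. $C_0^\infty(\Omega)$ is the space of smooth real-valued functions with compact support in $\Omega$. *)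

(* Defs.v *)
From HB Require Import structures.
From mathcomp Require Import all_boot all_order all_algebra.
From mathcomp Require Import all_classical all_reals all_analysis.
Set Implicit Arguments.
Unset Strict Implicit.
Unset Printing Implicit Defensive.
Import Order.TTheory GRing.Theory Num.Theory.
Import numFieldNormedType.Exports.
Local Open Scope ring_scope.
Local Open Scope classical_set_scope.

(* Lebesgue measure on R^n, carried by [n.-tuple R] with its product (= Borel)
   sigma-algebra, and built one coordinate at a time from [lebesgue_measure]
   with the binary product measure. *)
Section LebesgueTuple.
Context {R : realType}.
Local Notation mR := (measurableTypeR R).

Definition tcons (n : nat) (p : n.-tuple mR * mR) : n.+1.-tuple mR :=
  [tuple of p.2 :: p.1].

Lemma measurable_tcons (n : nat) : measurable_fun setT (@tcons n).
Proof. exact: measurable_cons. Qed.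

Fixpoint lebesgue_tuple (n : nat) : {measure set (n.-tuple mR) -> \bar R} :=
  match n with
  | 0%N => dirac ([tuple] : 0.-tuple mR)
  | m.+1 =>
      measure_function_pushforward__canonical__measure_function_Measure
        (lebesgue_tuple m \x (@lebesgue_measure R))%E (measurable_tcons (n := m))
  end.

Lemma lebesgue_tuple_box (n : nat) (A : 'I_n -> set mR) :
  (forall i, measurable (A i)) ->
  lebesgue_tuple n [set t | forall i, A i (tnth t i)] =
  (\prod_(i < n) @lebesgue_measure R (A i))%E.
Proof.
elim: n A => [|n IH] A mA.
  rewrite big_ord0 /= diracE mem_set//=.
  by case.
rewrite big_ord_recl -(IH (fun i => A (lift ord0 i)))// muleC.
rewrite -product_measure1E//; last first.
  rewrite (_ : [set t | _] = \bigcap_(i in [set: 'I_n])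
    ((fun t : n.-tuple mR => tnth t i) @^-1` A (lift ord0 i))); last first.
    by apply/seteqP; split => [t At i _|t At i]; exact: At.
  apply: fin_bigcap_measurable => // i _.
  rewrite -[X in measurable X]setTI; exact: measurable_tnth.
rewrite /= /pushforward; congr (_ _); apply/seteqP; split => -[t x] /=.
- move=> At; split => [i|]; last exact: (At ord0).
  by have := At (lift ord0 i); rewrite tnthS.
- by move=> [At Ax] i; case: (unliftP ord0 i) => [j|] -> //; rewrite tnthS.
Qed.

End LebesgueTuple.

Section SmoothFunctions.
Context {R : realType}.

Definition smooth1_on (I : set R) (f : R -> R) : Prop :=
  forall (k : nat) (t : R), I t -> derivable (derive1n k f) t 1.

Definition partial (n : nat) (i : 'I_n) (f : 'rV[R]_n -> R) : 'rV[R]_n -> R :=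
  fun x => 'D_(delta_mx ord0 i) f x.

Definition iter_partial (n : nat) (s : seq 'I_n) (f : 'rV[R]_n -> R) :
    'rV[R]_n -> R := foldr (@partial n) f s.

Definition smooth_on (n : nat) (A : set 'rV[R]_n) (f : 'rV[R]_n -> R) : Prop :=
  forall (s : seq 'I_n) (x : 'rV[R]_n),
    A x -> differentiable (iter_partial s f) x.

(* Elements of C_0^oo(Omega) are represented by their extension by zero. *)
Definition test_function (n : nat) (Omega : set 'rV[R]_n) (u : 'rV[R]_n -> R) :
    Prop :=
  [/\ smooth_on Omega u,
      compact (closure [set x | u x != 0])
    & closure [set x | u x != 0] `<=` Omega].

End SmoothFunctions.

(* Tangent vectors are identified with elements of ['rV_n] in the global chart;
   [k] is the parameter of the model of constant curvature - k^2. *)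
Section SpaceForm.
Context {R : realType}.

(* The library norm on ['rV_n] is the sup norm (same topology). *)
Definition enorm (n : nat) (x : 'rV[R]_n) : R :=
  Num.sqrt (\sum_(i < n) x ord0 i ^+ 2).

Definition space_form (n : nat) (k : R) : set 'rV[R]_n :=
  if k == 0 then setT else [set x | enorm x < 1].

Definition conf (n : nat) (k : R) (x : 'rV[R]_n) : R :=
  if k == 0 then 1 else 2 / (k * (1 - enorm x ^+ 2)).

Definition riem_metric (n : nat) (k : R) (x X Y : 'rV[R]_n) : R :=
  conf k x ^+ 2 * \sum_(i < n) X ord0 i * Y ord0 i.

Definition riem_norm (n : nat) (k : R) (x X : 'rV[R]_n) : R :=
  Num.sqrt (riem_metric k x X X).

Definition C1_curve (n : nat) (c : R -> 'rV[R]_n) : Prop :=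
  (forall t, derivable c t 1) /\ continuous (derive1 c).

Definition curve_length (n : nat) (k : R) (c : R -> 'rV[R]_n) : R :=
  \int[@lebesgue_measure R]_(t in `[0, 1]) riem_norm k (c t) (derive1 c t).

(* Every C^1 curve on [0, 1] is the restriction of a C^1 curve on R; only its
   restriction to [0, 1] has to stay in the space form. *)
Definition curve_from_to (n : nat) (k : R) (x y : 'rV[R]_n)
    (c : R -> 'rV[R]_n) : Prop :=
  [/\ C1_curve c, c 0 = x, c 1 = y
    & forall t, 0 <= t <= 1 -> space_form k (c t)].

Definition riem_dist (n : nat) (k : R) (x y : 'rV[R]_n) : R :=
  inf [set curve_length k c | c in curve_from_to k x y].

Definition riem_grad (n : nat) (k : R) (u : 'rV[R]_n -> R) (x : 'rV[R]_n) :
    'rV[R]_n := \row_(i < n) (conf k x ^- 2 * partial i u x).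

Definition laplace_beltrami (n : nat) (k : R) (u : 'rV[R]_n -> R) (x : 'rV[R]_n) : R :=
  conf k x ^- n *
  \sum_(i < n) partial i (fun y => conf k y ^+ (n - 2) * partial i u y) x.

Definition grad_rad (n : nat) (k : R) (rho u : 'rV[R]_n -> R) (x : 'rV[R]_n) : R :=
  riem_metric k x (riem_grad k u x) (riem_grad k rho x).

(* Integral of a real function against conf^n dx, with values in [\bar R]: for
   a nonnegative integrand it is always meaningful, possibly [+oo]. *)
Definition riem_integral (n : nat) (k : R) (Omega : set 'rV[R]_n)
    (f : 'rV[R]_n -> R) : \bar R :=
  let pt (t : n.-tuple (measurableTypeR R)) : 'rV[R]_n :=
    \row_(i < n) tnth t i in
  (\int[lebesgue_tuple n]_(t in [set t | Omega (pt t)])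
     (f (pt t) * conf k (pt t) ^+ n)%:E)%E.

End SpaceForm.

Section Riccati.
Context {R : realType}.

Definition coth (t : R) : R :=
  (expR t + expR (- t)) / (expR t - expR (- t)).

Definition ct (k t : R) : R := if k == 0 then t^-1 else k * coth (k * t).

Definition Lct (n : nat) (k t : R) : R := (n.-1)%:R * ct k t.

(* The interval (0, sup_Omega rho), whose right end may be [+oo]. *)
Definition dist_range (n : nat) (Omega : set 'rV[R]_n) (rho : 'rV[R]_n -> R) :
    set R :=
  [set t | 0 < t /\ (t%:E < ereal_sup [set (rho x)%:E | x in Omega])%E].

Definition admissible (I : set R) (L v V H : R -> R) : Prop :=
  smooth1_on I H /\
  forall t, I t -> V t <=
    - derive1 H t + (L t - derive1 v t / v t) * H t - H t ^+ 2.

Definition E1 (n : nat) (k : R) (v H : R -> R) (t : R) : R :=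
  derive1 (fun s => v s * H s) t + v t * H t * (Lct n k t - 2 * ct k t).

Definition E2 (k : R) (v H : R -> R) (t : R) : R :=
  2 * derive1 (fun s => v s * H s) t + v t * H t * (H t - 2 * ct k t).

End Riccati.

(* Main.v *)
(* Let [r] be the radial derivative of [u], [s] the warping function ([skf], with
   [s' / s = ct]), [f = v H], and [F] a function of the distance [rho]. The
   divergence of [F <grad rho, grad u> grad u - F |grad u|^2 grad rho / 2] is
     [F r Delta u + (F' - F ct) r^2 - (F' + (n - 3) F ct) |grad u|^2 / 2],
   so expanding [v (Delta u - H r)^2 >= 0] with [F = f] and inserting the Riccati
   inequality gives, up to a divergence,
     [v (Delta u)^2 >= v V r^2 + E1 (|grad u|^2 - r^2)];
   (ii) follows from [E1 >= v V + E2]. The field is singular at the pole, so [F] is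
   [f] times a cut-off [chi] at scale [e] of [s(rho)]. Riccati makes
   [f / s^(n-1)] nonincreasing and [E1 >= 0] makes [f s^(n-3)] nondecreasing, so
   [f = O(s^(3-n))] and the terms with [chi'] integrate to [O(e^2)]; Fatou's lemma
   removes the cut-off.

   The identity needs derivatives of [rho], defined as an infimum of lengths. The
   chordal function [q = conf(x) conf(a) |x - a|^2] determines it: [chord_dist q]
   grows along a curve at most as fast as its length, with equality on Moebius
   images of radial segments. The divergence theorem in [R^n] for compactly
   supported functions is Fubini in one coordinate at a time. *)
Require Import Defs.
From HB Require Import structures.
From mathcomp Require Import all_boot all_order all_algebra.
From mathcomp Require Import all_classical all_reals all_analysis.
From mathcomp Require Import ring lra zify.
From mathcomp Require Import measurable_realfun.
Set Implicit Arguments.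
Unset Strict Implicit.
Unset Printing Implicit Defensive.
Import Order.TTheory GRing.Theory Num.Theory.
Import numFieldNormedType.Exports.
Local Open Scope ring_scope.
Local Open Scope classical_set_scope.

(** * Divergence theorem for compactly supported functions *)

(** Both inequalities are instances of [integral_lower_le_upper], for an abstract density [w] with
    [v V w <= riccati_weight * r^2 + tangential_weight * (|grad u|^2 - r^2)]: [w = r^2] in (i),
    [w = |grad u|^2] in (ii). The obstacle is that nothing is assumed of [v], [V], [H] at 0: [v H]
    may change sign and blow up, and neither integral is known to be finite. So two monotone
    quantities are needed, one for each sign of [v H], and terms are moved across an inequality only
    after the cut-off has made them integrable. The powers match in every dimension: on the shell
    [e < s(rho) < 2 e] the derivative of the cut-off is of order [1 / e] and [v H] of order
    [e^(3-n)], and the shell lies in a cube of volume of order [e^n]. As the cut-off takes values in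
    [0, 1] and both densities are nonnegative, it is dropped by monotonicity on the side of
    [Delta u], and only the other side needs Fatou. *)

Section PtMeasurable.
Context {R : realType} (n : nat).
Local Notation mR := (measurableTypeR R).

(** The measure lives on tuples, the topology on row vectors. This is the map hidden as [pt] in
    [riem_integral], to which it is convertible. *)
Definition row_of (t : n.-tuple mR) : 'rV[R]_n := \row_(i < n) tnth t i.

(** The sigma-algebra on tuples is the product one, so an open set has to be cut into boxes: [F q]
    is the box with rational centre and radius coded by [q] if it lies in [A], and is empty
    otherwise, which leaves a union over a countable type. *)
Lemma measurable_row_of_open (A : set 'rV[R]_n) : open A ->
  measurable [set t | A (row_of t)].
Proof.
move=> oA.
pose U := (n.-tuple rat * rat)%type.
pose B (q : U) : set (n.-tuple mR) := [set t : n.-tuple mR |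
  forall i, ball (ratr (tnth q.1 i) : R) (ratr q.2 : R) (tnth t i : R)].
pose F (q : U) := if `[< B q `<=` [set t | A (row_of t)] >] then B q else set0.
have -> : [set t | A (row_of t)] = \bigcup_q F q.
  apply/seteqP; split => t; last first.
    by move=> [q _]; rewrite /F; case: asboolP => // + ?; exact.
  move=> /= At.
  have /nbhs_ballP[e /= e0 eA] := open_nbhs_nbhs (conj oA At).
  (* Half of [e], because two points of a box can be almost [2 r] apart. *)
  have /rat_in_itvoo[r /[!in_itv]/= /andP[r0 re]] : 0 < e / 2 by rewrite divr_gt0.
  have qP i : exists q : rat, ball (ratr q : R) (ratr r) (tnth t i : R).
    have /rat_in_itvoo[q /[!in_itv]/= /andP[q0 qe]] :
      (tnth t i : R) - ratr r < (tnth t i : R) + ratr r by lra.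
    by exists q; rewrite /ball/= ltr_norml; lra.
  exists ([tuple sval (cid (qP i)) | i < n], r) => //; rewrite /F; case: asboolP => [_|[]].
    by move=> i; rewrite /= tnth_mktuple; exact: (svalP (cid (qP i))).
  move=> s Bs; apply: eA; split=> // i j; rewrite !mxE.
  have := Bs j; have := svalP (cid (qP j)); rewrite /= tnth_mktuple.
  set q := sval _; rewrite /ball/= !ltr_norml; lra.
apply: countable_bigcupT_measurable; first exact: countableP.
move=> q; rewrite /F; case: asboolP => // _.
rewrite (_ : B q = \bigcap_(i in [set: 'I_n]) ((fun t : n.-tuple mR => tnth t i)
    @^-1` ball (ratr (tnth q.1 i) : R) (ratr q.2 : R))); last first.
  by apply/seteqP; split => [t At i _|t At i]; exact: At.
apply: fin_bigcap_measurable => // i _.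
rewrite -[X in measurable X]setTI; apply: measurable_tnth => //.
by rewrite ball_itv; exact: measurable_itv.
Qed.

Lemma measurable_row_of_fun (A : set 'rV[R]_n) (g : 'rV[R]_n -> R) :
  open A -> (forall x, A x -> {for x, continuous g}) ->
  measurable_fun [set t | A (row_of t)] (g \o row_of : n.-tuple mR -> mR).
Proof.
move=> oA cg; apply: (measurability _ (RGenOpens.measurableE R)).
move=> _ [_ [a [b ->] <-]].
rewrite (_ : _ `&` _ =
  [set t | (A `&` g @^-1` [set` `]a, b[%R]) (row_of t)])//.
apply: measurable_row_of_open; rewrite openE => x [Ax gx].
apply: filterI; first exact: open_nbhs_nbhs.
by apply: (cg x Ax); apply: open_nbhs_nbhs; split => //; exact: interval_open.
Qed.

End PtMeasurable.

Section LebesgueTupleFubini.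
Context {R : realType}.
Local Notation mR := (measurableTypeR R).
Local Notation mu := (@lebesgue_measure R).

Lemma measurable_tuple_box (n : nat) (A : 'I_n -> set mR) :
  (forall i, measurable (A i)) -> measurable [set t | forall i, A i (tnth t i)].
Proof.
move=> mA; rewrite (_ : [set t | _] = \bigcap_(i in [set: 'I_n])
  ((fun t : n.-tuple mR => tnth t i) @^-1` A i)); last first.
  by apply/seteqP; split => [t At i _|t At i]; exact: At.
apply: fin_bigcap_measurable => // i _.
by rewrite -[X in measurable X]setTI; exact: measurable_tnth.
Qed.

Definition tuple_cube (n : nat) (a : 'rV[R]_n) (r : R) : set (n.-tuple mR) :=
  [set t | forall i, `[a ord0 i - r, a ord0 i + r]%classic (tnth t i)].

Lemma measurable_tuple_cube (n : nat) (a : 'rV[R]_n) (r : R) :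
  measurable (tuple_cube a r).
Proof.
apply: (@measurable_tuple_box n
  (fun i => `[a ord0 i - r, a ord0 i + r]%classic)) => i.
exact: measurable_itv.
Qed.

Lemma lebesgue_tuple_cube (n : nat) (a : 'rV[R]_n) (r : R) : 0 <= r ->
  lebesgue_tuple n (tuple_cube a r) = ((2 * r) ^+ n)%:E.
Proof.
move=> r0; rewrite (@lebesgue_tuple_box R n
  (fun i => `[a ord0 i - r, a ord0 i + r]%classic)); last first.
  by move=> i; exact: measurable_itv.
rewrite (eq_bigr (fun=> (2 * r)%:E)) => [|i _]; last first.
  rewrite lebesgue_measure_itv/= lte_fin.
  case: ifPn => [_|]; first by rewrite -EFinD; congr (_%:E); ring.
  (* The case [r = 0]: the degenerate cube, later used to see that the pole is a null set. *)
  by rewrite -leNgt => ?; congr (_%:E); lra.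
by rewrite prodEFin prodr_const card_ord.
Qed.

Lemma sigma_finite_lebesgue_tuple (n : nat) :
  sigma_finite setT (lebesgue_tuple n : set (n.-tuple mR) -> \bar R).
Proof.
exists (fun k => tuple_cube (0 : 'rV[R]_n) k%:R).
  apply/esym/seteqP; split => // t _.
  pose m := \big[maxn/0%N]_(i < n) (Num.truncn `|tnth t i : R|).+1.
  exists m => // i; rewrite /= mxE sub0r add0r in_itv/= -ler_norml.
  apply: (le_trans (ltW (truncnS_gt _))); rewrite ler_nat /m.
  exact: (leq_bigmax i).
move=> k; split; first exact: measurable_tuple_cube.
by rewrite lebesgue_tuple_cube// ltry.
Qed.

(* A copy of [lebesgue_tuple] that carries the sigma-finite structure, which
   product measures require. *)
Definition sfin_lebesgue_tuple (n : nat) : set (n.-tuple mR) -> \bar R :=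
  lebesgue_tuple n.

HB.instance Definition _ n := Measure.on (@sfin_lebesgue_tuple n).
HB.instance Definition _ n := @Measure_isSigmaFinite.Build _ _ _
  (@sfin_lebesgue_tuple n) (@sigma_finite_lebesgue_tuple n).

Local Open Scope ereal_scope.

(** Both orders are needed: a derivative in coordinate 0 is integrated with that coordinate
    innermost, while for a later coordinate it must be outermost, so that induction applies to the
    slices. *)
Lemma lebesgue_tuple_Fubini (n : nat) (f : n.+1.-tuple mR -> \bar R) :
  (lebesgue_tuple n.+1).-integrable setT f ->
  \int[lebesgue_tuple n.+1]_t f t =
    \int[lebesgue_tuple n]_t \int[mu]_x f [tuple of x :: t] /\
  \int[lebesgue_tuple n.+1]_t f t =
    \int[mu]_x \int[lebesgue_tuple n]_t f [tuple of x :: t].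
Proof.
move=> /integrableP[mf intf].
have mfc : measurable_fun setT (f \o @tcons R n).
  by apply: measurableT_comp => //; exact: measurable_tcons.
have intfc : (lebesgue_tuple n \x mu).-integrable setT (f \o @tcons R n).
  apply/integrableP; split => //; move: intf; rewrite /=.
  rewrite ge0_integral_pushforward//; [exact: measurable_tcons|].
  exact: measurableT_comp.
have -> : \int[lebesgue_tuple n.+1]_t f t =
    \int[lebesgue_tuple n \x mu]_t (f \o @tcons R n) t.
  by rewrite /= integral_pushforward//; exact: measurable_tcons.
split.
  have := @integral12_prod_meas1 _ _ _ _ _ (@sfin_lebesgue_tuple n) mu _ intfc.
  by rewrite /fubini_F => <-.
have := @integral21_prod_meas1 _ _ _ _ _ (@sfin_lebesgue_tuple n) mu _ intfc.
by rewrite /fubini_G => <-.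
Qed.

End LebesgueTupleFubini.

Section IntegralOfDerivative.
Context {R : realType}.
Local Notation mR := (measurableTypeR R).
Local Notation mu := (@lebesgue_measure R).

Lemma integral_derivative_compact_support (g d : R -> R) (r : R) :
  (forall x : R, is_derive x 1 g (d x)) -> continuous d ->
  (forall x, r < `|x| -> g x = 0) -> (forall x, r < `|x| -> d x = 0) ->
  (\int[mu]_x (d x)%:E = 0)%E.
Proof.
move=> dg cd g0 d0; pose b : R := `|r| + 1.
have rb : r < b by rewrite /b; have := ler_norm r; lra.
have b0 : 0 < b by rewrite /b; have := normr_ge0 r; lra.
transitivity (\int[mu]_(x in `[(- b)%R, b]) (d x)%:E)%E.
  rewrite [in RHS]integral_mkcond; apply: eq_integral => x _.
  rewrite patchE; case: ifPn => //; rewrite notin_setE/= in_itv/= -ler_norml.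
  by move=> /negP; rewrite -ltNge => xb; rewrite d0// (lt_trans rb).
rewrite (@continuous_FTC2 _ d g)//.
- by rewrite !g0 ?subee// ?normrN gtr0_norm.
- lra.
- exact: continuous_subspaceT.
- split; first by move=> x _; exact: ex_derive.
    by apply/cvg_at_right_filter/differentiable_continuous/derivable1_diffP/ex_derive.
  by apply/cvg_at_left_filter/differentiable_continuous/derivable1_diffP/ex_derive.
- by move=> x _; rewrite derive1E; exact: derive_val.
Qed.

Definition tset (n : nat) (t : n.-tuple mR) (i : 'I_n) (s : R) : n.-tuple mR :=
  [tuple if j == i then s else tnth t j | j < n].

Lemma tset_ord0 (n : nat) (t : n.-tuple mR) (x s : mR) :
  tset [tuple of x :: t] ord0 s = [tuple of s :: t].
Proof.
apply: eq_from_tnth => j; rewrite tnth_mktuple.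
by case: (unliftP ord0 j) => [k|] ->; rewrite ?tnthS.
Qed.

Lemma tset_lift (n : nat) (t : n.-tuple mR) (x s : mR) (i : 'I_n) :
  tset [tuple of x :: t] (lift ord0 i) s = [tuple of x :: tset t i s].
Proof.
apply: eq_from_tnth => j; rewrite tnth_mktuple.
case: (unliftP ord0 j) => [k|] ->; rewrite ?tnthS ?tnth_mktuple//.
Qed.

Lemma integrable_bounded_cube (n : nat) (d : n.-tuple mR -> R) (M r : R) :
  measurable_fun setT d -> (forall t, `|d t| <= M) ->
  (forall t, (exists j, r < `|tnth t j : R|) -> d t = 0) ->
  (lebesgue_tuple n).-integrable setT (EFin \o d).
Proof.
move=> md dM d0.
have mc := measurable_tuple_cube (0 : 'rV[R]_n) `|r|.
have -> : EFin \o d = ((EFin \o d) \_ (tuple_cube 0 `|r|)).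
  apply/funext => t; rewrite patchE; case: ifPn => //.
  rewrite notin_setE => nt /=; rewrite d0//; apply: contrapT => nex; apply: nt => i.
  rewrite /= mxE sub0r add0r in_itv/= -ler_norml leNgt; apply/negP => h.
  by apply: nex; exists i; apply: le_lt_trans h; exact: ler_norm.
apply/(integrable_mkcond _ mc)/measurable_bounded_integrable => //.
- by rewrite lebesgue_tuple_cube ?ltry.
- exact: measurable_funTS.
- exists M; split; first by rewrite num_real.
  by move=> x Mx t _; exact: (le_trans (dM t) (ltW Mx)).
Qed.

(** Induction on the dimension. The bound [M] and the radius [r] pass unchanged to slices, and
    differentiability is asked through [tset] in direction [i] only, so that a slice satisfies the
    hypotheses again. *)
Lemma integral_partial_compact_support (n : nat) (i : 'I_n)
    (g d : n.-tuple mR -> R) (M r : R) :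
  measurable_fun setT d -> (forall t, `|d t| <= M) ->
  (forall t, (exists j, r < `|tnth t j : R|) -> g t = 0) ->
  (forall t, (exists j, r < `|tnth t j : R|) -> d t = 0) ->
  (forall t (s : R), is_derive s 1 (fun s => g (tset t i s)) (d (tset t i s))) ->
  (forall t, continuous (fun s : R => d (tset t i s))) ->
  (\int[lebesgue_tuple n]_t (d t)%:E = 0)%E.
Proof.
elim: n i g d => [[]//|n IH] i g d md dM g0 d0 dg cd.
have id := integrable_bounded_cube md dM d0.
have [E1 E2] := lebesgue_tuple_Fubini id.
case: (unliftP ord0 i) => [j|] ij.
- rewrite E2; apply: integral0_eq => x _.
  apply: (IH j (fun t => g [tuple of x :: t]) (fun t => d [tuple of x :: t])) => //.
  + apply: measurableT_comp => //; exact: measurable_cons.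
  + by move=> t [k tk]; apply: g0; exists (lift ord0 k); rewrite tnthS.
  + by move=> t [k tk]; apply: d0; exists (lift ord0 k); rewrite tnthS.
  + move=> t s; have := dg [tuple of x :: t] s; rewrite ij.
    under eq_fun do rewrite tset_lift.
    by rewrite tset_lift.
  + move=> t; have := cd [tuple of x :: t]; rewrite ij.
    by under eq_fun do rewrite tset_lift.
- rewrite E1; apply: integral0_eq => t _.
  (* Any value will do: [tset] overwrites coordinate 0. *)
  have x0 := 0 : mR.
  apply: (@integral_derivative_compact_support
    (fun x => g [tuple of x :: t]) (fun x => d [tuple of x :: t]) r).
  + move=> s; have := dg [tuple of x0 :: t] s; rewrite ij.
    under eq_fun do rewrite tset_ord0.
    by rewrite tset_ord0.
  + have := cd [tuple of x0 :: t]; rewrite ij.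
    by under eq_fun do rewrite tset_ord0.
  + by move=> x rx; apply: g0; exists ord0.
  + by move=> x rx; apply: d0; exists ord0.
Qed.

End IntegralOfDerivative.

Section CompactSupport.
Context {R : realType}.
Local Notation mR := (measurableTypeR R).

Lemma is_derive_line (V W : normedModType R) (f : V -> W) (y v : V) (s : R) df :
  is_derive (s *: v + y) v f df -> is_derive s 1 (fun h : R => f (h *: v + y)) df.
Proof.
have E : (fun h : R => h^-1 *: (f (h *: v + (s *: v + y)) - f (s *: v + y))) =
    (fun h : R => h^-1 *: (f ((h *: (1 : R) + s) *: v + y) - f (s *: v + y))).
  by apply/funext => h; rewrite [h%:A]mulr1 scalerDl addrA.
by case=> fd <-; split; [move: fd; rewrite /derivable E|rewrite /derive E].
Qed.

Lemma derive_eq0_off_closed (V W : normedModType R) (K : set V) (g : V -> W) x v :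
  closed K -> (forall x, ~ K x -> g x = 0) -> ~ K x -> 'D_v g x = 0.
Proof.
move=> cK g0 nKx; rewrite (@near_eq_derive _ _ _ g (cst 0)); first exact: derive_cst.
have : nbhs x (~` K) by apply: open_nbhs_nbhs; split => //; exact: closed_openC.
by apply: filterS => y; exact: g0.
Qed.

Lemma compact_rV_coord_bounded (n : nat) (K : set 'rV[R]_n) : compact K ->
  exists r : R, 0 <= r /\ forall x, K x -> forall i, `|x ord0 i| <= r.
Proof.
move=> /compact_bounded[M [Mr KM]]; exists (`|M| + 1); split.
  by rewrite addr_ge0.
move=> x Kx i; have := KM (`|M| + 1) _ x Kx.
have -> : M < `|M| + 1 by have := ler_norm M; lra.
move=> /(_ isT); apply: le_trans; rewrite [leRHS]/Num.Def.normr/= mx_normrE.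
exact: (le_bigmax _ (fun j : 'I_1 * 'I_n => `|x j.1 j.2|) (ord0, i)).
Qed.

Lemma compact_support_bounded (n : nat) (K : set 'rV[R]_n) (f : 'rV[R]_n -> R) :
  compact K -> continuous f -> (forall x, ~ K x -> f x = 0) ->
  exists M : R, forall x, `|f x| <= M.
Proof.
move=> cK cf f0.
have /compact_bounded[M [Mr KM]] : compact (f @` K).
  by apply: continuous_compact => //; exact: continuous_subspaceT.
exists (`|M| + 1) => x; have [Kx|nKx] := pselect (K x); last first.
  by rewrite f0// normr0 addr_ge0.
by apply: KM; [have := ler_norm M; lra|exists x].
Qed.

Lemma integrable_compact_support (n : nat) (K : set 'rV[R]_n) (f : 'rV[R]_n -> R) :
  compact K -> continuous f -> (forall x, ~ K x -> f x = 0) ->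
  (lebesgue_tuple n).-integrable setT (fun t => (f (row_of t))%:E).
Proof.
move=> cK cf f0.
have [M fM] := compact_support_bounded cK cf f0.
have [r [r0 Kr]] := compact_rV_coord_bounded cK.
apply: (@integrable_bounded_cube _ _ (f \o @row_of R n) M r) => //=.
- exact: (measurable_row_of_fun openT (fun x _ => cf x)).
- move=> t [j rt]; apply: f0 => /Kr/(_ j); rewrite mxE leNgt => /negP; exact.
Qed.

Lemma row_of_tset (n : nat) (t : n.-tuple mR) (i : 'I_n) (s : R) :
  row_of (tset t i s) = s *: delta_mx ord0 i + row_of (tset t i 0).
Proof.
apply/rowP => j; rewrite !mxE !tnth_mktuple eqxx/=; case: ifPn => _.
  by rewrite mulr1 addr0.
by rewrite mulr0 add0r.
Qed.

Lemma integral_partial (n : nat) (i : 'I_n) (K : set 'rV[R]_n) (g : 'rV[R]_n -> R) :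
  compact K -> (forall x, ~ K x -> g x = 0) ->
  (forall x, derivable g x (delta_mx ord0 i)) -> continuous (partial i g) ->
  (\int[lebesgue_tuple n]_t (partial i g (row_of t))%:E = 0)%E.
Proof.
move=> cK g0 dg cdg.
have clK : closed K by apply: compact_closed.
have d0 x : ~ K x -> partial i g x = 0 by exact: derive_eq0_off_closed.
have [M fM] := compact_support_bounded cK cdg d0.
have [r [r0 Kr]] := compact_rV_coord_bounded cK.
have nK (t : n.-tuple mR) : (exists j, r < `|tnth t j : R|) -> ~ K (row_of t).
  by move=> [j rt] /Kr/(_ j); rewrite mxE leNgt => /negP; exact.
apply: (@integral_partial_compact_support _ _ i (g \o @row_of R n)
  (partial i g \o @row_of R n) M r) => //=.
- exact: (measurable_row_of_fun openT (fun x _ => cdg x)).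
- by move=> t /nK; exact: g0.
- by move=> t /nK; exact: d0.
- move=> t s; under eq_fun do rewrite row_of_tset.
  by rewrite [row_of (tset t i s)]row_of_tset; apply: is_derive_line; exact/derivableP.
- move=> t s.
  apply: (@continuous_comp _ _ _ (fun s => row_of (tset t i s))); last exact: cdg.
  rewrite (_ : (fun _ => _) = fun s => s *: delta_mx ord0 i + row_of (tset t i 0)).
    by apply: cvgD; [apply: cvgZr_tmp; exact: cvg_id|exact: cvg_cst].
  by apply/funext => ?; rewrite row_of_tset.
Qed.

End CompactSupport.

(** * Differential calculus of the conformal metric *)

Section DirectionalCalculus.
Context {R : realType} {V : normedModType R}.

(** Only directional derivability of [f] is assumed, so the chain rule is the one-variable one,
    applied on the line through [x] with direction [v]. *)
Lemma is_derive_comp1 (f : V -> R) (g : R -> R) (x v : V) (df dg : R) :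
  is_derive x v f df -> is_derive (f x) 1 g dg ->
  is_derive x v (g \o f) (dg * df).
Proof.
move=> fd gd.
have fl : is_derive (0 : R) 1 (fun h : R => f (h *: v + x)) df.
  by apply: is_derive_line; rewrite scale0r add0r.
have gl : is_derive (f (0 *: v + x)) 1 g dg by rewrite scale0r add0r.
have [] := is_derive1_comp gl fl; rewrite /derivable /derive.
have <- : (fun h : R => h^-1 *: ((g \o f) (h *: v + x) - (g \o f) x)) =
    (fun h : R => h^-1 *: ((g \o (fun h : R => f (h *: v + x))) (h *: 1 + 0) -
                          (g \o (fun h : R => f (h *: v + x))) 0)).
  by apply/funext => h /=; rewrite addr0 scale0r add0r [h%:A]mulr1.
by move=> gfd gfE; split.
Qed.

Lemma is_derive_inv (f : V -> R) (x v : V) (df : R) :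
  f x != 0 -> is_derive x v f df ->
  is_derive x v (fun y => (f y)^-1) (- (f x) ^- 2 * df).
Proof. by move=> f0 [fd <-]; split; [exact: derivableV|rewrite deriveV]. Qed.

(** These forms, with the functions applied to their argument and the value of the derivative
    explicit, let the derivative of a compound expression be built as a term and compared with the
    expected value by [ring] or [field]. *)
Lemma is_deriveDf (f g : V -> R) (x v : V) (df dg : R) :
  is_derive x v f df -> is_derive x v g dg ->
  is_derive x v (fun y => f y + g y) (df + dg).
Proof. exact: is_deriveD. Qed.

Lemma is_deriveBf (f g : V -> R) (x v : V) (df dg : R) :
  is_derive x v f df -> is_derive x v g dg ->
  is_derive x v (fun y => f y - g y) (df - dg).
Proof. exact: is_deriveB. Qed.

Lemma is_deriveMf (f g : V -> R) (x v : V) (df dg : R) :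
  is_derive x v f df -> is_derive x v g dg ->
  is_derive x v (fun y => f y * g y) (f x * dg + df * g x).
Proof.
move=> fd gd; rewrite [df * _]mulrC; exact: is_deriveM.
Qed.

Lemma is_deriveMlf (b : R) (f : V -> R) (x v : V) (df : R) :
  is_derive x v f df -> is_derive x v (fun y => b * f y) (b * df).
Proof. exact: is_deriveZ. Qed.

Lemma is_deriveXf (f : V -> R) (x v : V) (df : R) (m : nat) :
  is_derive x v f df ->
  is_derive x v (fun y => f y ^+ m) (m%:R * f x ^+ m.-1 * df).
Proof.
move=> fd; elim: m => [|m IH].
  by rewrite !mul0r; under eq_fun do rewrite expr0; exact: is_derive_cst.
under eq_fun do rewrite exprS.
apply: (is_derive_eq (is_deriveMf fd IH)); case: m {IH} => [|m]/=.
  by rewrite expr0; ring.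
by rewrite !mulrSr exprS; ring.
Qed.

Lemma is_derive_translate (W : normedModType R) (f : V -> W) (c x v : V) (df : W) :
  is_derive (c + x) v f df -> is_derive x v (fun y => f (c + y)) df.
Proof.
have E : (fun h : R => h^-1 *: (f (h *: v + (c + x)) - f (c + x))) =
    (fun h : R => h^-1 *: (f (c + (h *: v + x)) - f (c + x))).
  by apply/funext => h; rewrite addrCA.
by case=> fd <-; split; [move: fd; rewrite /derivable E|rewrite /derive E].
Qed.

Definition dot (n : nat) (x y : 'rV[R]_n) : R := \sum_(i < n) x ord0 i * y ord0 i.

Lemma dotC (n : nat) (x y : 'rV[R]_n) : dot x y = dot y x.
Proof. by apply: eq_bigr => i _; rewrite mulrC. Qed.

Lemma dotDl (n : nat) (x y z : 'rV[R]_n) : dot (x + y) z = dot x z + dot y z.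
Proof. by rewrite -big_split; apply: eq_bigr => i _; rewrite mxE mulrDl. Qed.

Lemma dotZl (n : nat) (k : R) (x z : 'rV[R]_n) : dot (k *: x) z = k * dot x z.
Proof. by rewrite mulr_sumr; apply: eq_bigr => i _; rewrite mxE mulrA. Qed.

Lemma dotDr (n : nat) (x y z : 'rV[R]_n) : dot z (x + y) = dot z x + dot z y.
Proof. by rewrite dotC dotDl !(dotC z). Qed.

Lemma dotZr (n : nat) (k : R) (x z : 'rV[R]_n) : dot z (k *: x) = k * dot z x.
Proof. by rewrite dotC dotZl (dotC z). Qed.

Lemma dotNl (n : nat) (x z : 'rV[R]_n) : dot (- x) z = - dot x z.
Proof. by rewrite -scaleN1r dotZl mulN1r. Qed.

Lemma dotNr (n : nat) (x z : 'rV[R]_n) : dot z (- x) = - dot z x.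
Proof. by rewrite dotC dotNl (dotC z). Qed.

Definition dotE := (dotDl, dotDr, dotZl, dotZr, dotNl, dotNr).

Lemma dot_ge0 (n : nat) (x : 'rV[R]_n) : 0 <= dot x x.
Proof. by apply: sumr_ge0 => i _; rewrite -expr2 sqr_ge0. Qed.

Lemma dot_eq0 (n : nat) (x : 'rV[R]_n) : dot x x = 0 -> x = 0.
Proof.
move=> /eqP; rewrite psumr_eq0 => [/allP x0|i _]; last by rewrite -expr2 sqr_ge0.
apply/rowP => i; rewrite mxE; apply/eqP.
by rewrite -sqrf_eq0 expr2; apply: x0; rewrite mem_index_enum.
Qed.

Lemma dot_gt0 (n : nat) (x : 'rV[R]_n) : x != 0 -> 0 < dot x x.
Proof.
move=> x0; rewrite lt_neqAle dot_ge0 andbT eq_sym.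
by apply: contra_neq x0; exact: dot_eq0.
Qed.

Lemma cauchy_schwarz_dot (n : nat) (x y : 'rV[R]_n) :
  dot x y ^+ 2 <= dot x x * dot y y.
Proof.
have [->|y0] := eqVneq y 0.
  by rewrite -(scale0r 0) !dotE !mul0r mulr0 expr0n.
have := dot_ge0 (dot y y *: x - dot x y *: y).
rewrite !dotE (dotC y x) => h; have yy := dot_gt0 y0.
rewrite -(ler_pM2l yy); nra.
Qed.

Lemma is_derive_coord (n : nat) (c : V -> 'rV[R]_n) (x v : V) (dc : 'rV[R]_n)
    (i : 'I_n) :
  is_derive x v c dc -> is_derive x v (fun y => c y ord0 i) (dc ord0 i).
Proof.
case=> cd <-; have /derivable_mxP/(_ ord0 i) ci := cd.
by split => //; rewrite derive_mx// mxE.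
Qed.

Lemma is_derive_dot (n : nat) (c e : V -> 'rV[R]_n) (x v : V) (dc de : 'rV[R]_n) :
  is_derive x v c dc -> is_derive x v e de ->
  is_derive x v (fun y => dot (c y) (e y)) (dot dc (e x) + dot (c x) de).
Proof.
move=> cd ed.
have -> : (fun y => dot (c y) (e y)) =
    \sum_(i < n) ((fun y => c y ord0 i) * (fun y => e y ord0 i)).
  by apply/funext => y; rewrite fct_sumE.
have ci i := is_derive_coord i cd; have ei i := is_derive_coord i ed.
apply: is_derive_eq; rewrite -big_split; apply: eq_bigr => i _.
by rewrite addrC /GRing.scale/=; congr (_ + _); rewrite mulrC.
Qed.

End DirectionalCalculus.

Section ConformalFactor.
Context {R : realType} (n : nat) (k : R).
Hypothesis k0 : 0 <= k.
Implicit Types x a : 'rV[R]_n.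

Lemma enorm_sqr x : enorm x ^+ 2 = dot x x.
Proof.
rewrite /enorm sqr_sqrtr; last by apply: sumr_ge0 => i _; rewrite sqr_ge0.
by apply: eq_bigr => i _; rewrite expr2.
Qed.

Lemma space_formP x : space_form k x <-> k = 0 \/ dot x x < 1.
Proof.
rewrite /space_form; case: ifPn => [/eqP ->|/eqP kn0]; first by split => // _; left.
have e0 : 0 <= enorm x by exact: sqrtr_ge0.
by rewrite -enorm_sqr expr_lt1//; split => [|[]//]; right.
Qed.

Lemma conf_gt0 x : space_form k x -> 0 < conf k x.
Proof.
rewrite space_formP /conf; case: eqVneq => //= kn0 [//|x1].
  by move/eqP: kn0.
have kp : 0 < k by rewrite lt_neqAle eq_sym kn0.
by rewrite enorm_sqr divr_gt0// mulr_gt0// subr_gt0.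
Qed.

Lemma conf_inv x : space_form k x ->
  (conf k x)^-1 = if k == 0 then 1 else k * (1 - dot x x) / 2.
Proof.
rewrite space_formP /conf; case: eqVneq => [_ _|kn0 [|x1]]; first by rewrite invr1.
  by move/eqP; rewrite (negbTE kn0).
by rewrite enorm_sqr invf_div.
Qed.

(* Clears the case distinction [k = 0] from the algebra of [conf]. *)
Lemma conf_norm_rel x : space_form k x ->
  k * (k * conf k x * (1 - dot x x) - 2) = 0.
Proof.
move=> xM; have p0 := conf_gt0 xM; have := conf_inv xM.
case: eqVneq => [->|kn0 E]; first by rewrite mul0r.
have -> : k * conf k x * (1 - dot x x) =
  conf k x * 2 * (k * (1 - dot x x) / 2) by field.
by rewrite -E; field; exact: lt0r_neq0.
Qed.

(** For [k != 0] the inverse of [conf] is affine in [|x|^2]; this is the difference of the two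
    inverses multiplied by [conf k x * conf k a]. For [k = 0] both sides vanish. *)
Lemma conf_norm_rel2 x a : space_form k x -> space_form k a ->
  conf k x - conf k a = k / 2 * conf k x * conf k a * (dot x x - dot a a).
Proof.
move=> xM aM; have p0 := conf_gt0 xM; have pa := conf_gt0 aM.
have := conf_norm_rel xM; have := conf_norm_rel aM.
have [k00 _ _|kn0 ha hx] := eqVneq k 0.
  by rewrite /conf k00 eqxx !mul0r subrr.
have {}ha : k * conf k a * (1 - dot a a) = 2.
  by apply/eqP; rewrite -subr_eq0; move/eqP: ha; rewrite mulf_eq0 (negbTE kn0).
have {}hx : k * conf k x * (1 - dot x x) = 2.
  by apply/eqP; rewrite -subr_eq0; move/eqP: hx; rewrite mulf_eq0 (negbTE kn0).
transitivity ((k * conf k a * (1 - dot a a) * conf k x -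
  k * conf k x * (1 - dot x x) * conf k a) / 2); first by rewrite ha hx; field.
by field.
Qed.

Section Derivatives.
Context {V : normedModType R} (c : V -> 'rV[R]_n) (x v : V) (dc : 'rV[R]_n).
Hypotheses (cM : space_form k (c x)) (cd : is_derive x v c dc).

Lemma is_derive_conf : is_derive x v (fun y => conf k (c y))
  (k * conf k (c x) ^+ 2 * dot (c x) dc).
Proof.
rewrite /conf; case: eqVneq => [->|kn0]; first by rewrite !mul0r; exact: is_derive_cst.
have d1 := is_derive_dot cd cd.
have d2 : is_derive x v (fun y => k * (1 - enorm (c y) ^+ 2))
    (- (2 * k * dot (c x) dc)).
  under eq_fun do rewrite enorm_sqr.
  by apply: is_derive_eq; rewrite /GRing.scale/= (dotC dc); ring.
have n0 : k * (1 - enorm (c x) ^+ 2) != 0.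
  rewrite enorm_sqr mulf_neq0// subr_eq0 gt_eqF//.
  by move/space_formP: cM => [] // /eqP; rewrite (negbTE kn0).
have -> : (fun y => 2 / (k * (1 - enorm (c y) ^+ 2))) =
    2 *: (fun y => (k * (1 - enorm (c y) ^+ 2))^-1) by [].
have d3 := @is_derive_inv _ _ (fun y => k * (1 - enorm (c y) ^+ 2)) _ _ _ n0 d2.
apply: is_derive_eq; rewrite /GRing.scale/=; field.
by move: n0; rewrite mulf_eq0 => /norP[-> ->].
Qed.

Lemma is_derive_confV : is_derive x v (fun y => (conf k (c y))^-1)
  (- k * dot (c x) dc).
Proof.
have p0 := lt0r_neq0 (conf_gt0 cM).
have d := @is_derive_inv _ _ (fun y => conf k (c y)) _ _ _ p0 is_derive_conf.
by apply: is_derive_eq; field.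
Qed.

End Derivatives.

(* The squared chordal distance: for [rho] the distance from [a] it is
   [(2 sinh (k rho / 2) / k) ^+ 2], and [rho ^+ 2] if [k = 0]. *)
Definition chord2 a x : R := conf k x * conf k a * dot (x - a) (x - a).

(* Half the Riemannian gradient of [chord2 a]; it is conformal, quadratic in the
   coordinates, and equals [s(rho)] times the gradient of [rho]. *)
Definition radial_field a x : 'rV[R]_n :=
  conf k a *: ((conf k x)^-1 *: (x - a) + (k / 2 * dot (x - a) (x - a)) *: x).

Lemma chord2_ge0 a x : space_form k a -> space_form k x -> 0 <= chord2 a x.
Proof.
by move=> aM xM; rewrite !mulr_ge0 ?dot_ge0// ltW// conf_gt0.
Qed.

Lemma is_derive_chord2 (V : normedModType R) (c : V -> 'rV[R]_n) (x v : V)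
    (dc a : 'rV[R]_n) : space_form k (c x) -> is_derive x v c dc ->
  is_derive x v (fun y => chord2 a (c y))
    (2 * conf k (c x) ^+ 2 * dot (radial_field a (c x)) dc).
Proof.
move=> cM cd; have p0 := lt0r_neq0 (conf_gt0 cM).
have dp := is_derive_conf cM cd.
have dm : is_derive x v (fun y => c y - a) dc.
  have -> : (fun y => c y - a) = c - cst a by [].
  by apply: is_derive_eq; rewrite subr0.
have dd := is_derive_dot dm dm.
have -> : (fun y => chord2 a (c y)) =
    conf k a *: ((fun y => conf k (c y)) * (fun y => dot (c y - a) (c y - a))).
  by apply/funext => y; rewrite /chord2 [conf k (c y) * _]mulrC -mulrA.
apply: is_derive_eq; rewrite /radial_field /GRing.scale/= !dotE !(dotC dc).
by field.
Qed.

(** With [chord2 = (2 sinh (k rho / 2) / k)^2] the right-hand side is [(sinh (k rho) / k)^2]: this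
    is what makes the gradient of [rho] a unit vector. *)
Lemma radial_field_norm a x : space_form k a -> space_form k x ->
  conf k x ^+ 2 * dot (radial_field a x) (radial_field a x) =
  chord2 a x + k ^+ 2 * chord2 a x ^+ 2 / 4.
Proof.
move=> aM xM; have p0 := lt0r_neq0 (conf_gt0 xM).
have r1 := conf_norm_rel xM; have /eqP := conf_norm_rel2 xM aM.
rewrite -subr_eq0 => /eqP r2; apply/eqP; rewrite -subr_eq0; apply/eqP.
(* The two sides differ by a combination of the two relations satisfied by [conf]; once the
   cofactors are given, [field] checks it. *)
transitivity (- conf k a * dot (x - a) (x - a) *
    (conf k x - conf k a - k / 2 * conf k x * conf k a * (dot x x - dot a a)) -
  conf k a ^+ 2 * conf k x * dot (x - a) (x - a) ^+ 2 / 4 *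
    (k * (k * conf k x * (1 - dot x x) - 2))); last first.
  by rewrite r1 r2; ring.
by rewrite /chord2 /radial_field !dotE (dotC a x); field.
Qed.

(* The matrix of derivatives of [radial_field a] is
   [radial_slope a x *: 1 + antisymmetric]. *)
Definition radial_slope a x : R :=
  conf k a * ((conf k x)^-1 + k / 2 * dot (x - a) (x - a)).

Lemma is_derive_radial_field (V : normedModType R) (c : V -> 'rV[R]_n) (x v : V)
    (dc a : 'rV[R]_n) (j : 'I_n) : space_form k (c x) -> is_derive x v c dc ->
  is_derive x v (fun y => radial_field a (c y) ord0 j)
    (radial_slope a (c x) * dc ord0 j + k * conf k a *
      (dot (c x - a) dc * c x ord0 j - dot (c x) dc * (c x - a) ord0 j)).
Proof.
move=> cM cd; have p0 := lt0r_neq0 (conf_gt0 cM).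
have dp := is_derive_confV cM cd.
have dm : is_derive x v (fun y => c y - a) dc.
  have -> : (fun y => c y - a) = c - cst a by [].
  by apply: is_derive_eq; rewrite subr0.
have dd := is_derive_dot dm dm.
have dj := is_derive_coord j cd; have dmj := is_derive_coord j dm.
have -> : (fun y => radial_field a (c y) ord0 j) =
    (fun y => conf k a * ((conf k (c y))^-1 * (c y - a) ord0 j +
      (k / 2 * dot (c y - a) (c y - a)) * c y ord0 j)).
  by apply/funext => y; rewrite /radial_field !mxE.
apply: (is_derive_eq (is_deriveMlf (conf k a) (is_deriveDf (is_deriveMf dp dmj)
  (is_deriveMf (is_deriveMlf (k / 2) dd) dj)))).
rewrite /radial_slope !dotE !(dotC dc) !mxE.
move: (conf k (c x))^-1 => q; by field.
Qed.

(** The left-hand side is the derivative of [ln conf] along the radial field plus the Euclidean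
    slope of that field. It is the factor by which half the Lie derivative of the metric along the
    field multiplies the metric; the right-hand side is [cosh (k rho)]. *)
Lemma conf_radial_slope a x : space_form k a -> space_form k x ->
  k * conf k x * dot (radial_field a x) x + radial_slope a x =
  1 + k ^+ 2 * chord2 a x / 2.
Proof.
move=> aM xM; have p0 := lt0r_neq0 (conf_gt0 xM).
have r1 := conf_norm_rel xM; have /eqP := conf_norm_rel2 xM aM.
rewrite -subr_eq0 => /eqP r2; apply/eqP; rewrite -subr_eq0; apply/eqP.
transitivity (- (conf k x)^-1 *
    (conf k x - conf k a - k / 2 * conf k x * conf k a * (dot x x - dot a a)) -
  conf k a * dot (x - a) (x - a) / 2 *
    (k * (k * conf k x * (1 - dot x x) - 2))); last first.
  by rewrite r1 r2; ring.
by rewrite /chord2 /radial_field /radial_slope !dotE (dotC a x); field.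
Qed.

End ConformalFactor.

(** * Warping function, its derivative, and the passage from chord to distance *)

Section RadialFunctions.
Context {R : realType} (k : R).
Hypothesis k0 : 0 <= k.
Implicit Types t q : R.

Definition skf t : R :=
  if k == 0 then t else (expR (k * t) - expR (- (k * t))) / (2 * k).

Definition ckf t : R :=
  if k == 0 then 1 else (expR (k * t) + expR (- (k * t))) / 2.

Lemma is_derive_expRM (b t : R) :
  is_derive t 1 (fun t => expR (b * t)) (b * expR (b * t)).
Proof.
have db : is_derive t 1 (fun t => b * t) b.
  by have := is_deriveMlf b (is_derive_id t 1); rewrite mulr1.
by have := is_derive_comp1 db (is_derive_expR (b * t)); rewrite mulrC.
Qed.

Lemma is_derive_skf t : is_derive t 1 skf (ckf t).
Proof.
rewrite /skf /ckf; case: eqVneq => [_|kn0]; first exact: is_derive_id.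
under eq_fun do rewrite -mulNr.
have d1 := is_derive_expRM k t; have d2 := is_derive_expRM (- k) t.
have -> : (fun t => (expR (k * t) - expR (- k * t)) / (2 * k)) =
  (2 * k)^-1 *: ((fun t => expR (k * t)) - (fun t => expR (- k * t))).
  by apply/funext => ?; exact: mulrC.
by apply: is_derive_eq; rewrite /GRing.scale/= !mulNr; field.
Qed.

Lemma is_derive_ckf t : is_derive t 1 ckf (k ^+ 2 * skf t).
Proof.
rewrite /skf /ckf; case: eqVneq => [->|kn0].
  by rewrite expr0n mul0r; exact: is_derive_cst.
under eq_fun do rewrite -mulNr.
have d1 := is_derive_expRM k t; have d2 := is_derive_expRM (- k) t.
have -> : (fun t => (expR (k * t) + expR (- k * t)) / 2) =
  2^-1 *: ((fun t => expR (k * t)) + (fun t => expR (- k * t))).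
  by apply/funext => ?; exact: mulrC.
by apply: is_derive_eq; rewrite /GRing.scale/= !mulNr; field.
Qed.

Lemma ckf_sqr t : ckf t ^+ 2 = 1 + k ^+ 2 * skf t ^+ 2.
Proof.
rewrite /ckf /skf; case: eqVneq => [->|kn0]; first by rewrite !expr0n/=; ring.
rewrite expRN; have e0 := lt0r_neq0 (expR_gt0 (k * t)).
by field; rewrite e0 kn0.
Qed.

Lemma ckf_gt0 t : 0 < ckf t.
Proof.
rewrite /ckf; case: eqVneq => // _.
by rewrite divr_gt0// addr_gt0// expR_gt0.
Qed.

Lemma skf_lt t t' : t < t' -> skf t < skf t'.
Proof.
have ds x : derivable skf x 1 by have [] := is_derive_skf x.
move=> tt'; apply: (@gtr0_derive1_lt_cc _ skf t t') => //.
- by move=> x _; have [_ +] := is_derive_skf x; rewrite derive1E => ->; exact: ckf_gt0.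
- apply: derivable_within_continuous => x _; exact: ds.
- by rewrite in_itv/= lexx ltW.
- by rewrite in_itv/= lexx ltW.
Qed.

Lemma skf0 : skf 0 = 0.
Proof. by rewrite /skf; case: eqVneq => // _; rewrite mulr0 oppr0 subrr mul0r. Qed.

Lemma skf_gt0 t : 0 < t -> 0 < skf t.
Proof. by move/skf_lt; rewrite skf0. Qed.

Lemma ct_skf t : 0 < t -> ct k t = ckf t / skf t.
Proof.
move=> t0; rewrite /ct /coth; have := skf_gt0 t0; rewrite /ckf /skf.
case: eqVneq => [_|kn0 s0]; first by rewrite div1r.
have : expR (k * t) - expR (- (k * t)) != 0.
  by apply: contraTneq s0 => ->; rewrite mul0r ltxx.
by move=> e0; field; rewrite e0 kn0.
Qed.

(** The inverse of [rho |-> (2 sinh (k rho / 2) / k)^2], with the inverse hyperbolic sine written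
    out as a logarithm. *)
Definition chord_dist q : R :=
  if k == 0 then Num.sqrt q
  else 2 / k * ln (k / 2 * Num.sqrt q + Num.sqrt (1 + k ^+ 2 * q / 4)).

Lemma chord_dist_aux q : 0 <= q -> 1 <= 1 + k ^+ 2 * q / 4.
Proof. by move=> q0; rewrite lerDl divr_ge0// mulr_ge0// sqr_ge0. Qed.

Lemma chord_dist_arg_ge1 q : 0 <= q ->
  1 <= k / 2 * Num.sqrt q + Num.sqrt (1 + k ^+ 2 * q / 4).
Proof.
move=> q0; have /ler_wsqrtr := chord_dist_aux q0; rewrite sqrtr1 => h.
have : 0 <= k / 2 * Num.sqrt q by rewrite mulr_ge0 ?sqrtr_ge0// divr_ge0.
lra.
Qed.

Lemma chord_dist_ge0 q : 0 <= q -> 0 <= chord_dist q.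
Proof.
move=> q0; rewrite /chord_dist; case: eqVneq => _; first exact: sqrtr_ge0.
by rewrite mulr_ge0 ?divr_ge0// ln_ge0// chord_dist_arg_ge1.
Qed.

Lemma chord_dist0 : chord_dist 0 = 0.
Proof.
rewrite /chord_dist; case: eqVneq => _; first exact: sqrtr0.
by rewrite sqrtr0 !mulr0 mul0r addr0 add0r sqrtr1 ln1 mulr0.
Qed.

(** Duplication formulas: [k / 2 * sqrt q] and [sqrt (1 + k^2 q / 4)] are the hyperbolic sine and
    cosine of [k / 2] times the distance. *)
Lemma skf_ckf_chord_dist q : 0 <= q ->
  skf (chord_dist q) = Num.sqrt q * Num.sqrt (1 + k ^+ 2 * q / 4) /\
  ckf (chord_dist q) = 1 + k ^+ 2 * q / 2.
Proof.
move=> q0; rewrite /skf /ckf /chord_dist; case: eqVneq => [->|kn0].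
  by rewrite expr0n/= !mul0r addr0 sqrtr1 mulr1.
have := chord_dist_arg_ge1 q0; have w0 := chord_dist_aux q0.
have := sqr_sqrtr q0; have := @sqr_sqrtr R (1 + k ^+ 2 * q / 4).
move: (Num.sqrt (1 + _)) (Num.sqrt q) => w u /(_ (le_trans ler01 w0)) w2 u2 E1.
have E0 : 0 < k / 2 * u + w by apply: lt_le_trans E1.
have -> : k * (2 / k * ln (k / 2 * u + w)) = ln (k / 2 * u + w) + ln (k / 2 * u + w).
  by field.
rewrite expRN expRD lnK// -expr2.
(* Since [w^2 - (k u / 2)^2 = 1], the conjugate of [k u / 2 + w] is its inverse. *)
have -> : (k / 2 * u + w) ^- 2 = (w - k / 2 * u) ^+ 2.
  have h : (w - k / 2 * u) * (k / 2 * u + w) = 1.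
    have -> : (w - k / 2 * u) * (k / 2 * u + w) = w ^+ 2 - k ^+ 2 * u ^+ 2 / 4.
      by field.
    by rewrite w2 u2; ring.
  rewrite -exprVn; congr (_ ^+ 2); apply: (mulIf (lt0r_neq0 E0)).
  by rewrite h mulVf// lt0r_neq0.
split; first by field.
transitivity (w ^+ 2 + k ^+ 2 * u ^+ 2 / 4); first by field.
by rewrite w2 u2; field.
Qed.

Lemma chord_dist_gt0 q : 0 < q -> 0 < chord_dist q.
Proof.
move=> q0; have [E _] := skf_ckf_chord_dist (ltW q0).
rewrite lt_neqAle chord_dist_ge0 ?ltW// andbT; apply/negP => /eqP h0.
move: E; rewrite -h0 skf0 => /esym/eqP; rewrite mulf_eq0 !sqrtr_eq0 leNgt q0/=.
by rewrite leNgt (lt_le_trans ltr01 (chord_dist_aux (ltW q0))).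
Qed.

Lemma is_derive_chord_dist q : 0 < q -> is_derive q 1 chord_dist
  (2 * (Num.sqrt q * Num.sqrt (1 + k ^+ 2 * q / 4)))^-1.
Proof.
move=> q0; rewrite /chord_dist; case: eqVneq => [->|kn0].
  by rewrite expr0n/= !mul0r addr0 sqrtr1 mulr1; exact: is_derive1_sqrt.
have E1 := chord_dist_arg_ge1 (ltW q0).
have w1 : 0 < 1 + k ^+ 2 * q / 4.
  exact: (lt_le_trans ltr01 (chord_dist_aux (ltW q0))).
have dl : is_derive q 1 (fun q => 1 + k ^+ 2 * q / 4) (k ^+ 2 / 4).
  have -> : (fun q => 1 + k ^+ 2 * q / 4) = (fun q => 1 + (k ^+ 2 / 4) * q).
    by apply/funext => y; rewrite mulrAC.
  have := is_deriveDf (is_derive_cst (1 : R) q 1)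
    (is_deriveMlf (k ^+ 2 / 4) (is_derive_id q 1)).
  by rewrite mulr1 add0r.
have dw := is_derive_comp1 dl (is_derive1_sqrt w1).
have du := is_derive1_sqrt q0.
have dE : is_derive q 1
    (fun q => k / 2 * Num.sqrt q + Num.sqrt (1 + k ^+ 2 * q / 4))
    (k / 2 * (2 * Num.sqrt q)^-1 +
      (2 * Num.sqrt (1 + k ^+ 2 * q / 4))^-1 * (k ^+ 2 / 4)).
  have -> : (fun q => k / 2 * Num.sqrt q + Num.sqrt (1 + k ^+ 2 * q / 4)) =
    (k / 2) *: (fun q => Num.sqrt q) +
    (Num.sqrt \o (fun q => 1 + k ^+ 2 * q / 4)) by [].
  exact: is_deriveD.
have dln := is_derive_comp1 dE (is_derive1_ln (lt_le_trans ltr01 E1)).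
have u0 : Num.sqrt q != 0 by rewrite sqrtr_eq0 -ltNge.
have w0 : Num.sqrt (1 + k ^+ 2 * q / 4) != 0 by rewrite sqrtr_eq0 -ltNge.
have E0 := lt0r_neq0 (lt_le_trans ltr01 E1).
have -> : (fun q => 2 / k * ln (k / 2 * Num.sqrt q + Num.sqrt (1 + k ^+ 2 * q / 4)))
  = (2 / k) *: ((ln (R:=R)) \o
    (fun q => k / 2 * Num.sqrt q + Num.sqrt (1 + k ^+ 2 * q / 4))) by [].
apply: (is_derive_eq (is_deriveZ (2 / k) dln)); rewrite /GRing.scale/=.
move: u0 w0 E0; move: (Num.sqrt q) (Num.sqrt (1 + _)) => u w u0 w0 E0.
field; rewrite u0 w0 kn0 /=.
by rewrite andbT; move: E0; apply: contraNN => /eqP h; apply/eqP; lra.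
Qed.

Lemma chord_dist_le q q' : 0 <= q -> q <= q' -> chord_dist q <= chord_dist q'.
Proof.
move=> q0 qq'; have q0' := le_trans q0 qq'; rewrite leNgt; apply/negP => /skf_lt.
have [-> _] := skf_ckf_chord_dist q0; have [-> _] := skf_ckf_chord_dist q0'.
rewrite ltNge => /negP; apply; apply: ler_pM; rewrite ?sqrtr_ge0// ler_wsqrtr//.
by rewrite lerD2l ler_pM2r ?invr_gt0// ler_wpM2l// sqr_ge0.
Qed.

Lemma continuous_chord_dist q : 0 <= q -> {for q, continuous chord_dist}.
Proof.
move=> q0; rewrite /chord_dist; case: eqVneq => [_|kn0].
  exact: sqrt_continuous.
have cu : {for q, continuous (fun q => k / 2 * Num.sqrt q)}.
  by apply: cvgMl_tmp; exact: sqrt_continuous.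
have cw : {for q, continuous (fun q => Num.sqrt (1 + k ^+ 2 * q / 4))}.
  apply: (@continuous_comp _ _ _ (fun q => 1 + k ^+ 2 * q / 4)); last first.
    exact: sqrt_continuous.
  by apply: cvgD; [exact: cvg_cst|apply: cvgMr_tmp; apply: cvgMl_tmp; exact: cvg_id].
apply: cvgMl_tmp; apply: (@continuous_comp _ _ _
    (fun q => k / 2 * Num.sqrt q + Num.sqrt (1 + k ^+ 2 * q / 4)) (@ln R)).
  exact: cvgD.
by apply: continuous_ln; exact: (lt_le_trans ltr01 (chord_dist_arg_ge1 q0)).
Qed.

End RadialFunctions.

(** * The Riemannian distance in closed form *)

Section DistanceLowerBound.
Context {R : realType} (n : nat) (k : R).
Hypothesis k0 : 0 <= k.
Implicit Types x a : 'rV[R]_n.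

Lemma is_derive1_continuous (f : R -> R) (t df : R) :
  is_derive t 1 f df -> {for t, continuous f}.
Proof. by case=> /derivable1_diffP/differentiable_continuous. Qed.

Lemma dot_continuous (T : topologicalType) (F : set_system T) (FF : Filter F)
    (f g : T -> 'rV[R]_n) (l m : 'rV[R]_n) :
  f @ F --> l -> g @ F --> m -> dot (f t) (g t) @[t --> F] --> dot l m.
Proof.
move=> fl gm; apply: cvg_big => [|i _]; first exact: add_continuous.
apply: cvgM.
  exact: (cvg_comp _ _ fl (@coord_continuous R 1 n ord0 i l)).
exact: (cvg_comp _ _ gm (@coord_continuous R 1 n ord0 i m)).
Qed.

Lemma cvg_sqr (T : topologicalType) (F : set_system T) (FF : Filter F)
    (f : T -> R) (l : R) :
  f @ F --> l -> (f t) ^+ 2 @[t --> F] --> l ^+ 2.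
Proof. by move=> fl; exact: (cvgM fl fl). Qed.

Lemma riem_norm_sqr x X : space_form k x ->
  riem_norm k x X ^+ 2 = conf k x ^+ 2 * dot X X.
Proof.
by move=> xM; rewrite /riem_norm sqr_sqrtr// mulr_ge0 ?sqr_ge0 ?dot_ge0.
Qed.

(** Bounds the rate of [chord2] along a curve. The factor before the speed is the reciprocal of the
    derivative of [chord_dist], so [chord_dist] of the chord grows at most as fast as arc length. *)
Lemma radial_field_cauchy_schwarz a x X : space_form k a -> space_form k x ->
  `|2 * conf k x ^+ 2 * dot (radial_field k a x) X| <=
  2 * (Num.sqrt (chord2 k a x) * Num.sqrt (1 + k ^+ 2 * chord2 k a x / 4)) *
  riem_norm k x X.
Proof.
move=> aM xM; have q0 := chord2_ge0 k0 aM xM.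
have r0 : 0 <= riem_norm k x X by exact: sqrtr_ge0.
rewrite -ler_sqr ?nnegrE// ?mulr_ge0// ?sqrtr_ge0//.
rewrite real_normK ?num_real// !exprMn riem_norm_sqr// !sqr_sqrtr//; last first.
  exact: (le_trans ler01 (chord_dist_aux k q0)).
have E : chord2 k a x * (1 + k ^+ 2 * chord2 k a x / 4) =
    conf k x ^+ 2 * dot (radial_field k a x) (radial_field k a x).
  by rewrite radial_field_norm//; field.
rewrite E; have h := cauchy_schwarz_dot (radial_field k a x) X.
have p4 : 0 <= 2 ^+ 2 * (conf k x ^+ 2) ^+ 2 by rewrite mulr_ge0 ?sqr_ge0.
by have := ler_wpM2l p4 h; congr (_ <= _); ring.
Qed.

Section Curve.
Variables (a x : 'rV[R]_n) (c : R -> 'rV[R]_n).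
Hypotheses (aM : space_form k a) (cax : curve_from_to k a x c).

Let cM (t : R) : 0 <= t <= 1 -> space_form k (c t).
Proof. by case: cax => _ _ _; exact. Qed.

Let dc (t : R) : is_derive t 1 c (derive1 c t).
Proof. by case: cax => -[cd _] _ _ _; split; [exact: cd|rewrite derive1E]. Qed.

Let cc : continuous c.
Proof. by move=> t; apply/differentiable_continuous/derivable1_diffP; case: (dc t). Qed.

Let cdc : continuous (derive1 c).
Proof. by case: cax => -[]. Qed.

Let ccf (t : R) : 0 <= t <= 1 -> {for t, continuous (fun t => conf k (c t))}.
Proof.
by move=> /cM ct; exact: is_derive1_continuous (is_derive_conf ct (dc t)).
Qed.

Lemma continuous_speed (t : R) : 0 <= t <= 1 ->
  {for t, continuous (fun t => riem_norm k (c t) (derive1 c t))}.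
Proof.
move=> t01; apply: (@continuous_comp _ _ _
    (fun t => riem_metric k (c t) (derive1 c t) (derive1 c t))); last first.
  exact: sqrt_continuous.
have h1 : conf k (c s) @[s --> t] --> conf k (c t) := ccf t01.
have h2 : derive1 c s @[s --> t] --> derive1 c t := @cdc t.
exact: (cvgM (cvg_sqr _ h1) (dot_continuous _ h2 h2)).
Qed.

Lemma chord_dist_le_length : chord_dist k (chord2 k a x) <= curve_length k c.
Proof.
have [_ c0 c1 _] := cax.
have qge0 (t : R) : 0 <= t <= 1 -> 0 <= chord2 k a (c t).
  by move=> /cM; exact: chord2_ge0.
pose dq t := 2 * conf k (c t) ^+ 2 * dot (radial_field k a (c t)) (derive1 c t).
have qd (t : R) : 0 <= t <= 1 -> is_derive t 1 (fun t => chord2 k a (c t)) (dq t).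
  by move=> /cM ct; exact: is_derive_chord2.
have xM : space_form k x by rewrite -c1; apply: cM; rewrite ler01 lexx.
pose S q : R := Num.sqrt q * Num.sqrt (1 + k ^+ 2 * q / 4).
(* Adding [e] keeps [chord_dist], singular at 0, differentiable along the curve. *)
have key (e : R) : 0 < e -> chord_dist k (chord2 k a x + e) - chord_dist k e <=
    curve_length k c.
  move=> e0; pose F t := chord_dist k (chord2 k a (c t) + e).
  pose dF t := (2 * S (chord2 k a (c t) + e))^-1 * dq t.
  have Fd (t : R) : 0 <= t <= 1 -> is_derive t 1 F (dF t).
    move=> t01; apply: (@is_derive_comp1 _ _ (fun t => chord2 k a (c t) + e)).
      have := is_deriveDf (qd t t01) (is_derive_cst e t 1).
      by rewrite addr0.
    by apply: is_derive_chord_dist => //; rewrite ltr_wpDl// qge0.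
  have S0 (t : R) : 0 <= t <= 1 -> 0 < S (chord2 k a (c t) + e).
    move=> t01; have h : 0 < chord2 k a (c t) + e by rewrite ltr_wpDl// qge0.
    rewrite mulr_gt0 ?sqrtr_gt0//.
    exact: (lt_le_trans ltr01 (chord_dist_aux k (ltW h))).
  have cdF (t : R) : 0 <= t <= 1 -> {for t, continuous dF}.
    move=> t01; have cq := is_derive1_continuous (qd t t01).
    apply: cvgM.
      apply: cvgV; first by rewrite mulf_neq0// lt0r_neq0// S0.
      apply: cvgMl_tmp; apply: cvgM.
        apply: (@continuous_comp _ _ _ (fun t => chord2 k a (c t) + e)).
          by apply: cvgD => //; exact: cvg_cst.
        exact: sqrt_continuous.
      apply: (@continuous_comp _ _ _
        (fun t => 1 + k ^+ 2 * (chord2 k a (c t) + e) / 4)).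
        apply: cvgD; first exact: cvg_cst.
        apply: cvgMr_tmp; apply: cvgMl_tmp; apply: cvgD => //; exact: cvg_cst.
      exact: sqrt_continuous.
    apply: cvgM; first by apply: cvgMl_tmp; apply: cvg_sqr; exact: ccf.
    apply: dot_continuous; last exact: cdc.
    apply: cvgZ; first exact: cvg_cst.
    apply: cvgD; apply: cvgZ.
    - by apply: cvgV; [exact/lt0r_neq0/conf_gt0/cM|exact: ccf].
    - by apply: cvgB; [exact: cc|exact: cvg_cst].
    - apply: cvgMl_tmp; apply: dot_continuous;
        by apply: cvgB; [exact: cc|exact: cvg_cst].
    - exact: cc.
  have itvP (t : R) : `[0, 1]%classic t -> 0 <= t <= 1 by rewrite /= in_itv.
  have wF : {within `[0, 1], continuous dF}.
    by apply: continuous_in_subspaceT => t /set_mem/itvP; exact: cdF.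
  have wl : {within `[0, 1], continuous (fun t => riem_norm k (c t) (derive1 c t))}.
    by apply: continuous_in_subspaceT => t /set_mem/itvP; exact: continuous_speed.
  have iF := continuous_compact_integrable (@segment_compact _ _ _) wF.
  have il := continuous_compact_integrable (@segment_compact _ _ _) wl.
  have <- : \int[@lebesgue_measure R]_(t in `[0, 1]) dF t =
      chord_dist k (chord2 k a x + e) - chord_dist k e.
    rewrite /Rintegral (@continuous_FTC2 _ dF F)//.
    - rewrite /F c1 c0 -EFinB/= /chord2 subrr.
      by rewrite -{1}(scale0r (0 : 'rV[R]_n)) dotZl mul0r mulr0 add0r.
    - have F0 : 0 <= (0 : R) <= 1 by rewrite lexx ler01.
      have F1 : 0 <= (1 : R) <= 1 by rewrite lexx ler01.
      split.
      + move=> t /[!in_itv]/= /andP[t0 t1].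
        by have [|] := Fd t; rewrite ?ltW.
      + exact/cvg_at_right_filter/(is_derive1_continuous (Fd 0 F0)).
      + exact/cvg_at_left_filter/(is_derive1_continuous (Fd 1 F1)).
    - move=> t /[!in_itv]/= /andP[t0 t1]; rewrite derive1E.
      by have [|_ ->] := Fd t; rewrite ?ltW.
  apply: le_Rintegral => // t /itvP t01.
  rewrite /dF mulrC ler_pdivrMr; last by apply: mulr_gt0 => //; exact: S0.
  apply: (le_trans (ler_norm _)).
  apply: (le_trans (radial_field_cauchy_schwarz _ aM (cM t01))).
  rewrite mulrC ler_wpM2l ?sqrtr_ge0// ler_pM2l//.
  apply: ler_pM; rewrite ?sqrtr_ge0//; apply: ler_wsqrtr.
    by rewrite lerDl ltW.
  rewrite lerD2l.
  by rewrite ler_pM2r ?invr_gt0// ler_wpM2l ?sqr_ge0// lerDl ltW.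
have q0 := chord2_ge0 k0 aM xM.
(* The shift costs [chord_dist] of the shift, which tends to 0 by continuity at 0. *)
apply/ler_addgt0Pr => e e0.
have /cvgrPdist_lt/(_ _ e0) : chord_dist k d @[d --> 0] --> chord_dist k 0.
  exact: continuous_chord_dist.
rewrite chord_dist0 => -[d /= d0 dP].
have d2 : 0 < d / 2 by rewrite divr_gt0.
have := key _ d2; have := dP (d / 2).
rewrite /ball_/= !sub0r !normrN !gtr0_norm//; last first.
  by rewrite chord_dist_gt0.
move=> /(_ _)/[swap] h1 h2; have {}h2 : chord_dist k (d / 2) < e by apply: h2; lra.
have : chord_dist k (chord2 k a x) <= chord_dist k (chord2 k a x + d / 2).
  by apply: chord_dist_le => //; rewrite lerDl ltW.
lra.
Qed.

End Curve.
End DistanceLowerBound.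

(** * Curves that realise the distance *)

Section Geodesics.
Context {R : realType} (n : nat).

Lemma is_derive_scalel (t : R) (f : R -> R) (df : R) (v : 'rV[R]_n) :
  is_derive t 1 f df -> is_derive t 1 (fun t => f t *: v) (df *: v).
Proof.
move=> [fd fE].
have H i j : is_derive t 1 (fun t => (f t *: v) i j) (df * v i j).
  have -> : (fun t => (f t *: v) i j) = (fun t => v i j * f t).
    by apply/funext => s; rewrite mxE mulrC.
  by rewrite mulrC; exact: is_deriveMlf (DeriveDef fd fE).
have D : derivable (fun t => f t *: v) t 1.
  by apply/derivable_mxP => i j; have [] := H i j.
split => //; rewrite derive_mx//; apply/matrixP => i j; rewrite !mxE.
by have [] := H i j.
Qed.

(** Rational functions are kept as pairs of polynomials: the derivative is again such a pair, and
    continuity and evaluation reduce to those of polynomials. *)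
Definition ratio (p r : {poly R}) (t : R) := p.[t] / r.[t].

Lemma ratio_derivE (p r : {poly R}) (t : R) :
  ratio (p^`() * r - p * r^`()) (r * r) t =
  ((p^`()).[t] * r.[t] - p.[t] * (r^`()).[t]) / (r.[t] * r.[t]).
Proof. by rewrite /ratio hornerD hornerN !hornerM. Qed.

Lemma is_derive_ratio (p r : {poly R}) (t : R) : r.[t] != 0 ->
  is_derive t 1 (ratio p r) (ratio (p^`() * r - p * r^`()) (r * r) t).
Proof.
move=> r0; have dp := is_derive_poly p t; have dr := is_derive_poly r t.
apply: (is_derive_eq (is_deriveMf dp (is_derive_inv r0 dr))).
by rewrite ratio_derivE; field.
Qed.

Lemma continuous_ratio (p r : {poly R}) (t : R) : r.[t] != 0 ->
  {for t, continuous (ratio p r)}.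
Proof.
by move=> r0; apply: cvgM; [|apply: cvgV => //]; exact: continuous_horner.
Qed.

(* [sigma] runs from 0 to 1 on [[0, 1]] and stays in [[-1, 1]] on the whole line,
   where the geodesics below are defined. *)
Definition sigma : R -> R := ratio (2 *: 'X) (1 + 'X^2).

Lemma sigmaE t : sigma t = 2 * t / (1 + t ^+ 2).
Proof. by rewrite /sigma /ratio !hornerE. Qed.

Lemma sigma_den (t : R) : (1 + 'X^2 : {poly R}).[t] != 0.
Proof. by rewrite !hornerE lt0r_neq0// ltr_pwDl// sqr_ge0. Qed.

Definition dsigma := ratio ((2 *: 'X)^`() * (1 + 'X^2) -
  (2 *: 'X) * (1 + 'X^2)^`()) ((1 + 'X^2) * (1 + 'X^2)).

Lemma is_derive_sigma (t : R) : is_derive t 1 sigma (dsigma t).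
Proof. by apply: is_derive_ratio; exact: sigma_den. Qed.

Lemma continuous_sigma : continuous sigma.
Proof. by move=> t; apply: continuous_ratio; exact: sigma_den. Qed.

Lemma continuous_dsigma : continuous dsigma.
Proof.
by move=> t; apply: continuous_ratio; rewrite hornerM mulf_neq0// sigma_den.
Qed.

Lemma dsigma_ge0 (t : R) : 0 <= t <= 1 -> 0 <= dsigma t.
Proof.
move=> t01; rewrite /dsigma /ratio !(hornerE, poly.derivE) divr_ge0//; last first.
  by rewrite -expr2 sqr_ge0.
nra.
Qed.

Lemma sigma_itv (t : R) : -1 <= sigma t <= 1.
Proof.
have d0 : 0 < 1 + t ^+ 2 by rewrite ltr_pwDl// sqr_ge0.
rewrite sigmaE ler_pdivlMr// ler_pdivrMr//.
by have := sqr_ge0 (t - 1); have := sqr_ge0 (t + 1); rewrite !sqrrD; lra.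
Qed.

Lemma sigma0 : sigma 0 = 0.
Proof. by rewrite sigmaE mulr0 mul0r. Qed.

Lemma sigma1 : sigma 1 = 1.
Proof. by rewrite sigmaE expr1n; field. Qed.

End Geodesics.

Section HyperbolicGeodesics.
Context {R : realType} (n : nat).
Variable k : R.
Hypothesis k0 : 0 < k.
Implicit Types a x y : 'rV[R]_n.

Section Ray.
Variables (a y : 'rV[R]_n).
Hypotheses (a1 : dot a a < 1) (y1 : dot y y < 1).
Let A := dot a a.
Let B := dot a y.
Let Y := dot y y.

Let den (l : R) := 1 + 2 * B * l + A * Y * l ^+ 2.

(** By Cauchy-Schwarz the denominator is at least [(1 + B l)^2], and [|B l| < 1] because
    [B^2 <= A Y < 1]. *)
Let den_gt0 l : -1 <= l <= 1 -> 0 < den l.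
Proof.
move=> l1; have l2 : l ^+ 2 <= 1 by rewrite -real_normK ?num_real// expr_le1// ler_norml.
have cs : B ^+ 2 <= A * Y by exact: cauchy_schwarz_dot.
have A0 : 0 <= A := dot_ge0 a; have Y0 : 0 <= Y := dot_ge0 y.
have AY : A * Y < 1.
  by rewrite (le_lt_trans _ y1)// ler_piMl// ltW.
have lB : (l * B) ^+ 2 < 1.
  apply: le_lt_trans AY; rewrite exprMn; apply: le_trans cs.
  by apply: ler_piMl => //; exact: sqr_ge0.
have h : -1 < l * B < 1.
  by apply/andP; split; nra.
have : l ^+ 2 * B ^+ 2 <= l ^+ 2 * (A * Y) by rewrite ler_wpM2l// sqr_ge0.
rewrite /den; nra.
Qed.

Let P : {poly R} := 1 + (2 * B) *: 'X + Y *: 'X^2.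
Let Q : {poly R} := (1 - A) *: 'X.
Let E : {poly R} := 1 + (2 * B) *: 'X + (A * Y) *: 'X^2.

Let PE l : P.[l] = 1 + 2 * B * l + Y * l ^+ 2.
Proof. by rewrite /den !hornerE; ring. Qed.
Let QE l : Q.[l] = (1 - A) * l.
Proof. by rewrite /den !hornerE; ring. Qed.
Let EE l : E.[l] = den l.
Proof. by rewrite /den !hornerE; ring. Qed.
Let dPE l : (P^`()).[l] = 2 * B + Y * 2 * l.
Proof. by rewrite !(hornerE, poly.derivE); ring. Qed.
Let dQE l : (Q^`()).[l] = 1 - A.
Proof. by rewrite !(hornerE, poly.derivE); ring. Qed.
Let dEE l : (E^`()).[l] = 2 * B + A * Y * 2 * l.
Proof. by rewrite !(hornerE, poly.derivE); ring. Qed.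

Let E_neq0 l : -1 <= l <= 1 -> E.[l] != 0.
Proof. by move=> /den_gt0 /lt0r_neq0; rewrite EE. Qed.

(* The image of the segment [[0, y]] under the Moebius translation of the unit
   ball taking 0 to [a]. *)
Definition geodesic (t : R) : 'rV[R]_n :=
  ratio P E (sigma t) *: a + ratio Q E (sigma t) *: y.

Let dP := ratio (P^`() * E - P * E^`()) (E * E).
Let dQ := ratio (Q^`() * E - Q * E^`()) (E * E).

Let dgeodesic (t : R) : 'rV[R]_n :=
  (dP (sigma t) * dsigma t) *: a + (dQ (sigma t) * dsigma t) *: y.

Let is_derive_geodesic (t : R) : is_derive t 1 geodesic (dgeodesic t).
Proof.
have s1 := E_neq0 (sigma_itv t).
have ds := is_derive_sigma t.
have d1 := is_derive_comp1 ds (is_derive_ratio P s1).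
have d2 := is_derive_comp1 ds (is_derive_ratio Q s1).
exact: (is_deriveD (is_derive_scalel a d1) (is_derive_scalel y d2)).
Qed.

Lemma C1_geodesic : C1_curve geodesic.
Proof.
split=> [t|]; first by have [] := is_derive_geodesic t.
have -> : derive1 geodesic = dgeodesic.
  by apply/funext => t; rewrite derive1E; have [] := is_derive_geodesic t.
have cd p t : {for t, continuous (fun t => ratio p (E * E) (sigma t) * dsigma t)}.
  apply: cvgM; last exact: continuous_dsigma.
  apply: (@continuous_comp _ _ _ sigma); first exact: continuous_sigma.
  by apply: continuous_ratio; rewrite hornerM mulf_neq0// E_neq0// sigma_itv.
by move=> t; apply: cvgD; apply: cvgZr_tmp; exact: cd.
Qed.

Let dot_geodesic (l : R) : -1 <= l <= 1 ->
  1 - dot (ratio P E l *: a + ratio Q E l *: y) (ratio P E l *: a + ratio Q E l *: y)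
  = (1 - A) * (1 - l ^+ 2 * Y) / den l.
Proof.
move=> /den_gt0/lt0r_neq0 d0; rewrite !dotE (dotC y a) /ratio PE QE EE -/A -/B -/Y.
by move: d0; rewrite /den => d0; field.
Qed.

(** The square root of this value divided by that of [dot_geodesic] is [sqrt Y / (1 - l^2 Y)], where
    [a] no longer appears: the Moebius translation is an isometry, and the speed is that of a
    segment from the origin. *)
Let dot_dgeodesic (l : R) : -1 <= l <= 1 ->
  dot (dP l *: a + dQ l *: y) (dP l *: a + dQ l *: y) = (1 - A) ^+ 2 * Y / den l ^+ 2.
Proof.
move=> /den_gt0/lt0r_neq0 d0; rewrite !dotE (dotC y a) /dP /dQ.
rewrite !ratio_derivE dPE dQE dEE PE QE EE -/A -/B -/Y.
by move: d0; rewrite /den => d0; field.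
Qed.

Lemma geodesic0 : geodesic 0 = a.
Proof.
rewrite /geodesic sigma0 /ratio PE QE EE /den.
by rewrite !mulr0 expr0n/= !mulr0 !addr0 divr1 mul0r scale1r scale0r addr0.
Qed.

Lemma geodesic_space_form t : space_form k (geodesic t).
Proof.
apply/space_formP; right; rewrite -subr_gt0.
have s1 := sigma_itv t; rewrite /geodesic dot_geodesic//.
have Y0 : 0 <= Y := dot_ge0 y.
have s2 : sigma t ^+ 2 * Y < 1.
  rewrite (le_lt_trans _ y1)// ler_piMl//.
  by rewrite -real_normK ?num_real// expr_le1// ler_norml.
by rewrite divr_gt0 ?den_gt0// mulr_gt0// subr_gt0.
Qed.

Lemma geodesic_speed t : 0 <= t <= 1 ->
  riem_norm k (geodesic t) (derive1 geodesic t) =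
  2 * Num.sqrt Y / (k * (1 - (sigma t * Num.sqrt Y) ^+ 2)) * dsigma t.
Proof.
move=> t01; have s1 := sigma_itv t.
have Y0 : 0 <= Y := dot_ge0 y.
have s2 : sigma t ^+ 2 * Y < 1.
  rewrite (le_lt_trans _ y1)// ler_piMl//.
  by rewrite -real_normK ?num_real// expr_le1// ler_norml.
have M := geodesic_space_form t.
rewrite exprMn sqr_sqrtr//; apply/eqP.
rewrite -(@eqrXn2 _ 2)//; first last.
- rewrite mulr_ge0 ?dsigma_ge0// divr_ge0 ?mulr_ge0 ?sqrtr_ge0//; first exact: ltW.
  by rewrite subr_ge0 ltW.
- exact: sqrtr_ge0.
rewrite riem_norm_sqr//; apply/eqP.
have -> : derive1 geodesic t = dsigma t *: (dP (sigma t) *: a + dQ (sigma t) *: y).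
  rewrite derive1E; have [_ ->] := is_derive_geodesic t.
  by rewrite scalerDr !scalerA !(mulrC (dsigma t)).
rewrite dotZl dotZr dot_dgeodesic// /conf gt_eqF// enorm_sqr dot_geodesic//.
have := lt0r_neq0 (den_gt0 s1); move: s2 a1; rewrite -/A.
move: (sigma t) (dsigma t) => l dl s2 a1' d0; rewrite !exprMn sqr_sqrtr//.
by field; rewrite d0 !lt0r_neq0//; lra.
Qed.

Lemma curve_length_geodesic : curve_length k geodesic =
  k^-1 * (ln (1 + Num.sqrt Y) - ln (1 - Num.sqrt Y)).
Proof.
set s := Num.sqrt Y; have s0 : 0 <= s by exact: sqrtr_ge0.
have s1 : s < 1 by rewrite -sqrtr1 ltr_sqrt.
have m1 (t : R) : 0 < 1 - s * sigma t /\ 0 < 1 + s * sigma t.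
  have /andP[h1 h2] := sigma_itv t; split; nra.
(* Antiderivative of the speed by partial fractions; the second logarithm is written with [- s] so
   that [dln] serves for both. *)
pose F (t : R) := k^-1 * (ln (1 + s * sigma t) + (-1) * ln (1 + (- s) * sigma t)).
pose dF (t : R) := riem_norm k (geodesic t) (derive1 geodesic t).
have dln (b t : R) : 0 < 1 + b * sigma t ->
    is_derive t 1 (fun t => ln (1 + b * sigma t))
      ((1 + b * sigma t)^-1 * (b * dsigma t)).
  move=> bt; apply: (@is_derive_comp1 _ _ (fun t => 1 + b * sigma t) (@ln R)).
    have := is_deriveDf (is_derive_cst (1 : R) t 1)
      (is_deriveMlf b (is_derive_sigma t)).
    by rewrite add0r.
  exact: is_derive1_ln.
have Fd (t : R) : 0 <= t <= 1 -> is_derive t 1 F (dF t).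
  move=> t01; have [h1 h2] := m1 t.
  have h3 : 0 < 1 + - s * sigma t by rewrite mulNr.
  have d1 := dln _ _ h2; have d2 := dln _ _ h3.
  apply: (is_derive_eq (is_deriveMlf k^-1 (is_deriveDf d1
    (is_deriveMlf (-1) d2)))).
  rewrite /dF geodesic_speed// -/s; move: h1 h2.
  move: (sigma t) (dsigma t) => l dl h1 h2; field.
  by rewrite !lt0r_neq0//; nra.
have cax : curve_from_to k a (geodesic 1) geodesic.
  by split => //; [exact: C1_geodesic|exact: geodesic0|
    move=> t _; exact: geodesic_space_form].
have wF : {within `[0, 1], continuous dF}.
  apply: continuous_in_subspaceT => t /set_mem; rewrite /= in_itv/= => t01.
  exact: (continuous_speed cax t01).
rewrite /curve_length /Rintegral (@continuous_FTC2 _ dF F)//.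
- rewrite /F sigma0 sigma1 !mulr0 addr0 ln1 !mulr1 /=.
  by rewrite mulr0 addr0 mulr0 subr0 mulN1r.
- have F0 : 0 <= (0 : R) <= 1 by rewrite lexx ler01.
  have F1 : 0 <= (1 : R) <= 1 by rewrite lexx ler01.
  split.
  + move=> t /[!in_itv]/= /andP[t0 t1].
    by have [|] := Fd t; rewrite ?ltW.
  + exact/cvg_at_right_filter/(is_derive1_continuous (Fd 0 F0)).
  + exact/cvg_at_left_filter/(is_derive1_continuous (Fd 1 F1)).
- move=> t /[!in_itv]/= /andP[t0 t1]; rewrite derive1E.
  by have [|_ ->] := Fd t; rewrite ?ltW.
Qed.

End Ray.

End HyperbolicGeodesics.

Section DistanceFormula.
Context {R : realType} (n : nat) (k : R).
Hypothesis k0 : 0 <= k.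
Implicit Types a x : 'rV[R]_n.

Lemma minimal_curve_flat a x : k = 0 ->
  exists2 c, curve_from_to k a x c & curve_length k c = chord_dist k (chord2 k a x).
Proof.
move=> k00; exists (fun t : R => t *: (x - a) + a).
  have dc (t : R) : is_derive t 1 (fun t : R => t *: (x - a) + a) (x - a).
    have := is_deriveD (is_derive_scalel (x - a) (is_derive_id t 1))
      (is_derive_cst a t 1).
    by rewrite scale1r addr0.
  split => [|||t _]; last by apply/space_formP; left.
  - split=> [t|]; first by have [] := dc t.
    rewrite (_ : derive1 _ = cst (x - a)); first exact: cst_continuous.
    by apply/funext => t; rewrite derive1E; have [] := dc t.
  - by rewrite scale0r add0r.
  - by rewrite scale1r subrK.
have dc (t : R) : derive1 (fun t : R => t *: (x - a) + a) t = x - a.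
  have [_ h] := is_deriveD (is_derive_scalel (x - a) (is_derive_id t 1))
      (is_derive_cst a t 1).
  by rewrite derive1E h scale1r addr0.
rewrite /curve_length /riem_norm /riem_metric /conf k00 eqxx.
under eq_Rintegral do rewrite dc.
rewrite Rintegral_cst//= lebesgue_measure_itv/= lte_fin ltr01/= oppr0 addr0 mulr1.
by rewrite /chord_dist eqxx /chord2 /conf eqxx !mul1r expr1n mul1r.
Qed.

Lemma minimal_curve a x : space_form k a -> space_form k x ->
  exists2 c, curve_from_to k a x c & curve_length k c = chord_dist k (chord2 k a x).
Proof.
move=> aM xM; have [k00|kn0] := eqVneq k 0; first exact: minimal_curve_flat.
have kp : 0 < k by rewrite lt_neqAle eq_sym kn0.
have a1 : dot a a < 1 by case/space_formP: aM => // /eqP; rewrite (negbTE kn0).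
have x1 : dot x x < 1 by case/space_formP: xM => // /eqP; rewrite (negbTE kn0).
pose A := dot a a; pose P := dot a x; pose X := dot x x.
pose d : R := 1 - 2 * P + A * X.
have cs : P ^+ 2 <= A * X by exact: cauchy_schwarz_dot.
have A0 : 0 <= A := dot_ge0 a; have X0 : 0 <= X := dot_ge0 x.
have d0 : 0 < d.
  have AX1 : A * X < 1 by rewrite (le_lt_trans _ x1)// ler_piMl// ltW.
  have P1 : P < 1 by nra.
  have : 0 < (1 - P) ^+ 2 by rewrite exprn_gt0// subr_gt0.
  by rewrite /d; nra.
(* The image of [x] under the Moebius translation taking [a] to 0, so that the geodesic from [a]
   built on [y] ends at [x]. Its denominator [d] is at least [(1 - P)^2] by Cauchy-Schwarz. *)
pose y : 'rV[R]_n := d^-1 *: ((1 - A) *: x - (1 - 2 * P + X) *: a).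
have BE : dot a y = ((1 - A) * P - (1 - 2 * P + X) * A) / d.
  by rewrite /y !dotE -/A -/P mulrC.
have YE : dot y y = (X - 2 * P + A) / d.
  rewrite /y !dotE (dotC x a) -/A -/P -/X.
  by rewrite /d; field; exact: lt0r_neq0.
have Y1E : 1 - dot y y = (1 - A) * (1 - X) / d.
  by rewrite YE /d; field; exact: lt0r_neq0.
have y1 : dot y y < 1.
  by rewrite -subr_gt0 Y1E divr_gt0// mulr_gt0// subr_gt0.
exists (geodesic a y).
  split => [|||t _].
  - exact: C1_geodesic.
  - exact: geodesic0.
  - rewrite /geodesic sigma1 /ratio !hornerE -/A /= !mulr1.
    have -> : 1 + 2 * dot a y + A * dot y y = (1 - A) ^+ 2 / d.
      by rewrite BE YE /d; field; exact: lt0r_neq0.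
    have -> : 1 + 2 * dot a y + dot y y = (1 - A) * (1 - 2 * P + X) / d.
      by rewrite BE YE /d; field; exact: lt0r_neq0.
    have A1 : 1 - A != 0 by rewrite subr_eq0 eq_sym lt_eqF.
    by apply/rowP => i; rewrite !mxE; field; rewrite A1 lt0r_neq0.
  - exact: geodesic_space_form.
rewrite (curve_length_geodesic kp)//.
have qE : chord2 k a x = 4 * dot y y / (k ^+ 2 * (1 - dot y y)).
  rewrite Y1E YE /chord2 /conf (negbTE kn0) !enorm_sqr !dotE (dotC x a) -/A -/P -/X.
  move: (lt0r_neq0 d0) a1 x1; rewrite -/A -/X => d1 a1' x1'.
  by field; rewrite d1 kn0 !lt0r_neq0//; lra.
rewrite /chord_dist (negbTE kn0) qE; set Y := dot y y in y1 *.
have Y0 : 0 <= Y := dot_ge0 y.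
(* [s] and [w] are the hyperbolic tangent and the inverse of the hyperbolic cosine of half [k] times
   the distance. Both sides become logarithms in [1 + s] and [1 - s] through
   [w^2 = (1 - s)(1 + s)]. *)
set s := Num.sqrt Y; set w := Num.sqrt (1 - Y).
have s2 : s ^+ 2 = Y by rewrite sqr_sqrtr.
have w2 : w ^+ 2 = 1 - Y by rewrite sqr_sqrtr// subr_ge0 ltW.
have s0 : 0 <= s by exact: sqrtr_ge0.
have w0 : 0 < w by rewrite sqrtr_gt0 subr_gt0.
have s1 : s < 1 by rewrite -sqrtr1 ltr_sqrt.
have -> : Num.sqrt (4 * Y / (k ^+ 2 * (1 - Y))) = 2 * s / (k * w).
  rewrite -w2 -s2 (_ : _ / _ = (2 * s / (k * w)) ^+ 2).
    by rewrite sqrtr_sqr ger0_norm// divr_ge0 ?mulr_ge0// ltW.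
  by field; rewrite kn0 lt0r_neq0.
have -> : Num.sqrt (1 + k ^+ 2 * (4 * Y / (k ^+ 2 * (1 - Y))) / 4) = w^-1.
  rewrite -w2 (_ : 1 + _ = w^-1 ^+ 2).
    by rewrite sqrtr_sqr ger0_norm// invr_ge0 ltW.
  have -> : Y = 1 - w ^+ 2 by rewrite w2; ring.
  by field; rewrite kn0 lt0r_neq0.
have -> : k / 2 * (2 * s / (k * w)) + w^-1 = (1 + s) / w.
  by field; rewrite kn0 lt0r_neq0.
have p1 : 0 < 1 + s by rewrite ltr_pwDl.
have m1 : 0 < 1 - s by rewrite subr_gt0.
have wE : w = Num.sqrt (1 + s) * Num.sqrt (1 - s).
  by rewrite -sqrtrM ?ltW// /w -s2; congr Num.sqrt; ring.
have h : ln (1 - s) + ln (1 + s) = ln w + ln w.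
  by rewrite -!lnM ?posrE// -expr2 w2 -s2; congr ln; ring.
have lw : ln w = (ln (1 - s) + ln (1 + s)) / 2 by rewrite h; field.
by rewrite ln_div ?posrE// lw; field.
Qed.

Theorem riem_distE a x : space_form k a -> space_form k x ->
  riem_dist k a x = chord_dist k (chord2 k a x).
Proof.
move=> aM xM; have [c cax cE] := minimal_curve aM xM.
apply/eqP; rewrite eq_le; apply/andP; split.
  rewrite -cE; apply: ge_inf; last by exists c.
  exists (chord_dist k (chord2 k a x)) => _ [e eax <-].
  exact: chord_dist_le_length.
apply: lb_le_inf; first by exists (curve_length k c), c.
by move=> _ [e eax <-]; exact: chord_dist_le_length.
Qed.

End DistanceFormula.

(** * Cut-off, growth at the pole, symmetry of second derivatives *)

Section Cutoff.
Context {R : realType}.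

(** A ramp with one continuous derivative, which is enough since the cut-off is differentiated only
    once. *)
Definition sqpos (y : R) : R := Num.max y 0 ^+ 2.

Lemma continuous_max0 : continuous (fun y : R => Num.max y 0).
Proof.
move=> y; apply: (@continuous_max _ _ (fun y : R => y) (fun=> 0)).
  exact: cvg_id.
exact: cvg_cst.
Qed.

Lemma is_derive_sqpos (y : R) : is_derive y 1 sqpos (2 * Num.max y 0).
Proof.
have [y0|y0|->] := ltgtP y 0.
- rewrite mulr0; apply: (near_eq_is_derive _ (is_derive_cst (0 : R) y 1)).
  near=> z; rewrite /sqpos max_r ?expr0n//.
  by apply: ltW; near: z; exact: lt_nbhsl.
- have dy : is_derive y 1 (fun y : R => y * y) (2 * y).
    apply: (is_derive_eq (is_deriveMf (is_derive_id y 1) (is_derive_id y 1))).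
    by ring.
  apply: (near_eq_is_derive _ dy).
  near=> z; rewrite /sqpos max_l ?expr2//.
  by apply: ltW; near: z; exact: lt_nbhsr.
(* At the corner [sqpos z = max z 0 * z], whose first factor is continuous and vanishes at 0. *)
- rewrite mulr0; apply/is_derive1_caratheodory.
  exists (fun z => Num.max z 0); split; last by rewrite maxxx.
    by move=> z; rewrite /sqpos maxxx expr0n/= !subr0 expr2; case: (ltgtP z 0) => h; ring.
  exact: continuous_max0.
Unshelve. all: by end_near. Qed.

(* A [C^1] step: 0 on [y <= 1], 1 on [2 <= y]. *)
Definition step (y : R) : R := 1 - sqpos (1 - sqpos (y - 1)).

Definition dstep (y : R) : R :=
  4 * (Num.max (1 - sqpos (y - 1)) 0 * Num.max (y - 1) 0).

Lemma is_derive_step (y : R) : is_derive y 1 step (dstep y).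
Proof.
have d1 : is_derive y 1 (fun y : R => y + (-1)) 1.
  by have := is_deriveDf (is_derive_id y 1) (is_derive_cst (-1 : R) y 1); rewrite addr0.
have d2 := is_derive_comp1 d1 (is_derive_sqpos (y - 1)).
have d3 := is_deriveDf (is_derive_cst (1 : R) y 1) (is_deriveMlf (-1) d2).
have e3 : (fun y : R => cst 1 y + -1 * (sqpos \o (fun y : R => y + (-1))) y) =
    (fun y => 1 - sqpos (y - 1)).
  by apply/funext => z; rewrite mulN1r.
rewrite e3 in d3.
have d4 := is_derive_comp1 d3 (is_derive_sqpos (1 - sqpos (y - 1))).
have := is_deriveDf (is_derive_cst (1 : R) y 1) (is_deriveMlf (-1) d4).
have -> : (fun y : R => cst 1 y +
    -1 * (sqpos \o (fun y : R => 1 - sqpos (y - 1))) y) = step.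
  by apply/funext => z; rewrite mulN1r.
by move=> h; apply: (is_derive_eq h); rewrite /dstep; ring.
Qed.

Lemma sqpos_ge0 (y : R) : 0 <= sqpos y.
Proof. exact: sqr_ge0. Qed.

Lemma step_eq0 (y : R) : y <= 1 -> step y = 0.
Proof.
move=> y1; rewrite /step {2}/sqpos max_r ?subr_le0// expr0n subr0.
by rewrite /sqpos max_l// expr1n subrr.
Qed.

Lemma step_eq1 (y : R) : 2 <= y -> step y = 1.
Proof.
move=> y2; rewrite /step {1}/sqpos max_r ?expr0n ?subr0// subr_le0 /sqpos.
by rewrite max_l; [rewrite -[leLHS](expr1n _ 2) ler_sqr ?nnegrE; lra|lra].
Qed.

Lemma step_ge0_le1 (y : R) : 0 <= step y <= 1.
Proof.
rewrite /step lerBlDl lerDr sqpos_ge0 andbT subr_ge0 /sqpos expr_le1 ?le_max ?lexx ?orbT//.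
by rewrite ge_max ler01 andbT lerBlDl lerDr sqr_ge0.
Qed.

Lemma dstep_eq0l (y : R) : y <= 1 -> dstep y = 0.
Proof. by move=> y1; rewrite /dstep (@max_r _ _ (y - 1))  ?subr_le0// !mulr0. Qed.

Lemma dstep_eq0r (y : R) : 2 <= y -> dstep y = 0.
Proof.
move=> y2; rewrite /dstep (@max_r _ _ (1 - _)) ?mul0r ?mulr0// subr_le0 /sqpos.
by rewrite max_l; [rewrite -[leLHS](expr1n _ 2) ler_sqr ?nnegrE; lra|lra].
Qed.

Lemma dstep_bound (y : R) : `|dstep y| <= 4.
Proof.
have [y1|y1] := leP y 1; first by rewrite dstep_eq0l// normr0.
have [y2|y2] := leP 2 y; first by rewrite dstep_eq0r// normr0.
rewrite /dstep (@max_l _ _ (y - 1)) ?subr_ge0 ?ltW//.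
have m0 : 0 <= Num.max (1 - sqpos (y - 1)) 0 by rewrite le_max lexx orbT.
have m1 : Num.max (1 - sqpos (y - 1)) 0 <= 1.
  by rewrite ge_max ler01 andbT lerBlDl lerDr sqpos_ge0.
rewrite ger0_norm; nra.
Qed.

Lemma continuous_dstep : continuous dstep.
Proof.
have cm (y : R) : {for y, continuous (fun y : R => Num.max (y - 1) 0)}.
  apply: (@continuous_comp _ _ _ (fun y : R => y - 1) (fun y : R => Num.max y 0)).
    by apply: cvgB; [exact: cvg_id|exact: cvg_cst].
  exact: continuous_max0.
move=> y; apply: cvgMl_tmp; apply: cvgM; last exact: cm.
apply: (@continuous_comp _ _ _ (fun y : R => 1 - sqpos (y - 1)) (fun y : R => Num.max y 0)).
  apply: cvgB; first exact: cvg_cst.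
  exact: (cvg_sqr _ (cm y)).
exact: continuous_max0.
Qed.

End Cutoff.

Section GrowthAtZero.
Context {R : realType} (n : nat) (k : R) (f df : R -> R) (t0 : R).
Hypotheses (k0 : 0 <= k) (n2 : (2 <= n)%N) (t00 : 0 < t0).
Hypothesis fd : forall t : R, 0 < t <= t0 -> is_derive t 1 f (df t).
Hypothesis f_le : forall t : R, 0 < t <= t0 ->
  df t <= n.-1%:R * (ckf k t / skf k t) * f t.
Hypothesis f_ge : forall t : R, 0 < t <= t0 ->
  0 <= df t + (n%:R - 3) * (ckf k t / skf k t) * f t.

(** Two natural exponents encode the power [a - m]: the power [n - 3] is negative when [n = 2], and
    the power [- (n - 1)] always is. *)
Let is_derive_f_skf (a m : nat) (t : R) : 0 < t <= t0 ->
  is_derive t 1 (fun t => f t * (skf k t ^+ a * (skf k t ^+ m)^-1))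
    ((df t + (a%:R - m%:R) * (ckf k t / skf k t) * f t) *
      (skf k t ^+ a * (skf k t ^+ m)^-1)).
Proof.
move=> t0t; have s0 : skf k t != 0.
  by case/andP: t0t => h _; exact/lt0r_neq0/skf_gt0.
have dX (j : nat) : is_derive t 1 (fun t => skf k t ^+ j)
    (j%:R * (ckf k t / skf k t) * skf k t ^+ j).
  apply: (is_derive_eq (is_deriveXf j (is_derive_skf k t))).
  by case: j => [|j]; rewrite ?mul0r// exprS; field.
have sm : skf k t ^+ m != 0 by rewrite expf_neq0.
apply: (is_derive_eq (is_deriveMf (fd t0t)
  (is_deriveMf (dX a) (@is_derive_inv _ _ (fun t => skf k t ^+ m) _ _ _ sm (dX m))))).
by field; rewrite sm s0.
Qed.

Let monotone_f (g dg : R -> R) (t : R) : 0 < t <= t0 ->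
  (forall t : R, 0 < t <= t0 -> is_derive t 1 g (dg t)) ->
  exists2 c, 0 < c <= t0 & g t0 - g t = dg c * (t0 - t).
Proof.
move=> /andP[tp tt0] gd.
have gi x : x \in `]t, t0[%R -> is_derive x 1 g (dg x).
  rewrite in_itv/= => /andP[tx xt0]; apply: gd.
  by rewrite (lt_trans tp)//= ltW.
have gc : {within `[t, t0], continuous g}.
  apply: derivable_within_continuous => x; rewrite in_itv/= => /andP[tx xt0].
  by have [] := gd x; rewrite ?(lt_le_trans tp).
have [c] := MVT_segment tt0 gi gc.
rewrite in_itv/= => /andP[tc ct0] ->; exists c => //.
by rewrite (lt_le_trans tp).
Qed.

(* [f / skf ^+ n.-1] is nonincreasing and, formally, [f * skf ^ (n - 3)] is
   nondecreasing; together they bound both signs of [f] near 0. *)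
Lemma growth_at_zero : exists C : R, 0 <= C /\
  forall t, 0 < t <= t0 -> skf k t <= 1 -> `|f t| * skf k t ^+ n <= C * skf k t ^+ 3.
Proof.
pose w a m (t : R) := skf k t ^+ a * (skf k t ^+ m)^-1.
have w0 a m (t : R) : 0 < t -> 0 < w a m t.
  by move=> tp; rewrite divr_gt0// exprn_gt0// skf_gt0.
have t0t0 : 0 < t0 <= t0 by rewrite t00 lexx.
pose C1 : R := `|f t0 * w 0%N n.-1 t0|; pose C2 : R := `|f t0 * w n 3%N t0|.
exists (C1 + C2); split=> [|t tt0 s1]; first by rewrite addr_ge0// normr_ge0.
have tp : 0 < t by case/andP: tt0.
have tt : 0 <= t0 - t by rewrite subr_ge0; case/andP: tt0.
have s0 : 0 < skf k t by exact: skf_gt0.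
have lower : f t0 * w 0%N n.-1 t0 <= f t * w 0%N n.-1 t.
  have [c /[dup] /andP[cp _] cc] := monotone_f tt0 (@is_derive_f_skf 0%N n.-1).
  rewrite -/(w 0%N n.-1 t0) -/(w 0%N n.-1 t) => h; rewrite -subr_le0 h.
  apply: mulr_le0_ge0 => //; apply: mulr_le0_ge0; last exact/ltW/w0.
  by have := f_le cc; rewrite sub0r !mulNr; lra.
have upper : f t * w n 3%N t <= f t0 * w n 3%N t0.
  have [c /[dup] /andP[cp _] cc] := monotone_f tt0 (@is_derive_f_skf n 3%N).
  rewrite -/(w n 3%N t0) -/(w n 3%N t) => h; rewrite -subr_ge0 h.
  by apply: mulr_ge0 => //; apply: mulr_ge0; [exact: f_ge|exact/ltW/w0].
have s3 : 0 < skf k t ^+ 3 by rewrite exprn_gt0.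
have h1 : f t * skf k t ^+ n <= C2 * skf k t ^+ 3.
  rewrite -ler_pdivrMr// -mulrA; apply: (le_trans upper); exact: ler_norm.
(* The lower bound [f >= - C1 s^(n-1)] is stronger than required: [s^(n-1) s^n <= s^3], because
   [s <= 1] and [2 n - 1 >= 3]. *)
have h2 : - (C1 * skf k t ^+ 3) <= f t * skf k t ^+ n.
  have sn : 0 < skf k t ^+ n.-1 by rewrite exprn_gt0.
  have {}lower : - (C1 * skf k t ^+ n.-1) <= f t.
    rewrite -mulNr -ler_pdivlMr//; apply: (le_trans (_ : _ <= f t0 * w 0%N n.-1 t0)).
      by rewrite lerNl (le_trans (ler_norm _))// normrN.
    by apply: (le_trans lower); rewrite /w expr0 mul1r.
  apply: le_trans (ler_wpM2r (ltW (exprn_gt0 n s0)) lower).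
  rewrite mulNr lerN2 -mulrA ler_wpM2l ?normr_ge0// -exprD.
  by apply: ler_wiXn2l => //; [exact: ltW|move: n2; clear; lia].
rewrite -{1}(gtr0_norm (exprn_gt0 n s0)) -normrM ler_norml; apply/andP; split.
  apply: le_trans h2; rewrite lerN2 ler_wpM2r ?(ltW s3)// lerDl.
  exact: normr_ge0.
by apply: (le_trans h1); rewrite ler_wpM2r ?(ltW s3)// lerDr normr_ge0.
Qed.

End GrowthAtZero.

Section Schwarz.
Context {R : realType} {V : normedModType R}.

Let mvt_line (g : V -> R) (x v : V) (h : R) : 0 < h ->
  (forall y, derivable g y v) ->
  exists2 s, 0 <= s <= h & g (h *: v + x) - g x = 'D_v g (s *: v + x) * h.
Proof.
move=> h0 dg.
have d (s : R) : is_derive s 1 (fun s : R => g (s *: v + x)) ('D_v g (s *: v + x)).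
  by apply: is_derive_line; exact/derivableP.
have gc : {within `[0, h], continuous (fun s : R => g (s *: v + x))}.
  by apply: derivable_within_continuous => s _; have [] := d s.
have [s] := MVT_segment (ltW h0) (fun s _ => d s) gc.
rewrite in_itv/= => s0; rewrite scale0r add0r subr0 => ->.
by exists s.
Qed.

(** The mean value theorem twice: along [v] for the increment of [f] in direction [h w], then along
    [w] for ['D_v f]. *)
Let second_difference (f : V -> R) (v w x : V) (h : R) : 0 < h ->
  (forall x, derivable f x v) -> (forall x, derivable ('D_v f) x w) ->
  exists s r, [/\ 0 <= s <= h, 0 <= r <= h &
    f (h *: v + (h *: w + x)) - f (h *: w + x) - (f (h *: v + x) - f x) =
    'D_w ('D_v f) (r *: w + (s *: v + x)) * h * h].
Proof.
move=> h0 dv dvw.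
have dg y : is_derive y v (fun y => f (h *: w + y) - f y)
    ('D_v f (h *: w + y) - 'D_v f y).
  apply: (@is_deriveB _ _ _ (fun y => f (h *: w + y))); last exact/derivableP.
  exact/is_derive_translate/derivableP.
have dg' y : derivable (fun y => f (h *: w + y) - f y) y v by have [] := dg y.
have [s s1 E] := mvt_line x h0 dg'.
have [r r1 E'] := mvt_line (s *: v + x) h0 dvw.
exists s, r; split => //.
have -> : h *: v + (h *: w + x) = h *: w + (h *: v + x) by rewrite addrCA.
have [_ Dg] := dg (s *: v + x).
by rewrite -E' -Dg -E; ring.
Qed.

Let near_corner (g : V -> R) (v w x : V) (e : R) : 0 < e -> continuous g ->
  exists2 d, 0 < d & forall h s r, 0 <= h <= d -> 0 <= s <= h -> 0 <= r <= h ->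
    `|g x - g (r *: w + (s *: v + x))| < e.
Proof.
move=> e0 cg; have /cvgrPdist_lt/(_ _ e0)/nbhs_ballP[d /= d0 dP] := cg x.
have m0 : 0 < 1 + `|v| + `|w| by rewrite -addrA ltr_pwDl// addr_ge0.
exists (d / (1 + `|v| + `|w|)); first by rewrite divr_gt0.
move=> h s r /andP[h0 hd] /andP[s0 sh] /andP[r0 rh]; apply: dP.
rewrite -ball_normE/= addrA opprD addrCA subrr addr0 normrN.
apply: (le_lt_trans (ler_normD _ _)); rewrite !normrZ !ger0_norm//.
apply: (@le_lt_trans _ _ (h * (`|v| + `|w|))).
  by rewrite mulrDr addrC lerD// ler_wpM2r.
apply: (@le_lt_trans _ _ (d / (1 + `|v| + `|w|) * (`|v| + `|w|))).
  by rewrite ler_wpM2r// addr_ge0.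
rewrite mulrAC ltr_pdivrMr// ltr_pM2l// -addrA ltrDr//.
Qed.

(* Both mixed derivatives approximate the same second difference of [f]. *)
Lemma schwarz (f : V -> R) (v w : V) (x : V) :
  (forall x, derivable f x v) -> (forall x, derivable f x w) ->
  (forall x, derivable ('D_v f) x w) -> (forall x, derivable ('D_w f) x v) ->
  continuous ('D_w ('D_v f)) -> continuous ('D_v ('D_w f)) ->
  'D_w ('D_v f) x = 'D_v ('D_w f) x.
Proof.
move=> dv dw dvw dwv cvw cwv; apply/eqP/negPn/negP => ne.
pose e : R := `|'D_w ('D_v f) x - 'D_v ('D_w f) x| / 2.
have e0 : 0 < e by rewrite divr_gt0// normr_gt0 subr_eq0.
have [d1 d10 d1P] := near_corner v w x e0 cvw.
have [d2 d20 d2P] := near_corner w v x e0 cwv.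
pose h : R := Num.min d1 d2.
have h0 : 0 < h by rewrite lt_min d10 d20.
have h1 : 0 <= h <= d1 by rewrite ltW//= ge_min lexx.
have h2 : 0 <= h <= d2 by rewrite ltW//= ge_min lexx orbT.
have [s [r [sh rh E]]] := second_difference x h0 dv dvw.
have [s' [r' [sh' rh' E']]] := second_difference x h0 dw dwv.
have := d1P h s r h1 sh rh; have := d2P h s' r' h2 sh' rh'.
have -> : 'D_v ('D_w f) (r' *: v + (s' *: w + x)) =
    'D_w ('D_v f) (r *: w + (s *: v + x)).
  apply: (mulIf (lt0r_neq0 h0)); apply: (mulIf (lt0r_neq0 h0)).
  apply: etrans (esym E') _; apply: etrans _ E; rewrite (addrCA (h *: w)).
  move: (f (h *: v + (h *: w + x))) (f (h *: w + x)) (f (h *: v + x)) (f x).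
  by move=> *; ring.
move: ('D_w ('D_v f) (r *: w + _)) => z A1 A2.
have := ler_normB ('D_w ('D_v f) x - z) ('D_v ('D_w f) x - z).
rewrite opprB addrA subrK => A3.
have A4 : e * 2 = `|'D_w ('D_v f) x - 'D_v ('D_w f) x| by rewrite /e; field.
have := le_lt_trans A3 (ltrD A2 A1).
by rewrite -A4 mulr_natr mulr2n ltxx.
Qed.

End Schwarz.

Section PointwiseContinuity.
Context {R : realType}.

Definition cont (T : topologicalType) (x : T) (f : T -> R) : Prop :=
  {for x, continuous f}.

Context {T : topologicalType}.
Implicit Types (f g : T -> R) (x : T).

Lemma cont_cst (c : R) x : cont x (fun _ : T => c).
Proof. exact: cst_continuous. Qed.

Lemma contD f g x : cont x f -> cont x g ->
  cont x (fun y => f y + g y).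
Proof. exact: cvgD. Qed.

Lemma contB f g x : cont x f -> cont x g ->
  cont x (fun y => f y - g y).
Proof. exact: cvgB. Qed.

Lemma contM f g x : cont x f -> cont x g ->
  cont x (fun y => f y * g y).
Proof. exact: cvgM. Qed.

Lemma contV f x : f x != 0 -> cont x f ->
  cont x (fun y => (f y)^-1).
Proof. by move=> f0; exact: cvgV. Qed.

Lemma cont_ext f g x : f =1 g -> cont x f -> cont x g.
Proof. by move=> /funext ->. Qed.

Lemma contX f (m : nat) x : cont x f ->
  cont x (fun y => f y ^+ m).
Proof.
move=> cf; elim: m => [|m IH].
  by apply: (@cont_ext (fun=> 1)) => [y|]; [rewrite expr0|exact: cont_cst].
apply: (@cont_ext (fun y => f y * f y ^+ m)) => [y|]; first by rewrite exprS.
exact: contM.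
Qed.

Lemma cont_norm f x : cont x f -> cont x (fun y => `|f y|).
Proof. exact: cvg_norm. Qed.

Lemma cont_sum (n : nat) (f : 'I_n -> T -> R) x :
  (forall i, cont x (f i)) ->
  cont x (fun y => \sum_(i < n) f i y).
Proof.
by move=> cf; apply: cvg_big => [|i _]; [exact: add_continuous|exact: cf].
Qed.

Lemma cont_comp f (g : R -> R) x : cont x f ->
  cont (f x) g -> cont x (fun y => g (f y)).
Proof. exact: continuous_comp. Qed.

Lemma cont_near f g x : (\forall y \near x, f y = g y) ->
  cont x f -> cont x g.
Proof.
move=> fg cf; rewrite /cont /prop_for /continuous_at -(nbhs_singleton fg).
by apply: cvg_trans cf; exact: near_eq_cvg.
Qed.

Lemma cont_dot (n : nat) (f g : T -> 'rV[R]_n) x :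
  (forall i, cont x (fun y => f y ord0 i)) -> (forall i, cont x (fun y => g y ord0 i)) ->
  cont x (fun y => dot (f y) (g y)).
Proof. by move=> cf cg; apply: cont_sum => i; exact: contM. Qed.

End PointwiseContinuity.

Section CoordinateContinuity.
Context {R : realType}.

Lemma cont_coord (n : nat) (x : 'rV[R]_n) (i : 'I_n) : cont x (fun y => y ord0 i).
Proof. exact: coord_continuous. Qed.

Lemma cont_coordB (n : nat) (x a : 'rV[R]_n) (i : 'I_n) :
  cont x (fun y => (y - a) ord0 i).
Proof.
have -> : (fun y : 'rV[R]_n => (y - a) ord0 i) = fun y => y ord0 i - a ord0 i.
  by apply/funext => y; rewrite !mxE.
by apply: contB; [exact: cont_coord|exact: cont_cst].
Qed.

End CoordinateContinuity.

(** * Regularity of the distance and of test functions *)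

Section DistanceFunction.
Context {R : realType} (n : nat) (k : R) (a : 'rV[R]_n).
Hypotheses (k0 : 0 <= k) (aM : space_form k a).
Implicit Types x : 'rV[R]_n.
Local Notation rho := (riem_dist k a).
Local Notation "''e_' i" := (delta_mx ord0 i : 'rV[R]_n) (at level 8, i at level 2).

Lemma dot_delta x (i : 'I_n) : dot x 'e_i = x ord0 i.
Proof.
rewrite /dot (bigD1 i)//= big1 => [|j ji]; rewrite !mxE ?eqxx ?mulr1 ?addr0//.
by rewrite (negbTE ji) andbF mulr0.
Qed.

Lemma continuous_sqnorm : continuous (fun x : 'rV[R]_n => dot x x).
Proof.
by move=> x; apply: (@dot_continuous R n _ (nbhs x) _ id id x x); exact: cvg_id.
Qed.

Lemma open_space_form : open (space_form k : set 'rV[R]_n).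
Proof.
rewrite /space_form; case: eqVneq => _; first exact: openT.
rewrite (_ : mkset _ = (fun x : 'rV[R]_n => dot x x) @^-1` [set t | t < 1]).
  by apply: open_comp => [x _|]; [exact: continuous_sqnorm|exact: open_lt].
apply/seteqP; split => x /=; rewrite -enorm_sqr expr_lt1//; exact: sqrtr_ge0.
Qed.

Lemma near_space_form x : space_form k x -> \forall y \near x, space_form k y.
Proof. by move=> xM; apply: open_nbhs_nbhs; split => //; exact: open_space_form. Qed.

Lemma continuous_conf x : space_form k x -> cont x (@conf R n k).
Proof.
move=> xM; rewrite /conf; case: eqVneq => [_|kn0]; first exact: cont_cst.
have x1 : dot x x < 1 by case/space_formP: xM => // /eqP; rewrite (negbTE kn0).
apply: contM; first exact: cont_cst.
apply: contV; first by rewrite enorm_sqr mulf_neq0// subr_eq0 eq_sym lt_eqF.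
apply: contM; first exact: cont_cst.
apply: contB; first exact: cont_cst.
apply: (@cont_ext _ _ (fun y => dot y y)) => [y|]; first by rewrite enorm_sqr.
exact: continuous_sqnorm.
Qed.

Lemma continuous_chord2 x : space_form k x -> cont x (chord2 k a).
Proof.
move=> xM; apply: contM.
  by apply: contM; [exact: continuous_conf|exact: cont_cst].
by apply: cont_dot => i; exact: cont_coordB.
Qed.

Lemma continuous_radial_field x (j : 'I_n) : space_form k x ->
  cont x (fun x => radial_field k a x ord0 j).
Proof.
move=> xM.
apply: (@cont_ext _ _ (fun x => conf k a * ((conf k x)^-1 * (x - a) ord0 j +
    k / 2 * dot (x - a) (x - a) * x ord0 j))).
  by move=> y; rewrite /radial_field !mxE.
apply: contM; first exact: cont_cst.
apply: contD; apply: contM; [|exact: cont_coordB| |exact: cont_coord].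
  by apply: contV; [exact/lt0r_neq0/conf_gt0|exact: continuous_conf].
apply: contM; first exact: cont_cst.
by apply: cont_dot => i; exact: cont_coordB.
Qed.

Lemma continuous_radial_slope x : space_form k x -> cont x (radial_slope k a).
Proof.
move=> xM; apply: contM; first exact: cont_cst.
apply: contD.
  by apply: contV; [exact/lt0r_neq0/conf_gt0|exact: continuous_conf].
apply: contM; first exact: cont_cst.
by apply: cont_dot => i; exact: cont_coordB.
Qed.

(** The closed form of the distance is known inside the space form only; that set is open, so the
    closed form may still be differentiated in place of the infimum. *)
Lemma near_riem_dist x : space_form k x ->
  \forall y \near x, chord_dist k (chord2 k a y) = rho y.
Proof. by move=> /near_space_form; apply: filterS => y yM; rewrite riem_distE. Qed.

Lemma continuous_riem_dist x : space_form k x -> cont x rho.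
Proof.
move=> xM; apply: (cont_near (near_riem_dist xM)).
apply: (@cont_comp _ _ (chord2 k a)); first exact: continuous_chord2.
by apply: continuous_chord_dist => //; exact: chord2_ge0.
Qed.

Lemma chord2_gt0 x : space_form k x -> x != a -> 0 < chord2 k a x.
Proof.
move=> xM xa; rewrite /chord2 !mulr_gt0 ?conf_gt0// dot_gt0//.
by rewrite subr_eq0.
Qed.

Lemma riem_dist_refl : rho a = 0.
Proof.
rewrite riem_distE// /chord2 subrr -[X in dot X _](scale0r 0) dotZl mul0r mulr0.
exact: chord_dist0.
Qed.

Lemma riem_dist_gt0 x : space_form k x -> x != a -> 0 < rho x.
Proof. by move=> xM xa; rewrite riem_distE// chord_dist_gt0// chord2_gt0. Qed.

Lemma ckf_riem_dist x : space_form k x -> ckf k (rho x) = 1 + k ^+ 2 * chord2 k a x / 2.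
Proof.
move=> xM; rewrite riem_distE//.
by have [] := @skf_ckf_chord_dist _ k k0 _ (chord2_ge0 k0 aM xM).
Qed.

Lemma skf_riem_dist_sqr x : space_form k x ->
  skf k (rho x) ^+ 2 = chord2 k a x + k ^+ 2 * chord2 k a x ^+ 2 / 4.
Proof.
move=> xM; have q0 := chord2_ge0 k0 aM xM; rewrite riem_distE//.
have [-> _] := @skf_ckf_chord_dist _ k k0 _ q0.
rewrite exprMn !sqr_sqrtr//; first by field.
exact: (le_trans ler01 (chord_dist_aux k q0)).
Qed.

Lemma radial_field_sqnorm x : space_form k x ->
  conf k x ^+ 2 * dot (radial_field k a x) (radial_field k a x) = skf k (rho x) ^+ 2.
Proof. by move=> xM; rewrite radial_field_norm// skf_riem_dist_sqr. Qed.

Lemma conf_radial_slope_ckf x : space_form k x ->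
  k * conf k x * dot (radial_field k a x) x + radial_slope k a x = ckf k (rho x).
Proof. by move=> xM; rewrite conf_radial_slope// ckf_riem_dist. Qed.

Lemma is_derive_riem_dist x (v : 'rV[R]_n) : space_form k x -> x != a ->
  is_derive x v rho
    (conf k x ^+ 2 * dot (radial_field k a x) v / skf k (rho x)).
Proof.
move=> xM xa; have q0 := chord2_gt0 xM xa.
have d1 := @is_derive_chord2 _ _ _ k0 _ id x v v a xM (is_derive_id x v).
have d2 := is_derive_comp1 d1 (is_derive_chord_dist k0 q0).
apply: (near_eq_is_derive (near_riem_dist xM)); apply: (is_derive_eq d2).
rewrite riem_distE//; have [-> _] := @skf_ckf_chord_dist _ k k0 _ (ltW q0).
field; rewrite !sqrtr_eq0 -!ltNge q0 /= andbT.
exact: (lt_le_trans ltr01 (chord_dist_aux k (ltW q0))).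
Qed.

(* The sup of [rho] over an open set is not attained: the gradient does not vanish. *)
Lemma dist_range_riem_dist (Omega : set 'rV[R]_n) x :
  open Omega -> Omega `<=` space_form k -> Omega x -> x != a ->
  dist_range Omega rho (rho x).
Proof.
move=> oO OM Ox xa; have xM := OM _ Ox; split; first exact: riem_dist_gt0.
pose Z := radial_field k a x.
have S0 : 0 < skf k (rho x) by apply/skf_gt0/riem_dist_gt0.
have d : is_derive (0 : R) 1 (fun h : R => rho (h *: Z + x))
    (conf k x ^+ 2 * dot Z Z / skf k (rho x)).
  by apply: is_derive_line; rewrite scale0r add0r; exact: is_derive_riem_dist.
have D0 : 0 < conf k x ^+ 2 * dot Z Z / skf k (rho x).
  by rewrite radial_field_sqnorm// expr2 mulfK ?lt0r_neq0.
have [y Oy rxy] : exists2 y, Omega y & rho x < rho y.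
  apply: contrapT => nex.
  have le y : Omega y -> rho y <= rho x.
    by move=> Oy; rewrite leNgt; apply/negP => h; apply: nex; exists y.
  have : \forall h \near (0 : R), Omega (h *: Z + x) /\ h *: Z + x != a.
    have cl : (h *: Z + x) @[h --> (0 : R)] --> 0 *: Z + x.
      by apply: cvgD; [apply: cvgZr_tmp; exact: cvg_id|exact: cvg_cst].
    have : nbhs (0 *: Z + x) [set y | Omega y /\ y != a].
      rewrite scale0r add0r; apply: filterI; first exact: open_nbhs_nbhs.
      apply: open_nbhs_nbhs; split => //.
      rewrite (_ : (fun y => _) = ~` [set a]).
        by apply: closed_openC; apply: accessible_closed_set1; exact/hausdorff_accessible.
      by apply/seteqP; split => y /= /eqP.
    by move=> /cl.
  move=> [e /= e0 eP].
  have eP' (h : R) : h \in `]- e, e[%R -> Omega (h *: Z + x) /\ h *: Z + x != a.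
    by rewrite in_itv/= -ltr_norml => he; apply: eP; rewrite /= sub0r normrN.
  have : is_derive (0 : R) 1 (fun h : R => rho (h *: Z + x)) 0.
    apply: (@derive1_at_max _ _ (- e) e).
    - lra.
    - move=> h /eP'[/OM hM ha].
      by have [] := is_derive_line (is_derive_riem_dist Z hM ha).
    - by rewrite in_itv/=; lra.
    - by move=> h /eP'[/le]; rewrite scale0r add0r.
  case=> _ D0'; case: d => _ DE; move: D0.
  by rewrite -DE D0' ltxx.
apply: (@lt_le_trans _ _ (rho y)%:E); first by rewrite lte_fin.
by apply: ereal_sup_ubound; exists y.
Qed.

End DistanceFunction.

Section TestFunctions.
Context {R : realType} (n : nat).
Variables (Omega : set 'rV[R]_n) (u : 'rV[R]_n -> R).
Hypothesis ut : test_function Omega u.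
Local Notation K := (closure [set x | u x != 0]).
Local Notation "''e_' i" := (delta_mx ord0 i : 'rV[R]_n) (at level 8, i at level 2).

Lemma near_not_support x : ~ K x -> \forall y \near x, ~ K y.
Proof.
have cK : closed K by exact: closed_closure.
by move=> nKx; apply: open_nbhs_nbhs; split => //; exact: closed_openC.
Qed.

Lemma iter_partial_off_support s x : ~ K x -> iter_partial s u x = 0.
Proof.
elim: s x => [|i s IH] x nKx /=.
  by apply/eqP/negPn/negP => ux; apply: nKx; exact: subset_closure.
by apply: (derive_eq0_off_closed _ _ IH nKx); exact: closed_closure.
Qed.

(** Splits every regularity claim on the whole of R^n: at points of [Omega] the function is smooth,
    and off the support it vanishes in a neighbourhood. *)
Lemma test_function_cases x : Omega x \/ ~ K x.
Proof. by case: ut => _ _ KO; have [/KO|] := pselect (K x); [left|right]. Qed.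

Lemma derivable_iter_partial s x (v : 'rV[R]_n) : derivable (iter_partial s u) x v.
Proof.
have [Ox|nKx] := test_function_cases x.
  by apply: diff_derivable; case: ut => us _ _; exact: us.
apply: (@near_eq_derivable _ _ _ (cst 0)); last exact: derivable_cst.
apply: filterS (near_not_support nKx) => y nKy.
by rewrite iter_partial_off_support.
Qed.

Lemma continuous_iter_partial s : continuous (iter_partial s u).
Proof.
move=> x; have [Ox|nKx] := test_function_cases x.
  by apply: differentiable_continuous; case: ut => us _ _; exact: us.
apply: (@cont_near _ _ (fun=> 0)); last exact: cont_cst.
by apply: filterS (near_not_support nKx) => y nKy; rewrite iter_partial_off_support.
Qed.

Lemma iter_partialC (i j : 'I_n) x : partial i (partial j u) x = partial j (partial i u) x.
Proof.
apply: (@schwarz _ _ u 'e_j 'e_i).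
- by move=> y; exact: (@derivable_iter_partial [::] y 'e_j).
- by move=> y; exact: (@derivable_iter_partial [::] y 'e_i).
- by move=> y; exact: (@derivable_iter_partial [:: j] y 'e_i).
- by move=> y; exact: (@derivable_iter_partial [:: i] y 'e_j).
- exact: (@continuous_iter_partial [:: i; j]).
- exact: (@continuous_iter_partial [:: j; i]).
Qed.

End TestFunctions.

(** * The Pohozaev identity *)

Section Pohozaev.
Context {R : realType} (n : nat) (k : R) (a : 'rV[R]_n).
Hypotheses (k0 : 0 <= k) (aM : space_form k a) (n2 : (2 <= n)%N).
Variables (u : 'rV[R]_n -> R) (F dF : R -> R).
Hypothesis du_derivable : forall (i : 'I_n) (x v : 'rV[R]_n), derivable (partial i u) x v.
Hypothesis du_sym : forall (i j : 'I_n) x,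
  partial i (partial j u) x = partial j (partial i u) x.
Implicit Types x : 'rV[R]_n.
Local Notation rho := (riem_dist k a).
Local Notation "''e_' i" := (delta_mx ord0 i : 'rV[R]_n) (at level 8, i at level 2).
Local Notation Z := (radial_field k a).
Local Notation S x := (skf k (rho x)).
Local Notation C x := (ckf k (rho x)).
Local Notation hess i j x := (partial i (partial j u) x).

Definition egrad (u : 'rV[R]_n -> R) x : 'rV[R]_n := \row_i partial i u x.
Local Notation g := (egrad u).

(** Components of the Riemannian field [F r grad u - F |grad u|^2 grad rho / 2], with [r] the radial
    derivative, multiplied by the volume density [conf^n]. The Euclidean divergence of the product
    is then [conf^n] times the Riemannian divergence. *)
Definition pohozaev_field (i : 'I_n) x : R :=
  conf k x ^+ (n - 2) * (F (rho x) * (S x)^-1) *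
  (partial i u x * dot (Z x) (g x) - 2^-1 * (Z x ord0 i * dot (g x) (g x))).

Let dZ (i j : 'I_n) (x : 'rV[R]_n) : R := radial_slope k a x * (i == j)%:R + k * conf k a *
  ((x - a) ord0 i * x ord0 j - x ord0 i * (x - a) ord0 j).

(** The product rule written out, with [dF] in place of the derivative of [F]: an explicit formula,
    whose continuity follows term by term and which vanishes where both [F] and [dF] do. *)
Definition pohozaev_partial (i : 'I_n) x : R :=
  conf k x ^+ (n - 2) * ((n - 2)%:R * k * conf k x * x ord0 i) *
    (F (rho x) * (S x)^-1) *
    (partial i u x * dot (Z x) (g x) - 2^-1 * (Z x ord0 i * dot (g x) (g x))) +
  conf k x ^+ (n - 2) * ((dF (rho x) * (S x)^-1 - F (rho x) * C x * (S x) ^- 2) *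
    (conf k x ^+ 2 * Z x ord0 i * (S x)^-1)) *
    (partial i u x * dot (Z x) (g x) - 2^-1 * (Z x ord0 i * dot (g x) (g x))) +
  conf k x ^+ (n - 2) * (F (rho x) * (S x)^-1) *
    (hess i i x * dot (Z x) (g x) +
     partial i u x * (\sum_j (dZ i j x * partial j u x + Z x ord0 j * hess i j x)) -
     2^-1 * (radial_slope k a x * dot (g x) (g x) +
             Z x ord0 i * (2 * \sum_j partial j u x * hess i j x))).

Lemma is_derive_sumf (V : normedModType R) (f : 'I_n -> V -> R) (x v : V)
    (df : 'I_n -> R) : (forall i, is_derive x v (f i) (df i)) ->
  is_derive x v (fun y => \sum_i f i y) (\sum_i df i).
Proof.
move=> fd; have -> : (fun y => \sum_i f i y) = \sum_i f i.
  by apply/funext => y; rewrite fct_sumE.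
exact: is_derive_sum.
Qed.

Lemma is_derive_pohozaev_field (i : 'I_n) x : space_form k x -> x != a ->
  is_derive (rho x) 1 F (dF (rho x)) ->
  is_derive x 'e_i (pohozaev_field i) (pohozaev_partial i x).
Proof.
move=> xM xa Fd.
have S0 : S x != 0 by apply/lt0r_neq0/skf_gt0/riem_dist_gt0.
have p0 : conf k x != 0 by exact/lt0r_neq0/conf_gt0.
have dp := @is_derive_conf _ _ k _ id x 'e_i 'e_i xM (is_derive_id x 'e_i).
have dr := is_derive_riem_dist k0 aM 'e_i xM xa.
have dS := is_derive_comp1 dr (is_derive_skf k (rho x)).
have dFr := is_derive_comp1 dr Fd.
have dphi := is_deriveMf dFr (@is_derive_inv _ _ (fun x => S x) _ _ _ S0 dS).
have dZj j := @is_derive_radial_field _ _ k k0 _ id x 'e_i 'e_i a j xM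
  (is_derive_id x 'e_i).
have dd j : is_derive x 'e_i (partial j u) (hess i j x) by exact/derivableP.
have dz : is_derive x 'e_i (fun y => dot (Z y) (g y))
    (\sum_j (dZ i j x * partial j u x + Z x ord0 j * hess i j x)).
  have -> : (fun y => dot (Z y) (g y)) = (fun y => \sum_j Z y ord0 j * partial j u y).
    by apply/funext => y; apply: eq_bigr => j _; rewrite !mxE.
  apply: (is_derive_eq (is_derive_sumf (fun j => is_deriveMf (dZj j) (dd j)))).
  apply: eq_bigr => j _; rewrite !dot_delta /dZ.
  have -> : ('e_i : 'rV[R]_n) ord0 j = (i == j)%:R by rewrite mxE eqxx eq_sym.
  by ring.
have dW : is_derive x 'e_i (fun y => dot (g y) (g y))
    (2 * \sum_j partial j u x * hess i j x).
  have -> : (fun y => dot (g y) (g y)) =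
      (fun y => \sum_j partial j u y * partial j u y).
    by apply/funext => y; apply: eq_bigr => j _; rewrite !mxE.
  apply: (is_derive_eq (is_derive_sumf (fun j => is_deriveMf (dd j) (dd j)))).
  by rewrite mulr_sumr; apply: eq_bigr => j _; ring.
have dpm := is_deriveXf (n - 2) dp.
apply: (is_derive_eq (is_deriveMf (is_deriveMf dpm dphi) (is_deriveBf
  (is_deriveMf (dd i) dz) (is_deriveMlf 2^-1 (is_deriveMf (dZj i) dW))))).
rewrite !dot_delta /pohozaev_partial.
have -> : ('e_i : 'rV[R]_n) ord0 i = 1 by rewrite mxE !eqxx.
have -> : (n - 2)%:R * conf k x ^+ (n - 2).-1 * (k * conf k x ^+ 2 * x ord0 i) =
    conf k x ^+ (n - 2) * ((n - 2)%:R * k * conf k x * x ord0 i).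
  by case: (n - 2)%N => [|m]; rewrite ?mul0r ?mulr0// [conf k x ^+ m.+1]exprS /=; ring.
have -> : (F \o rho) x = F (rho x) by [].
move: (\sum_j _) (\sum_j _) (dot _ _) (dot _ _) (conf k x ^+ (n - 2)) => s1 s2 d1 d2 pm.
move: S0; move: (skf _ _) (F _) (dF _) (ckf _ _) => s f df c s0.
by field.
Qed.

Lemma laplace_beltramiE x : space_form k x ->
  conf k x ^+ n * laplace_beltrami k u x = conf k x ^+ (n - 2) *
    ((n - 2)%:R * k * conf k x * dot x (g x) + \sum_i hess i i x).
Proof.
move=> xM; have p0 : conf k x != 0 by exact/lt0r_neq0/conf_gt0.
rewrite /laplace_beltrami mulrA divff ?expf_neq0// mul1r.
rewrite mulrDr /dot !mulr_sumr -big_split; apply: eq_bigr => i _ /=.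
have dp := @is_derive_conf _ _ k _ id x 'e_i 'e_i xM (is_derive_id x 'e_i).
have dd : is_derive x 'e_i (partial i u) (hess i i x) by exact/derivableP.
have [_ E] := is_deriveMf (is_deriveXf (n - 2) dp) dd.
rewrite {1}/partial E dot_delta mxE.
case: (n - 2)%N => [|m]; first by rewrite /=; ring.
by rewrite [conf k x ^+ m.+1]exprS /=; ring.
Qed.

Lemma grad_radE x : space_form k x -> x != a ->
  grad_rad k rho u x = dot (Z x) (g x) / S x.
Proof.
move=> xM xa; have p0 : conf k x != 0 by exact/lt0r_neq0/conf_gt0.
rewrite /grad_rad /riem_metric /dot mulr_sumr mulr_suml.
apply: eq_bigr => i _; rewrite [riem_grad k u x _ _]mxE [riem_grad k rho x _ _]mxE.
rewrite [g x _ _]mxE.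
have [_] := is_derive_riem_dist k0 aM 'e_i xM xa; rewrite {2}/partial => ->.
have S0 : S x != 0 by apply/lt0r_neq0/skf_gt0/riem_dist_gt0.
by rewrite dot_delta; field; rewrite p0 S0.
Qed.

Lemma riem_norm_gradE x : space_form k x ->
  riem_norm k x (riem_grad k u x) ^+ 2 = dot (g x) (g x) / conf k x ^+ 2.
Proof.
move=> xM; have p0 : conf k x != 0 by exact/lt0r_neq0/conf_gt0.
rewrite riem_norm_sqr// /dot mulr_sumr mulr_suml.
by apply: eq_bigr => i _; rewrite !mxE; field.
Qed.

Lemma grad_rad_le x : space_form k x -> x != a ->
  grad_rad k rho u x ^+ 2 <= riem_norm k x (riem_grad k u x) ^+ 2.
Proof.
move=> xM xa; rewrite grad_radE// riem_norm_gradE//.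
have S0 : 0 < S x by apply/skf_gt0/riem_dist_gt0.
have p0 := conf_gt0 k0 xM.
rewrite expr_div_n ler_pdivrMr ?exprn_gt0// mulrAC ler_pdivlMr ?exprn_gt0//.
rewrite -radial_field_sqnorm// mulrC mulrCA.
have := cauchy_schwarz_dot (Z x) (g x).
by move/(ler_wpM2l (sqr_ge0 (conf k x))); congr (_ <= _); ring.
Qed.

(** Three cancellations bring the sum to this form: the antisymmetric part of the derivative of the
    radial field, all second derivatives of [u] outside the Laplacian, and the term in [dot (Z x) x]
    coming from the conformal factor. *)
Lemma sum_pohozaev_partial x : space_form k x -> x != a ->
  \sum_i pohozaev_partial i x = conf k x ^+ n *
    (F (rho x) * grad_rad k rho u x * laplace_beltrami k u x +
     (dF (rho x) - F (rho x) * (C x / S x)) * grad_rad k rho u x ^+ 2 -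
     2^-1 * riem_norm k x (riem_grad k u x) ^+ 2 *
       (dF (rho x) + (n%:R - 3) * F (rho x) * (C x / S x))).
Proof.
move=> xM xa; have p0 : conf k x != 0 by exact/lt0r_neq0/conf_gt0.
have S0 : S x != 0 by apply/lt0r_neq0/skf_gt0/riem_dist_gt0.
set z := dot (Z x) (g x); set W := dot (g x) (g x).
have B (c : 'rV[R]_n) : \sum_i c ord0 i *
    (partial i u x * z - 2^-1 * (Z x ord0 i * W)) =
    dot c (g x) * z - 2^-1 * (dot c (Z x) * W).
  rewrite /dot !mulr_suml mulr_sumr -sumrB; apply: eq_bigr => i _.
  by rewrite !mxE; ring.
pose T := \sum_i \sum_j partial i u x * (Z x ord0 j * hess i j x).
(* The antisymmetric part of [dZ] is contracted with the symmetric product of the gradient with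
   itself, so only the slope survives. *)
have T1 : \sum_i partial i u x *
      (\sum_j (dZ i j x * partial j u x + Z x ord0 j * hess i j x)) =
    radial_slope k a x * W + T.
  have E (i : 'I_n) : \sum_j (dZ i j x * partial j u x + Z x ord0 j * hess i j x) =
      radial_slope k a x * partial i u x + k * conf k a *
        ((x - a) ord0 i * dot x (g x) - x ord0 i * dot (x - a) (g x)) +
      \sum_j Z x ord0 j * hess i j x.
    rewrite big_split/=; congr (_ + _); rewrite /dot !mulr_sumr -sumrB mulr_sumr.
    have -> : radial_slope k a x * partial i u x =
        \sum_j radial_slope k a x * (i == j)%:R * partial j u x.
      rewrite (bigD1 i)//= big1 ?addr0 ?eqxx ?mulr1// => j ji.
      by rewrite eq_sym (negbTE ji) mulr0 mul0r.
    rewrite -big_split; apply: eq_bigr => j _ /=.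
    by rewrite [g x _ _]mxE /dZ; ring.
  under eq_bigr do rewrite E mulrDr.
  rewrite big_split/=; congr (_ + _); last first.
    by rewrite /T; apply: eq_bigr => i _; rewrite mulr_sumr.
  transitivity (\sum_i (radial_slope k a x * (g x ord0 i * g x ord0 i) +
      k * conf k a * (dot x (g x) * ((x - a) ord0 i * g x ord0 i) -
                      dot (x - a) (g x) * (x ord0 i * g x ord0 i)))).
    by apply: eq_bigr => i _; rewrite [g x _ _]mxE; ring.
  rewrite big_split/= -!mulr_sumr sumrB -!mulr_sumr -/(dot x (g x)).
  by rewrite -/(dot (x - a) (g x)) -/(dot (g x) (g x)) -/W; ring.
(* Symmetry of the Hessian identifies this sum with [2 T]; with the factor [2^-1] it cancels the [T]
   of the previous term. *)
have T2 : \sum_i Z x ord0 i * (2 * \sum_j partial j u x * hess i j x) = 2 * T.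
  rewrite /T exchange_big/= mulr_sumr; apply: eq_bigr => i _.
  rewrite mulrCA; congr (_ * _); rewrite mulr_sumr; apply: eq_bigr => j _.
  by rewrite du_sym; ring.
have -> : \sum_i pohozaev_partial i x =
  conf k x ^+ (n - 2) * ((n - 2)%:R * k * conf k x) * (F (rho x) * (S x)^-1) *
    (dot x (g x) * z - 2^-1 * (dot x (Z x) * W)) +
  conf k x ^+ (n - 2) * ((dF (rho x) * (S x)^-1 - F (rho x) * C x * (S x) ^- 2) *
    (conf k x ^+ 2 * (S x)^-1)) *
    (z * z - 2^-1 * (dot (Z x) (Z x) * W)) +
  conf k x ^+ (n - 2) * (F (rho x) * (S x)^-1) *
    ((\sum_i hess i i x) * z + (radial_slope k a x * W + T) -
     2^-1 * (n%:R * (radial_slope k a x * W) + 2 * T)).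
  rewrite /pohozaev_partial -/z -/W -T1 -T2 -!B; clearbody z W.
  have -> : n%:R * (radial_slope k a x * W) = \sum_(i < n) radial_slope k a x * W.
    by rewrite sumr_const card_ord mulr_natl.
  rewrite -[(\sum_i _) + \sum_i Z x ord0 i * _]big_split/=.
  rewrite mulr_suml [2^-1 * \sum_i _]mulr_sumr -big_split/= -sumrB !mulr_sumr.
  rewrite -!big_split/=; by apply: eq_bigr => i _; ring.
(* Exchanges the Euclidean slope for [ckf]; the remaining [dot (Z x) x] is the one produced by
   differentiating [conf ^+ (n - 2)]. *)
have slopeE : radial_slope k a x = C x - k * conf k x * dot (Z x) x.
  by rewrite -conf_radial_slope_ckf//; ring.
have ZZ : dot (Z x) (Z x) = S x ^+ 2 / conf k x ^+ 2.
  by rewrite -radial_field_sqnorm//; field.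
have L := laplace_beltramiE xM.
have pn : conf k x ^+ n = conf k x ^+ (n - 2) * conf k x ^+ 2.
  by rewrite -exprD subnK.
have nE : n%:R = (n - 2)%:R + 2 :> R by rewrite -natrD subnK.
have LE : laplace_beltrami k u x = ((n - 2)%:R * k * conf k x * dot x (g x) +
    \sum_i hess i i x) / conf k x ^+ 2.
  apply: (@mulfI _ (conf k x ^+ n)); first by rewrite expf_neq0.
  by rewrite L pn; field.
rewrite LE grad_radE// riem_norm_gradE// pn ZZ slopeE nE (dotC x (Z x)) -/z -/W.
move: (conf k x ^+ (n - 2)) (\sum_i _) (dot (Z x) x) (dot x (g x)) => pm h zx xg.
move: (n - 2)%:R => m.
move: S0 p0; move: (skf _ _) (F _) (dF _) (ckf _ _) (conf _ _) => s f df c p s0 p0.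
by field; rewrite s0 p0.
Qed.

End Pohozaev.

Section PohozaevContinuity.
Context {R : realType} (n : nat) (k : R) (a : 'rV[R]_n).
Hypotheses (k0 : 0 <= k) (aM : space_form k a).
Variables (u : 'rV[R]_n -> R).
Hypothesis du_derivable : forall (i : 'I_n) (x v : 'rV[R]_n), derivable (partial i u) x v.
Hypothesis du_cont : forall (i : 'I_n) x, cont x (partial i u).
Hypothesis hess_cont : forall (i j : 'I_n) x, cont x (partial i (partial j u)).
Implicit Types x : 'rV[R]_n.
Local Notation rho := (riem_dist k a).
Local Notation Z := (radial_field k a).
Local Notation S x := (skf k (rho x)).
Local Notation C x := (ckf k (rho x)).
Local Notation g := (egrad u).

Lemma near_neq x : x != a -> \forall y \near x, y != a.
Proof.
move=> xa; apply: open_nbhs_nbhs; split => //.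
rewrite (_ : (fun y => _) = ~` [set a]).
  by apply: closed_openC; apply: accessible_closed_set1; exact/hausdorff_accessible.
by apply/seteqP; split => y /= /eqP.
Qed.

Lemma cont_egrad x i : cont x (fun y => g y ord0 i).
Proof.
by apply: (@cont_ext _ _ (partial i u)) => [y|]; [rewrite mxE|exact: du_cont].
Qed.

Lemma cont_skf x : space_form k x -> cont x (fun y => S y).
Proof.
move=> xM; apply: (@cont_comp _ _ rho); first exact: continuous_riem_dist.
exact: is_derive1_continuous (is_derive_skf k _).
Qed.

Lemma cont_ckf x : space_form k x -> cont x (fun y => C y).
Proof.
move=> xM; apply: (@cont_comp _ _ rho); first exact: continuous_riem_dist.
exact: is_derive1_continuous (is_derive_ckf k _).
Qed.

Lemma cont_dotZg x : space_form k x -> cont x (fun y => dot (Z y) (g y)).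
Proof.
move=> xM; apply: cont_dot => i; last exact: cont_egrad.
exact: continuous_radial_field.
Qed.

Lemma cont_dotgg x : cont x (fun y => dot (g y) (g y)).
Proof. by apply: cont_dot => i; exact: cont_egrad. Qed.

Lemma cont_skfV x : space_form k x -> x != a -> cont x (fun y => (S y)^-1).
Proof.
move=> xM xa; apply: contV; last exact: cont_skf.
exact/lt0r_neq0/skf_gt0/riem_dist_gt0.
Qed.

Lemma cont_grad_rad x : space_form k x -> x != a -> cont x (grad_rad k rho u).
Proof.
move=> xM xa; apply: (@cont_near _ _ (fun y => dot (Z y) (g y) / S y)).
  apply: filterS (filterI (near_space_form xM) (near_neq xa)) => y [yM ya].
  by rewrite grad_radE.
by apply: contM; [exact: cont_dotZg|exact: cont_skfV].
Qed.

Lemma cont_norm_grad x : space_form k x ->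
  cont x (fun y => riem_norm k y (riem_grad k u y) ^+ 2).
Proof.
move=> xM; apply: (@cont_near _ _ (fun y => dot (g y) (g y) / conf k y ^+ 2)).
  by apply: filterS (near_space_form xM) => y yM; rewrite riem_norm_gradE.
apply: contM; first exact: cont_dotgg.
apply: contV; first by rewrite expf_neq0// lt0r_neq0// conf_gt0.
by apply: contX; exact: continuous_conf.
Qed.

Lemma cont_laplace x : space_form k x -> cont x (laplace_beltrami k u).
Proof.
move=> xM; apply: (@cont_near _ _ (fun y => (conf k y ^+ n)^-1 *
  (conf k y ^+ (n - 2) * ((n - 2)%:R * k * conf k y * dot y (g y) +
    \sum_i partial i (partial i u) y)))).
  apply: filterS (near_space_form xM) => y yM.
  rewrite -laplace_beltramiE// mulrA mulVf ?mul1r//.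
  by rewrite expf_neq0// lt0r_neq0// conf_gt0.
have cp := continuous_conf xM.
apply: contM.
  by apply: contV; [rewrite expf_neq0// lt0r_neq0// conf_gt0|exact: contX].
apply: contM; first exact: contX.
apply: contD; last by apply: cont_sum => i; exact: hess_cont.
apply: contM; first by apply: contM => //; exact: cont_cst.
by apply: cont_dot => i; [exact: cont_coord|exact: cont_egrad].
Qed.

Lemma cont_pohozaev_partial (F dF : R -> R) (i : 'I_n) x :
  space_form k x -> x != a -> cont (rho x) F -> cont (rho x) dF ->
  cont x (pohozaev_partial k a u F dF i).
Proof.
move=> xM xa cF cdF.
have cr : cont x rho by exact: continuous_riem_dist.
have cFr : cont x (fun y => F (rho y)) by exact: cont_comp.
have cdFr : cont x (fun y => dF (rho y)) by exact: cont_comp.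
have cp := continuous_conf xM.
have cZ j := @continuous_radial_field _ _ _ a k0 _ j xM.
have csl := @continuous_radial_slope _ _ _ a k0 _ xM.
have cV := cont_skfV xM xa.
have cV2 : cont x (fun y => (S y) ^- 2).
  apply: contV; last by apply: contX; exact: cont_skf.
  by rewrite expf_neq0//; exact/lt0r_neq0/skf_gt0/riem_dist_gt0.
have cc := cont_ckf xM; have czg := cont_dotZg xM; have cgg := @cont_dotgg x.
have cco (j : 'I_n) := @cont_coord _ _ x j.
have ccB (j : 'I_n) := @cont_coordB _ _ x a j.
have cB : cont x (fun x => partial i u x * dot (Z x) (g x) -
    2^-1 * (Z x ord0 i * dot (g x) (g x))).
  apply: contB; first exact: contM.
  by apply: contM; [exact: cont_cst|exact: contM].
apply: contD; [apply: contD|].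
- apply: contM => //; apply: contM; last exact: contM.
  apply: contM; first exact: contX.
  by apply: contM => //; apply: contM => //; exact: cont_cst.
- apply: contM => //; apply: contM; first exact: contX.
  apply: contM.
    by apply: contB; [exact: contM|apply: contM => //; exact: contM].
  by apply: contM => //; apply: contM => //; exact: contX.
- apply: contM; first by apply: contM; [exact: contX|exact: contM].
  apply: contB.
    apply: contD; first exact: contM.
    apply: contM => //; apply: cont_sum => j; apply: contD; last exact: contM.
    apply: contM => //; apply: contD; first by apply: contM => //; exact: cont_cst.
    apply: contM; first exact: cont_cst.
    by apply: contB; exact: contM.
  apply: contM; first exact: cont_cst.
  apply: contD; first exact: contM.
  apply: contM => //; apply: contM; first exact: cont_cst.
  by apply: cont_sum => j; exact: contM.
Qed.

End PohozaevContinuity.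

(** * The weighted inequality away from the pole *)

Section RadialWeights.
Context {R : realType} (n : nat) (k : R) (a : 'rV[R]_n) (Omega : set 'rV[R]_n).
Hypotheses (k0 : 0 <= k) (n2 : (2 <= n)%N) (aM : space_form k a).
Local Notation rho := (riem_dist k a).
Local Notation I := (dist_range Omega rho).

Lemma dist_range_le (t t' : R) : I t -> 0 < t' <= t -> I t'.
Proof.
move=> [_ tO] /andP[t'0 t't]; split => //; apply: le_lt_trans tO.
by rewrite lee_fin.
Qed.

Lemma smooth1_on_is_derive (g : R -> R) (t : R) : smooth1_on I g -> I t ->
  is_derive t 1 g (derive1 g t).
Proof. by move=> gs It; split; [exact: (gs 0%N)|rewrite derive1E]. Qed.

Lemma smooth1_on_cont (g : R -> R) (t : R) : smooth1_on I g -> I t -> cont t g.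
Proof. by move=> gs It; exact: is_derive1_continuous (smooth1_on_is_derive gs It). Qed.

Lemma smooth1_on_cont_derive (g : R -> R) (t : R) : smooth1_on I g -> I t ->
  cont t (derive1 g).
Proof.
move=> gs It; have d : derivable (derive1 g) t 1 by exact: (gs 1%N).
exact: is_derive1_continuous (derivableP d).
Qed.

Variables (v V H : R -> R).
Hypotheses (vs : smooth1_on I v) (Hs : smooth1_on I H).
Hypothesis v0 : forall t, I t -> 0 < v t.
Hypothesis V0 : forall t, I t -> 0 <= V t.
Hypothesis riccati : forall t, I t ->
  V t <= - derive1 H t + (Lct n k t - derive1 v t / v t) * H t - H t ^+ 2.

Definition vH (t : R) : R := v t * H t.
Definition dvH (t : R) : R := derive1 v t * H t + v t * derive1 H t.

Lemma is_derive_vH (t : R) : I t -> is_derive t 1 vH (dvH t).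
Proof.
move=> It; apply: (is_derive_eq (is_deriveMf (smooth1_on_is_derive vs It)
  (smooth1_on_is_derive Hs It))).
by rewrite /dvH addrC.
Qed.

Lemma derive1_vH (t : R) : I t -> derive1 (fun s => v s * H s) t = dvH t.
Proof. by move=> /is_derive_vH[_]; rewrite derive1E. Qed.

Lemma cont_vH (t : R) : I t -> cont t vH.
Proof.
move=> It; exact: contM (smooth1_on_cont vs It) (smooth1_on_cont Hs It).
Qed.

Lemma cont_dvH (t : R) : I t -> cont t dvH.
Proof.
move=> It; apply: contD; apply: contM.
- exact: smooth1_on_cont_derive vs It.
- exact: smooth1_on_cont Hs It.
- exact: smooth1_on_cont vs It.
- exact: smooth1_on_cont_derive Hs It.
Qed.

(** [v] times the left-hand side of the Riccati inequality, with the terms in [v'] and [H'] gathered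
    into the derivative of [v H]. It will be the coefficient of the squared radial derivative, and
    [tangential_weight] that of the rest of the squared gradient. *)
Definition riccati_weight (t : R) : R :=
  - dvH t + n.-1%:R * (ckf k t / skf k t) * vH t - v t * H t ^+ 2.

Lemma riccati_weight_ge (t : R) : I t -> v t * V t <= riccati_weight t.
Proof.
move=> It; have t0 : 0 < t by case: It.
have vt := v0 It; apply: le_trans (ler_wpM2l (ltW vt) (riccati It)) _.
rewrite /riccati_weight /Lct ct_skf//.
have s0 := lt0r_neq0 (skf_gt0 k t0).
by rewrite le_eqVlt; apply/orP; left; apply/eqP; rewrite /dvH /vH; field; rewrite s0 lt0r_neq0.
Qed.

Definition tangential_weight (t : R) : R :=
  dvH t + (n%:R - 3) * (ckf k t / skf k t) * vH t.

Lemma tangential_weightE (t : R) : I t -> E1 n k v H t = tangential_weight t.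
Proof.
move=> It; have t0 : 0 < t by case: It.
rewrite /E1 derive1_vH// /Lct ct_skf// /tangential_weight /vH.
have -> : n%:R = n.-1%:R + 1 :> R by rewrite natr1 prednK// (ltn_trans _ n2).
by ring.
Qed.

Lemma E2E (t : R) : I t -> E2 k v H t = tangential_weight t - riccati_weight t.
Proof.
move=> It; have t0 : 0 < t by case: It.
rewrite /E2 derive1_vH// ct_skf// /tangential_weight /riccati_weight /vH.
have -> : n%:R = n.-1%:R + 1 :> R by rewrite natr1 prednK// (ltn_trans _ n2).
by ring.
Qed.

(** The sign of [V] enters here: dropping the nonnegative terms [v V] and [v H^2] from the Riccati
    inequality leaves the upper bound on the derivative of [v H]. *)
Lemma vH_growth (t0 : R) : I t0 ->
  (forall t, I t -> 0 <= tangential_weight t) ->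
  exists C : R, 0 <= C /\ forall t : R, 0 < t <= t0 -> skf k t <= 1 ->
    `|vH t| * skf k t ^+ n <= C * skf k t ^+ 3.
Proof.
move=> It0 tw; have t00 : 0 < t0 by case: It0.
apply: (@growth_at_zero _ n k vH dvH t0) => //.
- by move=> t tt; apply: is_derive_vH; exact: dist_range_le tt.
- move=> t tt; have It := dist_range_le It0 tt.
  have := riccati_weight_ge It; rewrite /riccati_weight.
  have := v0 It; have := V0 It => VV vv.
  have : 0 <= v t * V t by rewrite mulr_ge0// ltW.
  have : 0 <= v t * H t ^+ 2 by rewrite mulr_ge0 ?sqr_ge0// ltW.
  lra.
- by move=> t tt; apply: tw; exact: dist_range_le tt.
Qed.

Variable e : R.
Hypothesis e0 : 0 < e.

Definition chi (t : R) : R := step (skf k t / e).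
Definition dchi (t : R) : R := dstep (skf k t / e) * (ckf k t / e).
Definition chi_vH (t : R) : R := chi t * vH t.
Definition dchi_vH (t : R) : R := dchi t * vH t + chi t * dvH t.

Lemma is_derive_chi (t : R) : is_derive t 1 chi (dchi t).
Proof.
have d : is_derive t 1 (fun t => skf k t / e) (ckf k t / e).
  have := is_deriveMlf e^-1 (is_derive_skf k t).
  by rewrite [e^-1 * ckf k t]mulrC; under eq_fun do rewrite mulrC.
exact: (is_derive_comp1 d (is_derive_step (skf k t / e))).
Qed.

Lemma is_derive_chi_vH (t : R) : I t -> is_derive t 1 chi_vH (dchi_vH t).
Proof.
move=> It; apply: (is_derive_eq (is_deriveMf (is_derive_chi t) (is_derive_vH It))).
by rewrite /dchi_vH addrC.
Qed.

Lemma cont_chi (t : R) : cont t chi.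
Proof. exact: is_derive1_continuous (is_derive_chi t). Qed.

Lemma cont_dchi (t : R) : cont t dchi.
Proof.
apply: contM; last first.
  apply: contM; last exact: cont_cst.
  exact: is_derive1_continuous (is_derive_ckf k t).
apply: (@cont_comp _ _ (fun t => skf k t / e)); last exact: continuous_dstep.
apply: contM; last exact: cont_cst.
exact: is_derive1_continuous (is_derive_skf k t).
Qed.

Lemma cont_dchi_vH (t : R) : I t -> cont t dchi_vH.
Proof.
move=> It; apply: contD; apply: contM;
  [exact: cont_dchi|exact: cont_vH|exact: cont_chi|exact: cont_dvH].
Qed.

Lemma chi_dchi_eq0 (t : R) : skf k t <= e -> chi t = 0 /\ dchi t = 0.
Proof.
move=> se; have h : skf k t / e <= 1 by rewrite ler_pdivrMr// mul1r.
by rewrite /chi /dchi step_eq0// dstep_eq0l// mul0r.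
Qed.

Lemma chi_itv (t : R) : 0 <= chi t <= 1.
Proof. exact: step_ge0_le1. Qed.

(* The cut-off of the nonnegative form [v (Delta u - H u_rho) ^+ 2]. *)
Lemma pohozaev_pointwise (t r N D w : R) : I t -> 0 <= r ^+ 2 <= N ->
  v t * V t * w <= riccati_weight t * r ^+ 2 + tangential_weight t * (N - r ^+ 2) ->
  chi t * (v t * V t * w) <= chi t * (v t * D ^+ 2) + `|dchi t * vH t| * N -
    2 * (chi_vH t * r * D + (dchi_vH t - chi_vH t * (ckf k t / skf k t)) * r ^+ 2 -
         2^-1 * N * (dchi_vH t + (n%:R - 3) * chi_vH t * (ckf k t / skf k t))).
Proof.
move=> It /andP[r0 rN] hw; have /andP[c0 _] := chi_itv t.
apply: (le_trans (ler_wpM2l c0 hw)).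
have sq : 0 <= chi t * (v t * (D - H t * r) ^+ 2).
  by rewrite mulr_ge0// mulr_ge0 ?sqr_ge0// ltW// v0.
(* The terms with [dchi] add up to [dchi * vH * (N - 2 r^2)], and [|N - 2 r^2| <= N] because
   [0 <= r^2 <= N]. *)
have ab : 0 <= `|dchi t * vH t| * N + dchi t * vH t * (N - 2 * r ^+ 2).
  have := ler_norm (- (dchi t * vH t)); rewrite normrN.
  have := ler_norm (dchi t * vH t); move: `|_| => q h1 h2; nra.
have nE : n%:R = n.-1%:R + 1 :> R.
  by rewrite natr1 prednK// (ltn_trans _ n2).
rewrite -subr_ge0; apply: le_trans (addr_ge0 sq ab) _.
rewrite le_eqVlt; apply/orP; left; apply/eqP.
rewrite /riccati_weight /tangential_weight /chi_vH /dchi_vH /vH nE.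
have s0 : skf k t != 0 by apply/lt0r_neq0/skf_gt0; case: It.
by field.
Qed.

End RadialWeights.

(** * Truncated fields on the whole of R^n and their vanishing divergence integral *)

Section CutoffIntegral.
Context {R : realType} (n : nat) (k : R) (a : 'rV[R]_n) (Omega : set 'rV[R]_n).
Hypothesis k0 : 0 <= k.
Hypotheses (oO : open Omega) (OM : Omega `<=` space_form k) (Oa : Omega a).
Variables (u : 'rV[R]_n -> R).
Hypothesis ut : test_function Omega u.
Implicit Types x y : 'rV[R]_n.
Local Notation rho := (riem_dist k a).
Local Notation I := (dist_range Omega rho).
Local Notation K := (closure [set x | u x != 0]).
Local Notation "''e_' i" := (delta_mx ord0 i : 'rV[R]_n) (at level 8, i at level 2).
Let aM : space_form k a := OM Oa.

Let K_compact : compact K. Proof. by case: ut. Qed.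

Let du_derivable (i : 'I_n) x (w : 'rV[R]_n) : derivable (partial i u) x w.
Proof. exact: (@derivable_iter_partial _ _ _ _ ut [:: i]). Qed.

Let du_cont (i : 'I_n) x : cont x (partial i u).
Proof. exact: (@continuous_iter_partial _ _ _ _ ut [:: i]). Qed.

Let hess_cont (i j : 'I_n) x : cont x (partial i (partial j u)).
Proof. exact: (@continuous_iter_partial _ _ _ _ ut [:: i; j]). Qed.

Let du_off_support (i : 'I_n) x : ~ K x -> partial i u x = 0.
Proof. exact: (@iter_partial_off_support _ _ _ [:: i]). Qed.

Lemma egrad_off_support x : ~ K x -> egrad u x = 0.
Proof.
by move=> Kx; apply/rowP => i; rewrite !mxE du_off_support.
Qed.

Lemma riem_grad_off_support x : ~ K x -> riem_grad k u x = 0.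
Proof.
by move=> Kx; apply/rowP => i; rewrite !mxE du_off_support// mulr0.
Qed.

Lemma riem_metric0l x (X : 'rV[R]_n) : riem_metric k x 0 X = 0.
Proof. by rewrite /riem_metric big1 ?mulr0// => i _; rewrite mxE mul0r. Qed.

Lemma grad_rad_off_support x : ~ K x -> grad_rad k rho u x = 0.
Proof. by move=> Kx; rewrite /grad_rad riem_grad_off_support// riem_metric0l. Qed.

Lemma norm_grad_off_support x : ~ K x -> riem_norm k x (riem_grad k u x) ^+ 2 = 0.
Proof.
move=> Kx; rewrite riem_grad_off_support// /riem_norm riem_metric0l sqrtr0.
by rewrite expr0n.
Qed.

Lemma laplace_off_support x : ~ K x -> laplace_beltrami k u x = 0.
Proof.
move=> Kx; rewrite /laplace_beltrami big1 ?mulr0// => i _.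
apply: (@derive_eq0_off_closed _ _ _ K) => // [|y Ky]; first exact: closed_closure.
by rewrite du_off_support// mulr0.
Qed.

Lemma pohozaev_off_support (F dF : R -> R) (i : 'I_n) x : ~ K x ->
  pohozaev_field k a u F i x = 0 /\ pohozaev_partial k a u F dF i x = 0.
Proof.
move=> Kx.
have d0 j : partial j u x = 0 by exact: du_off_support.
have h0 j l : partial j (partial l u) x = 0.
  exact: (@iter_partial_off_support _ _ _ [:: j; l]).
have gg : dot (egrad u x) (egrad u x) = 0.
  by rewrite egrad_off_support// /dot big1// => j _; rewrite mxE mul0r.
rewrite /pohozaev_field /pohozaev_partial gg d0 h0.
rewrite [\sum_j partial j u x * _]big1 => [|j _]; last by rewrite d0 mul0r.
by rewrite !(mul0r, mulr0, subr0, addr0).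
Qed.

Lemma near_skf_riem_dist_le (e : R) : 0 < e -> \forall y \near a, skf k (rho y) <= e.
Proof.
move=> e0; have := cont_skf k0 aM aM => /(_ _ (_ : nbhs _ [set s | s <= e])).
apply; rewrite riem_dist_refl// skf0.
by apply: filterS (lt_nbhsl e0) => s /ltW.
Qed.

(** Every point is the pole, a point of [Omega] away from it, or a point off the support; at the
    first and the last kind the function is locally zero. *)
Lemma cont_glue (f : 'rV[R]_n -> R) :
  (forall x, Omega x -> x != a -> cont x f) ->
  (forall x, ~ K x -> f x = 0) -> (\forall y \near a, f y = 0) -> continuous f.
Proof.
move=> fO fK fa x; have [->|xa] := eqVneq x a.
  apply: (@cont_near _ _ (fun=> 0)); last exact: cont_cst.
  by apply: filterS fa => y ->.
have [Ox|Kx] := test_function_cases ut x; first exact: fO.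
apply: (@cont_near _ _ (fun=> 0)); last exact: cont_cst.
by apply: filterS (near_not_support Kx) => y /fK ->.
Qed.

Variables (F dF : R -> R) (e : R).
Hypotheses (e0 : 0 < e) (F0 : forall t, skf k t <= e -> F t = 0 /\ dF t = 0).
Hypothesis Fd : forall t, I t -> is_derive t 1 F (dF t).
Hypothesis dFc : forall t, I t -> cont t dF.

Let I_rho x : Omega x -> x != a -> I (rho x).
Proof. exact: dist_range_riem_dist. Qed.

Let near_pohozaev (i : 'I_n) : \forall y \near a,
  pohozaev_field k a u F i y = 0 /\ pohozaev_partial k a u F dF i y = 0.
Proof.
apply: filterS (near_skf_riem_dist_le e0) => y /F0[F1 dF1].
by rewrite /pohozaev_field /pohozaev_partial F1 dF1 !(mul0r, mulr0, subr0, addr0).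
Qed.

Lemma is_derive_pohozaev_cutoff (i : 'I_n) x :
  is_derive x 'e_i (pohozaev_field k a u F i) (pohozaev_partial k a u F dF i x).
Proof.
have z (x1 : 'rV[R]_n) : (\forall y \near x1, pohozaev_field k a u F i y = 0 /\
    pohozaev_partial k a u F dF i y = 0) ->
  is_derive x1 'e_i (pohozaev_field k a u F i) (pohozaev_partial k a u F dF i x1).
  move=> h; have [_ ->] := nbhs_singleton h.
  apply: (near_eq_is_derive _ (is_derive_cst (0 : R) x1 'e_i)).
  by apply: filterS h => y [-> _].
have [->|xa] := eqVneq x a; first exact: z.
have [Ox|Kx] := test_function_cases ut x.
  by apply: is_derive_pohozaev_field => //; [exact: OM|exact/Fd/I_rho].
by apply: z; apply: filterS (near_not_support Kx) => y; exact: pohozaev_off_support.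
Qed.

Lemma partial_pohozaev_cutoff (i : 'I_n) :
  partial i (pohozaev_field k a u F i) = pohozaev_partial k a u F dF i.
Proof. by apply/funext => x; have [_ <-] := is_derive_pohozaev_cutoff i x. Qed.

Lemma continuous_pohozaev_cutoff (i : 'I_n) :
  continuous (pohozaev_partial k a u F dF i).
Proof.
apply: cont_glue => [x Ox xa|x Kx|].
- have Ix := I_rho Ox xa.
  apply: (@cont_pohozaev_partial _ _ _ _ k0 aM) => //; first exact: OM.
    exact: is_derive1_continuous (Fd Ix).
  exact: dFc.
- exact: (pohozaev_off_support F dF i Kx).2.
- by apply: filterS (near_pohozaev i) => y [].
Qed.

Lemma integrable_pohozaev_cutoff (i : 'I_n) :
  (lebesgue_tuple n).-integrable setT
    (fun t => (pohozaev_partial k a u F dF i (row_of t))%:E).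
Proof.
apply: (@integrable_compact_support _ _ K _ K_compact) => [|x Kx].
  exact: continuous_pohozaev_cutoff.
exact: (pohozaev_off_support F dF i Kx).2.
Qed.

Lemma integral_pohozaev_cutoff (i : 'I_n) :
  (\int[lebesgue_tuple n]_t (pohozaev_partial k a u F dF i (row_of t))%:E = 0)%E.
Proof.
rewrite -partial_pohozaev_cutoff.
apply: (integral_partial K_compact) => [x Kx|x|].
- exact: (pohozaev_off_support F dF i Kx).1.
- by case: (is_derive_pohozaev_cutoff i x).
- by rewrite partial_pohozaev_cutoff; exact: continuous_pohozaev_cutoff.
Qed.

End CutoffIntegral.

Section DistanceBounds.
Context {R : realType} (n : nat) (k : R) (a : 'rV[R]_n).
Hypotheses (k0 : 0 <= k) (aM : space_form k a).
Local Notation rho := (riem_dist k a).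

Lemma ckf_le (t : R) : 0 <= skf k t -> ckf k t <= 1 + k * skf k t.
Proof.
move=> s0; have ks : 0 <= k * skf k t by exact: mulr_ge0.
rewrite -(@ler_pXn2r _ 2)//; last 2 first.
- by rewrite nnegrE; exact/ltW/ckf_gt0.
- by rewrite nnegrE addr_ge0.
by rewrite ckf_sqr; nra.
Qed.

(** Places the shell that carries the derivative of the cut-off inside a coordinate cube. The square
    of [skf] is at least [chord2]; for [k > 0] the bound [k conf >= 2] gives
    [4 |x - a|^2 <= k^2 chord2], for [k = 0] the chord is Euclidean, and [1 + k] covers both
    cases. *)
Lemma coord_le_skf x (i : 'I_n) : space_form k x -> x != a ->
  `|(x - a) ord0 i| <= (1 + k) * skf k (rho x).
Proof.
move=> xM xa.
have S0 : 0 < skf k (rho x) by exact/skf_gt0/riem_dist_gt0.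
have k1 : 0 < 1 + k by exact: ltr_pwDl.
rewrite -(@ler_pXn2r _ 2)//; last by rewrite nnegrE mulr_ge0// ltW.
rewrite real_normK ?num_real//.
rewrite exprMn skf_riem_dist_sqr//.
have p0 := conf_gt0 k0 xM; have q0 := conf_gt0 k0 aM.
have d0 := dot_ge0 (x - a).
have xd : (x - a) ord0 i ^+ 2 <= dot (x - a) (x - a).
  rewrite /dot (bigD1 i)//= -expr2 lerDl; apply: sumr_ge0 => j _.
  by rewrite -expr2 sqr_ge0.
apply: (le_trans xd); rewrite /chord2.
have [kz|kz] := eqVneq k 0.
  by rewrite kz /conf eqxx; rewrite addr0 !expr1n !mul1r expr0n/= !mul0r addr0.
have kp : 0 < k by rewrite lt0r kz.
have conf_ge (y : 'rV[R]_n) : space_form k y -> 2 <= k * conf k y.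
  rewrite /conf (negPf kz) enorm_sqr => /space_formP[/eqP|yy1]; first by rewrite (negPf kz).
  have y1 : 0 < 1 - dot y y by rewrite subr_gt0.
  rewrite (_ : k * _ = 2 / (1 - dot y y)); last by field; rewrite kz lt0r_neq0.
  by rewrite ler_pdivlMr//; have := dot_ge0 y; lra.
have px := conf_ge x xM; have pa := conf_ge a aM.
move: p0 q0 d0 px pa; move: (conf k x) (conf k a) (dot _ _) => p q d p0 q0 d0 px pa.
have kpq : 4 * d <= k ^+ 2 * (p * q * d).
  rewrite (_ : k ^+ 2 * _ = (k * p) * (k * q) * d); last by ring.
  rewrite ler_wpM2r//; nra.
have pqd : 0 <= p * q * d by rewrite !mulr_ge0// ltW.
have sq : 0 <= k ^+ 2 * (p * q * d) ^+ 2 / 4 by rewrite divr_ge0// mulr_ge0// sqr_ge0.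
apply: (@le_trans _ _ ((1 + k) ^+ 2 * (p * q * d))).
  have : k ^+ 2 * (p * q * d) <= (1 + k) ^+ 2 * (p * q * d).
    by rewrite ler_wpM2r// lerXn2r ?nnegrE ?addr_ge0// lerDr.
  lra.
by rewrite ler_wpM2l ?sqr_ge0// lerDl.
Qed.

End DistanceBounds.

(** * Removing the cut-off *)

Lemma limn_einf_le {R : realType} (w : (\bar R)^nat) (c : \bar R) :
  (forall j, (w j <= c)%E) -> (limn_einf w <= c)%E.
Proof.
move=> wc; rewrite limn_einf_lim; apply: lime_le; first exact: is_cvg_einfs.
by near=> j; apply: (le_trans _ (wc j)); apply: ereal_inf_lbound; exists j => /=.
Unshelve. all: by end_near. Qed.

Section PuncturedIntegral.
Context {R : realType} (n : nat).
Local Notation mu := (@lebesgue_tuple R n).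

Lemma open_punctured (A : set 'rV[R]_n) (a : 'rV[R]_n) : open A ->
  open [set x | A x /\ x != a].
Proof.
move=> oA; have -> : [set x | A x /\ x != a] = A `&` [set x | x != a] by [].
apply: openI => //; rewrite openE => x xa; exact: near_neq.
Qed.

Lemma tuple_cube0 (a : 'rV[R]_n) : tuple_cube a 0 = [set t | row_of t = a].
Proof.
apply/seteqP; split => [t at0|t <- i] /=; last first.
  by rewrite /= in_itv/= !mxE subr0 addr0 lexx.
apply/rowP => i; rewrite mxE; apply/eqP.
by have := at0 i; rewrite /= in_itv/= subr0 addr0 eq_le andbC.
Qed.

Lemma integral_restrict (A : set (n.-tuple (measurableTypeR R)))
    (f : n.-tuple (measurableTypeR R) -> \bar R) : (forall t, ~ A t -> f t = 0%E) ->
  (\int[mu]_(t in A) f t = \int[mu]_t f t)%E.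
Proof.
move=> f0; rewrite [LHS]integral_mkcond; apply: eq_integral => t _.
by rewrite patchE; case: ifPn => // /negP At; rewrite f0// => h; apply: At; rewrite inE.
Qed.

(** At the pole [rho] is 0, outside the interval on which [v] and [V] are controlled. The pole is a
    cube of side 0, which is null since [0 < n]. *)
Lemma integral_punctured (A : set 'rV[R]_n) (a : 'rV[R]_n) (g : 'rV[R]_n -> R) :
  (0 < n)%N -> open A -> A a -> (forall x, A x -> x != a -> cont x g) ->
  (\int[mu]_(t in [set t | A (row_of t)]) (g (row_of t))%:E =
   \int[mu]_(t in [set t | A (row_of t) /\ row_of t != a]) (g (row_of t))%:E)%E.
Proof.
move=> n0 oA Aa cg; have oA' := @open_punctured _ a oA.
have mN := @measurable_tuple_cube _ _ a 0.
have mA' : measurable [set t | A (row_of t) /\ row_of t != a].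
  exact: measurable_row_of_open oA'.
have N0 : mu (tuple_cube a 0) = 0%E.
  by rewrite [LHS]lebesgue_tuple_cube// mulr0 expr0n eqn0Ngt n0.
have mfN : measurable_fun (tuple_cube a 0) (fun t => (g (row_of t))%:E).
  apply: (eq_measurable_fun (cst (g a)%:E)) => // t.
  by rewrite tuple_cube0 inE /= => ->.
have mfA : measurable_fun [set t | A (row_of t) /\ row_of t != a]
    (fun t => (g (row_of t))%:E).
  apply/measurable_EFinP; apply: (measurable_row_of_fun oA') => x [Ax xa].
  exact: cg.
have -> : [set t | A (row_of t)] =
    [set t | A (row_of t) /\ row_of t != a] `|` tuple_cube a 0.
  rewrite tuple_cube0; apply/seteqP; split => [t At|t [[]//|/= ->//]].
  by have [ta|ta] := eqVneq (row_of t) a; [right|left].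
rewrite integral_setU//.
- by rewrite [X in (_ + X)%E](null_set_integral mN mfN N0) adde0.
- by apply/measurable_funU.
- apply/disj_setPS => t [[_ ta]]; rewrite tuple_cube0 /= => ta'.
  by rewrite ta' eqxx in ta.
Qed.

End PuncturedIntegral.

Section CutoffInequality.
Context {R : realType} (n : nat) (k : R) (a : 'rV[R]_n) (Omega : set 'rV[R]_n).
Hypotheses (k0 : 0 <= k) (n2 : (2 <= n)%N).
Hypotheses (oO : open Omega) (OM : Omega `<=` space_form k) (Oa : Omega a).
Local Notation rho := (riem_dist k a).
Local Notation I := (dist_range Omega rho).
Variables (v V H : R -> R).
Hypotheses (vs : smooth1_on I v) (Vs : smooth1_on I V) (Hs : smooth1_on I H).
Hypothesis v0 : forall t, I t -> 0 < v t.
Hypothesis V0 : forall t, I t -> 0 <= V t.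
Hypothesis riccati : forall t, I t ->
  V t <= - derive1 H t + (Lct n k t - derive1 v t / v t) * H t - H t ^+ 2.
Hypothesis tangential0 : forall t, I t -> 0 <= tangential_weight n k v H t.
Variables (u w : 'rV[R]_n -> R).
Hypothesis ut : test_function Omega u.
Implicit Types x y : 'rV[R]_n.
Local Notation K := (closure [set x | u x != 0]).
Local Notation sqgrad x := (riem_norm k x (riem_grad k u x) ^+ 2).
Hypothesis w_cont : forall x, Omega x -> x != a -> cont x w.
Hypothesis w_off_support : forall x, ~ K x -> w x = 0.
Hypothesis w_ge0 : forall x, 0 <= w x.
Hypothesis w_le : forall x, Omega x -> x != a ->
  v (rho x) * V (rho x) * w x <=
  riccati_weight n k v H (rho x) * grad_rad k rho u x ^+ 2 +
  tangential_weight n k v H (rho x) * (sqgrad x - grad_rad k rho u x ^+ 2).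

Let aM : space_form k a := OM Oa.

Let K_compact : compact K. Proof. by case: ut. Qed.

Let du_derivable (i : 'I_n) x (z : 'rV[R]_n) : derivable (partial i u) x z.
Proof. exact: (@derivable_iter_partial _ _ _ _ ut [:: i]). Qed.

Let du_cont (i : 'I_n) x : cont x (partial i u).
Proof. exact: (@continuous_iter_partial _ _ _ _ ut [:: i]). Qed.

Let hess_cont (i j : 'I_n) x : cont x (partial i (partial j u)).
Proof. exact: (@continuous_iter_partial _ _ _ _ ut [:: i; j]). Qed.

Let I_rho x : Omega x -> x != a -> I (rho x).
Proof. exact: dist_range_riem_dist. Qed.

Let rho_cont x : Omega x -> cont x rho.
Proof. by move=> Ox; apply: continuous_riem_dist => //; exact: OM. Qed.

Let conf_cont x : Omega x -> cont x (fun y => conf k y ^+ n).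
Proof. by move=> Ox; apply/contX/continuous_conf/OM. Qed.

(** [w] stands for the squared radial derivative in (i) and for the squared norm of the gradient in
    (ii). *)
Definition lower_density x : R := v (rho x) * V (rho x) * w x * conf k x ^+ n.

Definition upper_density x : R :=
  v (rho x) * laplace_beltrami k u x ^+ 2 * conf k x ^+ n.

Definition error_density (e : R) x : R :=
  `|dchi k e (rho x) * vH v H (rho x)| * sqgrad x * conf k x ^+ n.

Let conf_ge0 x : Omega x -> 0 <= conf k x ^+ n.
Proof. by move=> /OM xM; rewrite exprn_ge0// ltW// conf_gt0. Qed.

Lemma lower_density_ge0 x : Omega x -> x != a -> 0 <= lower_density x.
Proof.
move=> Ox xa; have Ix := I_rho Ox xa.
apply: mulr_ge0; last exact: conf_ge0.
by apply: mulr_ge0 => //; apply: mulr_ge0; [exact/ltW/v0|exact: V0].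
Qed.

Lemma upper_density_ge0 x : Omega x -> x != a -> 0 <= upper_density x.
Proof.
move=> Ox xa; have Ix := I_rho Ox xa.
apply: mulr_ge0; last exact: conf_ge0.
by apply: mulr_ge0; [exact/ltW/v0|exact: sqr_ge0].
Qed.

Lemma cont_lower_density x : Omega x -> x != a -> cont x lower_density.
Proof.
move=> Ox xa; have Ix := I_rho Ox xa; have cr := rho_cont Ox.
apply: contM; last exact: conf_cont.
apply: contM; last exact: w_cont.
by apply: contM; apply: (@cont_comp _ _ rho) => //;
  [exact: smooth1_on_cont vs Ix|exact: smooth1_on_cont Vs Ix].
Qed.

Lemma cont_upper_density x : Omega x -> x != a -> cont x upper_density.
Proof.
move=> Ox xa; have Ix := I_rho Ox xa; have cr := rho_cont Ox.
apply: contM; last exact: conf_cont.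
apply: contM; last by apply/contX/cont_laplace => //; exact: OM.
by apply: (@cont_comp _ _ rho) => //; exact: smooth1_on_cont vs Ix.
Qed.

Lemma cont_error_density (e : R) x : Omega x -> x != a -> cont x (error_density e).
Proof.
move=> Ox xa; have Ix := I_rho Ox xa; have cr := rho_cont Ox.
apply: contM; last exact: conf_cont.
apply: contM; last by apply: cont_norm_grad => //; exact: OM.
apply: cont_norm; apply: contM; apply: (@cont_comp _ _ rho) => //.
  exact: cont_dchi.
exact: (@cont_vH _ _ _ _ _ _ _ vs Hs _ Ix).
Qed.

Lemma lower_density_off_support x : ~ K x -> lower_density x = 0.
Proof. by move=> Kx; rewrite /lower_density w_off_support// mulr0 mul0r. Qed.

Lemma upper_density_off_support x : ~ K x -> upper_density x = 0.
Proof.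
by move=> Kx; rewrite /upper_density laplace_off_support// expr0n mulr0 mul0r.
Qed.

Lemma error_density_off_support (e : R) x : ~ K x -> error_density e x = 0.
Proof.
by move=> Kx; rewrite /error_density norm_grad_off_support// mulr0 mul0r.
Qed.

Let cutoff (e : R) x : R := chi k e (rho x).

Let cont_cutoff (e : R) x : Omega x -> cont x (cutoff e).
Proof.
move=> Ox; apply: (@cont_comp _ _ rho); first exact: rho_cont.
exact: cont_chi.
Qed.

Lemma continuous_cut_lower (e : R) : 0 < e ->
  continuous (fun x => cutoff e x * lower_density x).
Proof.
move=> e0; apply: (@cont_glue _ _ a _ _ ut) => [x Ox xa|x Kx|].
- by apply: contM; [exact: cont_cutoff|exact: cont_lower_density].
- by rewrite lower_density_off_support// mulr0.
- apply: filterS (near_skf_riem_dist_le k0 OM Oa e0) => y /(chi_dchi_eq0 e0)[c0 _].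
  by rewrite /cutoff c0 mul0r.
Qed.

Lemma continuous_cut_upper (e : R) : 0 < e ->
  continuous (fun x => cutoff e x * upper_density x).
Proof.
move=> e0; apply: (@cont_glue _ _ a _ _ ut) => [x Ox xa|x Kx|].
- by apply: contM; [exact: cont_cutoff|exact: cont_upper_density].
- by rewrite upper_density_off_support// mulr0.
- apply: filterS (near_skf_riem_dist_le k0 OM Oa e0) => y /(chi_dchi_eq0 e0)[c0 _].
  by rewrite /cutoff c0 mul0r.
Qed.

Lemma continuous_error_density (e : R) : 0 < e -> continuous (error_density e).
Proof.
move=> e0; apply: (@cont_glue _ _ a _ _ ut) => [x Ox xa|x Kx|].
- exact: cont_error_density.
- exact: error_density_off_support.
- apply: filterS (near_skf_riem_dist_le k0 OM Oa e0) => y /(chi_dchi_eq0 e0)[_ c0].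
  by rewrite /error_density c0 mul0r normr0 !mul0r.
Qed.

(** [pohozaev_pointwise] multiplied by the volume density, with the bracket recognised as a
    divergence. At the pole and off the support every term is 0, so the inequality can be integrated
    over the whole of R^n. *)
Lemma cut_density_le (e : R) x : 0 < e ->
  cutoff e x * lower_density x <= cutoff e x * upper_density x + error_density e x -
  2 * \sum_i pohozaev_partial k a u (chi_vH k v H e) (dchi_vH k v H e) i x.
Proof.
move=> e0; have [Ox|Kx] := test_function_cases ut x; last first.
  rewrite lower_density_off_support// upper_density_off_support//.
  rewrite error_density_off_support// big1 => [|i _]; last first.
    by have [] := pohozaev_off_support k a (chi_vH k v H e) (dchi_vH k v H e) i Kx.
  by rewrite !mulr0 addr0 subr0.
have [xa|xa] := eqVneq x a.
  have /(chi_dchi_eq0 e0)[c0 dc0] := nbhs_singleton (near_skf_riem_dist_le k0 OM Oa e0).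
  rewrite xa /cutoff /error_density c0 dc0 big1 => [|i _].
    by rewrite !(mul0r, mulr0, normr0, addr0, subr0).
  by rewrite /pohozaev_partial /chi_vH /dchi_vH c0 dc0 !(mul0r, mulr0, subr0, addr0).
have xM := OM Ox; have Ix := I_rho Ox xa.
rewrite (@sum_pohozaev_partial _ _ _ _ k0 aM n2 _ _ _ du_derivable
  (iter_partialC ut) _ xM xa).
have rN : 0 <= grad_rad k rho u x ^+ 2 <= sqgrad x.
  by rewrite sqr_ge0/=; exact: grad_rad_le.
have := pohozaev_pointwise n2 v0 e (laplace_beltrami k u x) Ix rN (w_le Ox xa).
move/(ler_wpM2r (conf_ge0 Ox)); rewrite /cutoff /lower_density /upper_density.
rewrite /error_density.
move: (conf k x ^+ n) (grad_rad _ _ _ _) (laplace_beltrami _ _ _) (riem_norm _ _ _ ^+ 2)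
  (chi _ _ _) (chi_vH _ _ _ _ _) (dchi_vH _ _ _ _ _) (`|_|) => p r D N c F dF q.
by congr (_ <= _); ring.
Qed.

Let continuous_sqgrad_density : continuous (fun x => sqgrad x * conf k x ^+ n).
Proof.
move=> x; change (cont x (fun x => sqgrad x * conf k x ^+ n)).
have [Ox|Kx] := test_function_cases ut x.
  apply: contM; last exact: conf_cont.
  by apply: cont_norm_grad => //; exact: OM.
apply: (@cont_near _ _ (fun=> 0)); last exact: cont_cst.
by apply: filterS (near_not_support Kx) => y Ky; rewrite norm_grad_off_support// mul0r.
Qed.

(** Pointwise size [e^(2-n)] on a cube of side of order [e]: the two facts from which the error
    integral is seen to be of order [e^2]. *)
Lemma error_density_bound : exists M d : R, [/\ 0 < d, 0 <= M & forall (e : R) x, 0 < e <= d ->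
  error_density e x <= M * e ^+ 2 / e ^+ n /\
  (error_density e x != 0 -> forall i : 'I_n, `|(x - a) ord0 i| <= 2 * (1 + k) * e)].
Proof.
(* A second point of [Omega] supplies the reference radius [t0] for the growth bound; without one
   the error density is identically 0. *)
have [[z [Oz za]]|nz] := pselect (exists x, Omega x /\ x != a); last first.
  exists 0, 1; split=> // e x /andP[e0 _].
  suff -> : error_density e x = 0 by rewrite !mul0r eqxx.
  have [xa|xa] := eqVneq x a.
    have /(chi_dchi_eq0 e0)[_ dc0] := nbhs_singleton (near_skf_riem_dist_le k0 OM Oa e0).
    by rewrite xa /error_density dc0 !mul0r normr0 !mul0r.
  have [Ox|Kx] := test_function_cases ut x; last exact: error_density_off_support.
  by case: nz; exists x.
have It0 := I_rho Oz za; set t0 := rho z in It0.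
have [C [C0 vHC]] : exists C : R, 0 <= C /\ forall t : R, 0 < t <= t0 ->
    skf k t <= 1 -> `|vH v H t| * skf k t ^+ n <= C * skf k t ^+ 3.
  exact: (vH_growth n2 vs Hs v0 V0 riccati It0 tangential0).
have [M0 gM] : exists M : R, forall x, `|sqgrad x * conf k x ^+ n| <= M.
  apply: (compact_support_bounded K_compact continuous_sqgrad_density) => x Kx.
  by rewrite norm_grad_off_support// mul0r.
have M00 : 0 <= M0 by apply: le_trans (gM a).
have S0 : 0 < skf k t0 by apply: skf_gt0; case: It0.
(* [32 = 4 * 8]: 4 bounds [dstep], and 8 is the cube of 2 in [s < 2 e]; [1 + k] bounds [ckf] where
   [s <= 1]. The condition [e <= 1 / 2] ensures [s <= 1] on the shell, and [e <= s(t0) / 4] ensures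
   that the shell lies within distance [t0]. *)
exists (32 * (1 + k) * C * M0), (Num.min 2^-1 (skf k t0 / 4)); split.
- by rewrite lt_min invr_gt0 ltr0n divr_gt0.
- by rewrite !mulr_ge0// addr_ge0.
move=> e x /andP[e0]; rewrite le_min => /andP[e1 e2].
have en : 0 < e ^+ n by exact: exprn_gt0.
have r0 : 0 <= 32 * (1 + k) * C * M0 * e ^+ 2 / e ^+ n.
  apply: divr_ge0; last exact: ltW.
  by apply: mulr_ge0; [rewrite !mulr_ge0// addr_ge0|exact: sqr_ge0].
have [E0|en0] := eqVneq (error_density e x) 0; first by rewrite E0.
have [Ox|Kx] := test_function_cases ut x; last first.
  by rewrite error_density_off_support ?eqxx// in en0.
have [xa|xa] := eqVneq x a.
  have /(chi_dchi_eq0 e0)[_ dc0] := nbhs_singleton (near_skf_riem_dist_le k0 OM Oa e0).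
  by rewrite xa /error_density dc0 !mul0r normr0 !mul0r eqxx in en0.
have t00 := riem_dist_gt0 k0 aM (OM Ox) xa.
have sp : 0 < skf k (rho x) by exact: skf_gt0.
have s1 : e < skf k (rho x).
  rewrite ltNge; apply/negP => /(chi_dchi_eq0 e0)[_ dc0].
  by rewrite /error_density dc0 !mul0r normr0 !mul0r eqxx in en0.
have s2 : skf k (rho x) < 2 * e.
  rewrite ltNge; apply/negP => s2e.
  rewrite /error_density /dchi dstep_eq0r ?ler_pdivlMr// in en0.
  by rewrite !mul0r normr0 !mul0r eqxx in en0.
split=> [|_ i]; last first.
  apply: (le_trans (coord_le_skf k0 aM i (OM Ox) xa)).
  by have k1 : 0 < 1 + k by [exact: ltr_pwDl]; move: s2; nra.
have tt : rho x <= t0.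
  rewrite leNgt; apply/negP => /(skf_lt k); lra.
have s11 : skf k (rho x) <= 1 by lra.
have vb : `|vH v H (rho x)| <= 8 * C * e ^+ 3 / e ^+ n.
  rewrite ler_pdivlMr//.
  apply: (@le_trans _ _ (`|vH v H (rho x)| * skf k (rho x) ^+ n)).
    by rewrite ler_wpM2l// lerXn2r ?nnegrE ?ltW.
  apply: (le_trans (vHC _ _ s11)); first by rewrite t00 tt.
  rewrite [8 * C]mulrC -mulrA ler_wpM2l//.
  rewrite (_ : 8 * e ^+ 3 = (2 * e) ^+ 3); last by ring.
  by rewrite lerXn2r ?nnegrE ?mulr_ge0// ltW.
have db : `|dchi k e (rho x)| <= 4 * (1 + k) / e.
  rewrite /dchi normrM [4 * _]mulrC -mulrA [in leRHS]mulrCA.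
  apply: ler_pM => //; first exact: dstep_bound.
  rewrite ger0_norm; last by rewrite divr_ge0// ltW// ckf_gt0.
  rewrite ler_pM2r ?invr_gt0//; apply: (le_trans (ckf_le k0 (ltW sp))).
  by rewrite lerD2l ler_piMr.
rewrite /error_density -mulrA normrM.
apply: (@le_trans _ _ (4 * (1 + k) / e * (8 * C * e ^+ 3 / e ^+ n) * M0)).
  apply: ler_pM => //.
  - by rewrite mulr_ge0 ?sqr_ge0// conf_ge0.
  - exact: ler_pM.
  - exact: le_trans (ler_norm _) (gM x).
rewrite le_eqVlt; apply/orP; left; apply/eqP.
by field; rewrite expf_neq0// lt0r_neq0.
Qed.
Local Notation mu := (lebesgue_tuple n : {measure set _ -> \bar R}).

Lemma integral_error_le : exists M d : R, [/\ 0 < d, 0 <= M & forall e : R, 0 < e <= d ->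
  (\int[mu]_t (error_density e (row_of t))%:E <= (M * e ^+ 2)%:E)%E].
Proof.
have [M [d [d0 M0 bound]]] := error_density_bound.
(* The cube has half-side [2 (1 + k) e]; its volume cancels the [e ^+ n] in the denominator of the
   pointwise bound. *)
exists (M * (2 * (2 * (1 + k))) ^+ n), d; split => //.
  by rewrite mulr_ge0// exprn_ge0// !mulr_ge0// addr_ge0.
move=> e ed; have /andP[e0 _] := ed; set r := 2 * (1 + k) * e.
have r0 : 0 <= r by rewrite !mulr_ge0// ?addr_ge0// ltW.
have ce := continuous_error_density e0.
have me (D : set _) : measurable_fun D (fun t => (error_density e (row_of t))%:E).
  apply: measurable_funTS; apply/measurable_EFinP.
  exact: (measurable_row_of_fun openT (fun x _ => ce x)).
have mc := @measurable_tuple_cube _ _ a r.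
rewrite [leLHS](_ : _ = \int[mu]_(t in tuple_cube a r) (error_density e (row_of t))%:E)%E.
  apply: (@le_trans _ _ (\int[mu]_(t in tuple_cube a r) cst (M * e ^+ 2 / e ^+ n)%:E t)%E).
    apply: ge0_le_integral => //.
    - move=> t _; rewrite lee_fin /error_density.
      have [Ox|Kx] := test_function_cases ut (row_of t).
        by rewrite mulr_ge0 ?conf_ge0// mulr_ge0// sqr_ge0.
      by rewrite norm_grad_off_support// mulr0 mul0r.
    - by move=> t _; rewrite lee_fin; exact: (bound e _ ed).1.
  rewrite integral_cst// [X in (_ * X)%E](lebesgue_tuple_cube a r0) -EFinM lee_fin.
  have en : e ^+ n != 0 by rewrite expf_neq0// lt0r_neq0.
  rewrite le_eqVlt; apply/orP; left; apply/eqP.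
  by rewrite /r mulrA exprMn; field.
apply/esym/integral_restrict => t nt.
have [->//|/eqP en0] := pselect (error_density e (row_of t) = 0).
case: nt => i /=.
have := (bound e _ ed).2 en0 i; rewrite !mxE ler_norml => /andP[h1 h2].
by rewrite in_itv/=; apply/andP; split; rewrite /r; lra.
Qed.

Lemma integral_cut_le (e : R) : 0 < e ->
  (\int[mu]_t (cutoff e (row_of t) * lower_density (row_of t))%:E <=
   \int[mu]_t (cutoff e (row_of t) * upper_density (row_of t))%:E +
   \int[mu]_t (error_density e (row_of t))%:E)%E.
Proof.
move=> e0.
have iL : mu.-integrable setT
    (fun t => (cutoff e (row_of t) * lower_density (row_of t))%:E).
  apply: (@integrable_compact_support _ _ K
    (fun x => cutoff e x * lower_density x) K_compact) => [|x Kx].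
    exact: continuous_cut_lower.
  by rewrite lower_density_off_support// mulr0.
have iU : mu.-integrable setT
    (fun t => (cutoff e (row_of t) * upper_density (row_of t))%:E).
  apply: (@integrable_compact_support _ _ K
    (fun x => cutoff e x * upper_density x) K_compact) => [|x Kx].
    exact: continuous_cut_upper.
  by rewrite upper_density_off_support// mulr0.
have iE : mu.-integrable setT (fun t => (error_density e (row_of t))%:E).
  apply: (@integrable_compact_support _ _ K _ K_compact) => [|x Kx].
    exact: continuous_error_density.
  exact: error_density_off_support.
pose P i x := pohozaev_partial k a u (chi_vH k v H e) (dchi_vH k v H e) i x.
have F0 t : skf k t <= e -> chi_vH k v H e t = 0 /\ dchi_vH k v H e t = 0.
  by move=> /(chi_dchi_eq0 e0)[c0 d0]; rewrite /chi_vH /dchi_vH c0 d0 !mul0r addr0.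
have Fd t : I t -> is_derive t 1 (chi_vH k v H e) (dchi_vH k v H e t).
  exact: is_derive_chi_vH.
have dFc t : I t -> cont t (dchi_vH k v H e).
  by move=> It; exact: (@cont_dchi_vH _ _ _ _ _ _ _ vs Hs _ _ It).
have iP i : mu.-integrable setT (fun t => (P i (row_of t))%:E).
  exact: (integrable_pohozaev_cutoff k0 oO OM Oa ut e0 F0 Fd dFc).
have iPs := integrable_sum measurableT (index_enum 'I_n) (fun i (_ : true) => iP i).
have P0 : (\int[mu]_t \sum_i (P i (row_of t))%:E = 0)%E.
  rewrite integral_sum// big1// => i _.
  exact: (integral_pohozaev_cutoff k0 oO OM Oa ut e0 F0 Fd dFc).
(* The zero added on the right is [-2] times the integral of the divergence, which turns the claim
   into a pointwise comparison. *)
rewrite -integralD// -[leRHS]adde0 -[X in (_ <= _ + X)%E](mule0 (- 2)%:E) -P0.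
rewrite -integralZl// -integralD//; last 2 first.
- exact: integrableD.
- exact: integrableZl.
apply: le_integral => //.
- by apply: integrableD => //; [exact: integrableD|exact: integrableZl].
- move=> t _; rewrite sumEFin -EFinM -!EFinD lee_fin mulNr.
  exact: cut_density_le.
Qed.
(** The upper integral may be infinite, so nothing is subtracted from it: the truncated upper
    density is bounded by the full one, the error is made smaller than any given [eps], and Fatou's
    lemma asks only for the sign of the truncated lower densities. *)
Theorem integral_lower_le_upper :
  (\int[mu]_(t in [set t | Omega (row_of t)]) (lower_density (row_of t))%:E <=
   \int[mu]_(t in [set t | Omega (row_of t)]) (upper_density (row_of t))%:E)%E.
Proof.
have n0 : (0 < n)%N by exact: ltnW.
rewrite (integral_punctured n0 oO Oa cont_lower_density).
rewrite (integral_punctured n0 oO Oa cont_upper_density).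
have oO' := open_punctured (a := a) oO.
pose D := [set t : n.-tuple (measurableTypeR R) | Omega (row_of t) /\ row_of t != a].
rewrite -/D; have mD : measurable D by exact: measurable_row_of_open oO'.
have mf (g : 'rV[R]_n -> R) : (forall x, Omega x -> x != a -> cont x g) ->
    measurable_fun D (fun t => (g (row_of t))%:E).
  move=> cg; apply/measurable_EFinP; apply: (measurable_row_of_fun oO') => x [Ox xa].
  exact: cg.
have cut0 e x : 0 < e -> ~ (Omega x /\ x != a) ->
    cutoff e x * lower_density x = 0 /\ cutoff e x * upper_density x = 0.
  move=> e0 nx; have [xa|xa] := eqVneq x a.
    have /(chi_dchi_eq0 e0)[c0 _] := nbhs_singleton (near_skf_riem_dist_le k0 OM Oa e0).
    by rewrite xa /cutoff c0 !mul0r.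
  have [Ox|Kx] := test_function_cases ut x; first by case: nx.
  by rewrite lower_density_off_support// upper_density_off_support// mulr0.
have [M [d [d0 M0 error_le]]] := integral_error_le.
have step_le (e : R) : 0 < e <= d ->
    (\int[mu]_(t in D) (cutoff e (row_of t) * lower_density (row_of t))%:E <=
     \int[mu]_(t in D) (upper_density (row_of t))%:E + (M * e ^+ 2)%:E)%E.
  move=> ed; have /andP[e0 _] := ed.
  rewrite integral_restrict; last by move=> t Dt; rewrite (cut0 _ _ e0 Dt).1.
  apply: (le_trans (integral_cut_le e0)); apply: leeD; last exact: error_le.
  rewrite -(@integral_restrict _ _ D); last by move=> t Dt; rewrite (cut0 _ _ e0 Dt).2.
  apply: ge0_le_integral => //.
  - move=> t [Ot ta]; rewrite lee_fin mulr_ge0 ?upper_density_ge0//.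
    by have /andP[] := chi_itv k e (rho (row_of t)).
  - apply: (mf (fun x => cutoff e x * upper_density x)) => x Ox xa.
    by apply: contM; [exact: cont_cutoff|exact: cont_upper_density].
  - exact: mf cont_upper_density.
  - move=> t [Ot ta]; rewrite lee_fin ler_piMl ?upper_density_ge0//.
    by have /andP[] := chi_itv k e (rho (row_of t)).
apply/lee_addgt0Pr => eps eps0.
(* For [e <= b] the error is at most [eps]: [b <= 1] gives [b^2 <= b], and [M + 1] instead of [M]
   keeps the quotient meaningful when [M = 0]. *)
pose b := Num.min d (Num.min 1 (eps / (M + 1))).
have M1 : 0 < M + 1 by rewrite ltr_wpDl.
have b0 : 0 < b by rewrite !lt_min d0 ltr01 divr_gt0.
have [bd b1 be] : [/\ b <= d, b <= 1 & b <= eps / (M + 1)].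
  by split; rewrite /b !ge_min lexx ?orbT.
pose e_ (j : nat) : R := b / j.+1%:R.
have e_gt0 j : 0 < e_ j by rewrite divr_gt0.
have e_le j : e_ j <= b by rewrite ler_pdivrMr// ler_peMr// ?ler1n// ltW.
have Mb j : M * e_ j ^+ 2 <= eps.
  rewrite ler_pdivlMr// in be; have := e_le j; have := e_gt0 j.
  move: (e_ j) => y y0 yb; have y2 : y ^+ 2 <= b by rewrite expr2; nra.
  by apply: (le_trans (ler_wpM2l M0 y2)); lra.
pose f j t := (cutoff (e_ j) (row_of t) * lower_density (row_of t))%:E.
have -> : (\int[mu]_(t in D) (lower_density (row_of t))%:E =
    \int[mu]_(t in D) limn_einf (f ^~ t))%E.
  apply: eq_integral => t; rewrite inE => -[Ot ta].
  have s0 : 0 < skf k (rho (row_of t)).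
    by apply: skf_gt0; apply: riem_dist_gt0 => //; exact: OM.
  (* Away from the pole [s(rho) > 0], so the cut-off equals 1 as soon as [2 e_ j <= s(rho)]: the
     sequence is eventually constant. *)
  have cf : f ^~ t @ \oo --> (lower_density (row_of t))%:E.
    apply: cvg_near_cst.
    have sb : 0 < skf k (rho (row_of t)) / (2 * b) by rewrite divr_gt0// mulr_gt0.
    apply: filterS (near_infty_natSinv_lt (PosNum sb)) => j /= hj.
    rewrite /f /cutoff /chi step_eq1 ?mul1r// ler_pdivlMr//.
    rewrite ltr_pdivlMr ?mulr_gt0// in hj.
    by apply: le_trans (ltW hj); rewrite /e_ mulrA mulrC.
  by rewrite (cvg_limn_einf_sup cf).1.
apply: (@le_trans _ _ (limn_einf (fun j => \int[mu]_(t in D) f j t)%E)).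
  apply: fatou => // [j|j t [Ot ta]].
    apply: (mf (fun x => cutoff (e_ j) x * lower_density x)) => x Ox xa.
    by apply: contM; [exact: cont_cutoff|exact: cont_lower_density].
  rewrite lee_fin mulr_ge0 ?lower_density_ge0//.
  by have /andP[] := chi_itv k (e_ j) (rho (row_of t)).
apply: limn_einf_le => j; apply: (le_trans (step_le (e_ j) _)).
  by rewrite e_gt0 (le_trans (e_le j)).
by rewrite leeD2l// lee_fin.
Qed.

End CutoffInequality.

Theorem theorem3p1 (R : realType) (kappa : R) (n : nat)
    (Omega : set 'rV[R]_n) (x0 : 'rV[R]_n) (v V H : R -> R) :
  let rho := riem_dist kappa x0 in
  let I := dist_range Omega rho in
  0 <= kappa -> (2 <= n)%N ->
  open Omega -> Omega `<=` space_form kappa -> Omega x0 ->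
  smooth1_on I v -> smooth1_on I V ->
  (forall t, I t -> 0 <= v t) -> (forall t, I t -> 0 <= V t) ->
  (forall t, I t -> v t != 0) ->
  admissible I (Lct n kappa) v V H ->
  ((forall t, I t -> 0 <= E1 n kappa v H t) ->
   forall u : 'rV[R]_n -> R, test_function Omega u ->
     (riem_integral kappa Omega
        (fun x => (v (rho x) * V (rho x) * `|grad_rad kappa rho u x| ^+ 2)%R) <=
      riem_integral kappa Omega
        (fun x => (v (rho x) * `|laplace_beltrami kappa u x| ^+ 2)%R))%E) /\
  ((forall t, I t -> 0 <= E2 kappa v H t) ->
   forall u : 'rV[R]_n -> R, test_function Omega u ->
     (riem_integral kappa Omega
        (fun x => (v (rho x) * V (rho x) *
                   riem_norm kappa x (riem_grad kappa u x) ^+ 2)%R) <=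
      riem_integral kappa Omega
        (fun x => (v (rho x) * `|laplace_beltrami kappa u x| ^+ 2)%R))%E).
Proof.
move=> rho I k0 n2 oO OM Oa vs Vs v_ge0 V0 v_neq0 [Hs riccati].
have v0 t : I t -> 0 < v t by move=> It; rewrite lt0r v_neq0// v_ge0.
have aM := OM _ Oa.
have I_rho x : Omega x -> x != x0 -> I (rho x) by exact: dist_range_riem_dist.
have upperE u : riem_integral kappa Omega
      (fun x => v (rho x) * `|laplace_beltrami kappa u x| ^+ 2) =
    (\int[lebesgue_tuple n]_(t in [set t | Omega (row_of t)])
      (upper_density kappa x0 v u (row_of t))%:E)%E.
  by apply: eq_integral => t _; rewrite real_normK ?num_real.
have lowerE (f w : 'rV[R]_n -> R) : (forall x, f x = v (rho x) * V (rho x) * w x) ->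
    riem_integral kappa Omega f =
    (\int[lebesgue_tuple n]_(t in [set t | Omega (row_of t)])
      (lower_density kappa x0 v V w (row_of t))%:E)%E.
  by move=> fE; apply: eq_integral => t _; rewrite fE.
have weight_ge t : I t -> v t * V t <= riccati_weight n kappa v H t.
  exact: riccati_weight_ge.
split => [E1_ge0 u ut|E2_ge0 u ut]; rewrite upperE.
- have tw t : I t -> 0 <= tangential_weight n kappa v H t.
    by move=> It; rewrite -(tangential_weightE n2 vs Hs It); exact: E1_ge0.
  rewrite (lowerE _ (fun x => grad_rad kappa rho u x ^+ 2)); last first.
    by move=> x; rewrite real_normK ?num_real.
  apply: (integral_lower_le_upper k0 n2 oO OM Oa vs Vs Hs v0 V0 riccati tw ut) => //.
  + move=> x Ox xa; apply: contX; apply: cont_grad_rad => //; last exact: OM.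
    by move=> i y; exact: (@continuous_iter_partial _ _ _ _ ut [:: i]).
  + by move=> x Kx; rewrite grad_rad_off_support// expr0n.
  + by move=> x; exact: sqr_ge0.
  + move=> x Ox xa; have It := I_rho x Ox xa.
    (* Of the tangential term only the sign is known, so it is discarded, and the radial derivative
       alone is controlled. *)
    rewrite -[leLHS]addr0; apply: lerD.
      by rewrite ler_wpM2r ?sqr_ge0// weight_ge.
    by rewrite mulr_ge0 ?tw// subr_ge0; apply: grad_rad_le => //; exact: OM.
- have weightsE t : I t -> tangential_weight n kappa v H t =
      E2 kappa v H t + riccati_weight n kappa v H t.
    by move=> It; rewrite (E2E n2 vs Hs It) subrK.
  (* Nonnegativity of [v V] makes the Riccati weight nonnegative, so [E2 >= 0] implies the condition
     of (i), on which the growth bound at the pole relies. *)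
  have rw t : I t -> 0 <= riccati_weight n kappa v H t.
    move=> It; apply: le_trans (weight_ge t It).
    by rewrite mulr_ge0 ?v_ge0// V0.
  have tw t : I t -> 0 <= tangential_weight n kappa v H t.
    by move=> It; rewrite weightsE// addr_ge0 ?E2_ge0// rw.
  rewrite (lowerE _ (fun x => riem_norm kappa x (riem_grad kappa u x) ^+ 2))//.
  apply: (integral_lower_le_upper k0 n2 oO OM Oa vs Vs Hs v0 V0 riccati tw ut) => //.
  + move=> x Ox xa; apply: cont_norm_grad => //; last exact: OM.
    by move=> i y; exact: (@continuous_iter_partial _ _ _ _ ut [:: i]).
  + by move=> x Kx; rewrite norm_grad_off_support.
  + by move=> x; exact: sqr_ge0.
  + move=> x Ox xa; have It := I_rho x Ox xa.
    have rN : grad_rad kappa rho u x ^+ 2 <=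
        riem_norm kappa x (riem_grad kappa u x) ^+ 2.
      by apply: grad_rad_le => //; exact: OM.
    rewrite weightsE//.
    have wN := ler_wpM2r (sqr_ge0 (riem_norm kappa x (riem_grad kappa u x)))
      (weight_ge _ It).
    have e2 := E2_ge0 _ It.
    (* By [weightsE] the right-hand side is [riccati_weight * |grad u|^2 + E2 * (|grad u|^2 - r^2)],
       and the second term is nonnegative. *)
    apply: (le_trans wN); rewrite -subr_ge0.
    move: e2 rN; move: (E2 _ _ _ _) (riccati_weight _ _ _ _ _) (_ ^+ 2) (_ ^+ 2).
    by move=> e w r N e0; rewrite -subr_ge0 => /(mulr_ge0 e0); lra.
Qed.
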